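(* For every $n\ge 3$, the flip graph of (unlabeled) combinatorial 4-PPTs with $n$ vertices and triangular outer face is connected and has diameter $O(n^2)$, i.e., any two such combinatorial 4-PPTs can be transformed into each other by at most $Cn^2$ flips, for an absolute constant $C$.
   Context: An angle is a vertex–face incidence of a plane embedded graph. A combinatorial pseudo-triangulation is a combinatorial embedding in the plane (rotation system with designated outer face) of a connected planar simple graph, with a tag ''reflex'' or ''convex'' on each angle, such that every interior face has exactly three convex angles, all angles of the outer face are reflex, and no vertex is incident to more than one reflex angle; it is pointed if every vertex is incident to exactly one reflex angle. A combinatorial 4-PPT is a combinatorial pointed pseudo-triangulation whose interior faces all have size 3 or 4. Combinatorial 4-PPTs are considered up to isomorphism preserving embedding, outer face and tags. Flip: for an interior triangular face $\triangle$, an edge $e$ of $\triangle$ not on the outer face, the other face $F$ at $e$, and the region $R$ obtained by deleting $e$, a flip replaces $e$ by an edge $e'\ne e$ inside $R$ that splits $R$ into a triangular face and a face of the same size as $F$, such that the result (tags outside $R$ unchanged) is again a combinatorial 4-PPT; in particular $e'$ may not join two vertices already adjacent. The flip graph has these combinatorial 4-PPTs as vertices, two being adjacent if one is obtained from the other by a flip. *)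

(* Defs.v *)
From mathcomp Require Import all_boot all_fingroup.
Set Implicit Arguments. Unset Strict Implicit. Unset Printing Implicit Defensive.

(* A (candidate) embedded tagged graph on the vertex set 'I_n:
   - adj    : adjacency relation
   - rot v  : rotation at v; for a neighbour u of v, rot v u is the next
              neighbour of v in the cyclic (counterclockwise) order
   - odart  : a dart (ordered pair of adjacent vertices) lying on the outer face
   - reflex v u : tag of the angle at v between the edges vu and v(rot v u)
                  (true = reflex, false = convex).
   Values of rot / reflex outside of adjacent pairs are irrelevant junk. *)
Record emb (n : nat) := Emb {
  adj : rel 'I_n;
  rot : 'I_n -> 'I_n -> 'I_n;
  odart : 'I_n * 'I_n;
  reflex : 'I_n -> 'I_n -> bool }.

Section Defs.
Variable n : nat.
Implicit Types T U : emb n.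

(* face traversal on darts: (u,v) -> (v, rot v u); the angle traversed at v
   when passing the dart d = (u,v) is the angle (v,u). *)
Definition nxt T (d : 'I_n * 'I_n) : 'I_n * 'I_n := (d.2, rot T d.2 d.1).

Definition darts T : {set 'I_n * 'I_n} := [set d | adj T d.1 d.2].

Definition sface T (d d' : 'I_n * 'I_n) : bool := fconnect (nxt T) d d'.

Definition fsize T (d : 'I_n * 'I_n) : nat := fingraph.order (nxt T) d.

Definition faces T : {set {set 'I_n * 'I_n}} :=
  [set [set d' | sface T d d'] | d in darts T].

(* connected simple plane graph with a rotation system (genus 0 via Euler's
   formula V - E + F = 2) and a designated outer face *)
Definition is_plane T : Prop :=
  (forall u v, adj T u v = adj T v u) /\
  (forall u, ~~ adj T u u) /\
  (forall u v, connect (adj T) u v) /\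
  (forall v u, adj T v u -> adj T v (rot T v u)) /\
  (forall v u w, adj T v u -> adj T v w -> fconnect (rot T v) u w) /\
  adj T (odart T).1 (odart T).2 /\
  2 * n + 2 * #|faces T| = #|darts T| + 4.

Definition nconvex T (d : 'I_n * 'I_n) : nat :=
  #|[set d' | sface T d d' && ~~ reflex T d'.2 d'.1]|.

Definition is4PPT T : Prop :=
  [/\ is_plane T,
      (forall d, adj T d.1 d.2 -> ~~ sface T (odart T) d ->
          (fsize T d == 3) || (fsize T d == 4)),
      (forall d, adj T d.1 d.2 -> ~~ sface T (odart T) d -> nconvex T d = 3),
      (forall d, sface T (odart T) d -> reflex T d.2 d.1)
    &
      (forall v, #|[set u | adj T v u && reflex T v u]| = 1) ].

Definition tri4PPT T : Prop := is4PPT T /\ fsize T (odart T) = 3.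

Definition iso T U : Prop :=
  exists f : {perm 'I_n},
  [/\ (forall u v, adj U (f u) (f v) = adj T u v),
      (forall v u, adj T v u -> rot U (f v) (f u) = f (rot T v u)),
      (forall v u, adj T v u -> reflex U (f v) (f u) = reflex T v u)
    & sface U (odart U) (f (odart T).1, f (odart T).2) ].

(* deletion of the edge ab (tags are irrelevant and kept) *)
Definition del T (a b : 'I_n) : emb n :=
  Emb (fun u v => adj T u v && ~~ (((u == a) && (v == b)) || ((u == b) && (v == a))))
      (fun v u => let w := rot T v u in
                  if (v == a) && (w == b) then rot T a b
                  else if (v == b) && (w == a) then rot T b a else w)
      (odart T) (reflex T).

Definition same_emb (G H : emb n) : Prop :=
  [/\ (forall u v, adj G u v = adj H u v),
      (forall v u, adj G v u -> rot G v u = rot H v u)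
    & sface G (odart G) (odart H) ].

(* T' is obtained from T by a flip: the edge e = ab of the interior triangular
   face of dart (a,b) (e not on the outer face; F = face of (b,a)) is replaced by
   e' = a'b' (not an edge of T) drawn inside the region R = merged face of T - e
   (R is the face of T - e containing the dart following (a,b) in the triangle),
   splitting R into a triangle and a face of size |F|; tags outside R unchanged;
   the result is again a 4-PPT. *)
Definition flip T T' : Prop :=
  is4PPT T /\ is4PPT T' /\
  exists a b a' b' : 'I_n,
  adj T a b /\ ~~ adj T a' b' /\ adj T' a' b' /\
  fsize T (a, b) = 3 /\
  (~~ sface T (odart T) (a, b) /\ ~~ sface T (odart T) (b, a)) /\
  same_emb (del T a b) (del T' a' b') /\
  (sface T' (a', b') (nxt T (a, b)) \/ sface T' (b', a') (nxt T (a, b))) /\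
  ((fsize T' (a', b') = 3 /\ fsize T' (b', a') = fsize T (b, a)) \/
      (fsize T' (b', a') = 3 /\ fsize T' (a', b') = fsize T (b, a))) /\
    (forall v u, adj T v u -> ~~ sface T (a, b) (u, v) -> ~~ sface T (b, a) (u, v) ->
         reflex T' v u = reflex T v u).

(* adjacency in the flip graph of unlabeled combinatorial 4-PPTs with n vertices
   and triangular outer face (classes adjacent iff some representatives are
   related by a flip) *)
Definition fstep T U : Prop :=
  exists T1 U1, [/\ iso T T1, iso U U1, tri4PPT T1, tri4PPT U1 &
                    (flip T1 U1 \/ flip U1 T1)].

Fixpoint freach (k : nat) T U : Prop :=
  match k with
  | 0 => iso T U
  | k'.+1 => exists W, freach k' T W /\ fstep W U
  end.

End Defs.

(* Main.v *)
(** Let [T] be a combinatorial 4-PPT with triangular outer face.  Counting reflex angles and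
    using Euler's formula shows that exactly one interior face is a triangle and that all other
    interior faces are quadrangles with one reflex angle each.  Deleting an edge between the
    triangle and a quadrangle leaves a pentagon with a reflex vertex [r]; a flip cuts off an ear
    of this pentagon whose tip is not [r] and whose chord is not yet an edge.

    A 3-cycle separates the inner triangle from the outer face by parity, and Euler's formula
    on its two sides shows that its vertices have no reflex angle on the side of the triangle.
    As chords outside the pentagon do not cross, one of any two consecutive ears can be cut
    off.  Hence the triangle can be moved across any given edge by one flip, and anywhere in
    O(n) flips.

    Fix the outer edge [xy] and let [v] be the third outer vertex.  Sweeping the triangle once
    around [v] reduces the degree of [v] to 2 in O(n) flips.  Then [v] lies on a quadrangle
    [x v y w], and the same is done with [w] inside the 3-cycle [x w y], and so on.  After at
    most n rounds all vertices are adjacent to [x] and [y], which determines the 4-PPT. *)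

Require Import Defs.
From mathcomp Require Import all_boot all_fingroup.
From mathcomp Require Import zify.
From mathcomp Require Import all_algebra.
Import Defs.
Set Implicit Arguments. Unset Strict Implicit. Unset Printing Implicit Defensive.
Import GRing.Theory.

(** Planarity is given only by Euler's formula for a rotation system, so there is no curve to
    separate anything. The two sides of a 3-cycle are therefore a Boolean labelling of darts,
    constant on faces and changing exactly across the cycle; it exists because cycles bound in
    homology over F_2. Three facts about it are used: the side away from the outer face holds the
    inner triangle, labels are constant around vertices off the cycle, and no vertex of the cycle is
    reflex on that side.

    Boundary walks may repeat vertices, since an edge can have the same pentagon on both sides.
    Hence faces, regions and the finished part are sets of darts, and distinctness of corners is
    derived case by case, often from non-adjacency of the ends of the chord.

    The finished part is a union of faces, which flips in other faces leave alone.

    Costs: a simple path has at most 4n - 6 darts; a round takes at most 4n flips for transport and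
    2n + 2 for the sweep; there are at most n rounds after one initial transport. Both canonical
    embeddings are isomorphic and [fstep] is symmetric, so the second sequence is read backwards. *)

Definition rev_dart n (d : 'I_n * 'I_n) := (d.2, d.1).

(** * Faces and counting *)

Section Faces.
Variables (n : nat) (T : emb n).
Hypothesis plT : is_plane T.
Implicit Types (u v w : 'I_n) (d : 'I_n * 'I_n).

Lemma adjC u v : adj T u v = adj T v u. Proof. by case: plT => H _; apply: H. Qed.
Lemma adjxx u : adj T u u = false.
Proof. by case: plT => _ [H _]; apply/negbTE. Qed.
Lemma adj_neq u v : adj T u v -> u != v.
Proof. by apply: contraTneq => ->; rewrite adjxx. Qed.
Lemma adj_rot v u : adj T v u -> adj T v (rot T v u).
Proof. by case: plT => _ [_ [_ [H _]]]; apply: H. Qed.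
Lemma adj_connect u v : connect (adj T) u v.
Proof. by case: plT => _ [_ [H _]]. Qed.
Lemma rot_trans v u w : adj T v u -> adj T v w -> fconnect (rot T v) u w.
Proof. by case: plT => _ [_ [_ [_ [H _]]]]; apply: H. Qed.
Lemma odartP : odart T \in darts T.
Proof. by case: plT => _ [_ [_ [_ [_ [H _]]]]]; rewrite inE. Qed.
Lemma euler : 2 * n + 2 * #|faces T| = #|darts T| + 4.
Proof. by case: plT => _ [_ [_ [_ [_ [_ H]]]]]. Qed.

(** Transitivity of the rotation makes it surjective on the neighbours of [v], hence injective there
    by finiteness; its values elsewhere are arbitrary. *)
Lemma rot_inj v : {in adj T v &, injective (rot T v)}.
Proof.
move=> u w vu vw e; pose A := [set u | adj T v u].
have inA u' : (u' \in A) = adj T v u' by rewrite inE.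
have : A \subset rot T v @: A.
  apply/subsetP => z; rewrite inA => vz.
  have := rot_trans (adj_rot vz) vz => /iter_findex.
  case: (findex _ _ _) => [|k] /= E.
    by apply/imsetP; exists z; rewrite ?inA.
  rewrite -E; apply/imsetP; eexists; last by [].
  by rewrite inA; elim: (k) => /= [|j]; [apply: adj_rot | apply: adj_rot].
move/subset_leq_card => le; have/imset_injP inj : #|rot T v @: A| == #|A|.
  by rewrite eqn_leq leq_imset_card le.
by apply: inj; rewrite ?inA.
Qed.

Lemma adj_rot_inj v u w : adj T v u -> adj T v w -> rot T v u = rot T v w -> u = w.
Proof. by move=> vu vw; apply: rot_inj. Qed.

Lemma in_darts u v : ((u, v) \in darts T) = adj T u v. Proof. by rewrite inE. Qed.
Lemma rev_dartK : involutive (@rev_dart n). Proof. by case. Qed.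
Lemma rev_darts d : (rev_dart d \in darts T) = (d \in darts T).
Proof. by rewrite !inE /= adjC. Qed.
Lemma nxt_darts d : d \in darts T -> nxt T d \in darts T.
Proof. by rewrite !inE /= adjC => /adj_rot. Qed.
Lemma nxt_inj : {in darts T &, injective (nxt T)}.
Proof.
move=> [u v] [u' v']; rewrite !inE /= => h h'; rewrite /nxt /= => -[e].
by subst v' => /rot_inj H; congr (_, _); apply: H; rewrite -topredE /= adjC.
Qed.

Lemma sface_refl d : sface T d d. Proof. exact: connect0. Qed.
Lemma sface_nxt d : sface T d (nxt T d). Proof. exact: fconnect1. Qed.
(** [sface] is forward reachability; injectivity of [nxt] on darts makes it symmetric there. *)
Lemma sface_sym d d' : d \in darts T -> d' \in darts T -> sface T d d' = sface T d' d.
Proof. exact: (fconnect_sym_in nxt_darts nxt_inj). Qed.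
Lemma sface_trans d2 d1 d3 : sface T d1 d2 -> sface T d2 d3 -> sface T d1 d3.
Proof. exact: connect_trans. Qed.
Lemma sface_darts d d' : d \in darts T -> sface T d d' -> d' \in darts T.
Proof.
move=> dd /iter_findex <-; elim: (findex _ _ _) => //= k; exact: nxt_darts.
Qed.
Lemma sface_nxtr d d' : d \in darts T -> d' \in darts T ->
  sface T d (nxt T d') = sface T d d'.
Proof.
move=> h h'; apply/idP/idP => H; last exact: sface_trans H (sface_nxt _).
by apply: sface_trans H _; rewrite sface_sym ?nxt_darts // sface_nxt.
Qed.

Definition face d := [set d' | sface T d d'].

Lemma mem_face d d' : (d' \in face d) = sface T d d'. Proof. by rewrite inE. Qed.
Lemma faceE d d' : d \in darts T -> d' \in darts T -> (face d == face d') = sface T d d'.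
Proof.
move=> h h'; apply/eqP/idP => [e|s].
  by rewrite -mem_face e mem_face sface_refl.
have s' : sface T d' d by rewrite sface_sym.
by apply/setP => z; rewrite !inE; apply/idP/idP; apply: sface_trans.
Qed.
Lemma card_face d : #|face d| = fsize T d.
Proof. by apply: eq_card => z; rewrite inE. Qed.
Lemma mem_faces d : d \in darts T -> face d \in faces T.
Proof. by move=> h; apply: imset_f. Qed.
Lemma facesP A : reflect (exists2 d, d \in darts T & A = face d) (A \in faces T).
Proof. exact: imsetP. Qed.

Lemma faces_partition : partition (faces T) (darts T).
Proof.
apply/and3P; split.
- apply/eqP/setP => z; apply/bigcupP/idP => [[A /facesP[d h ->]]|h].
    by rewrite mem_face; apply: sface_darts.
  by exists (face z); rewrite ?mem_faces ?mem_face ?sface_refl.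
- apply/trivIsetP => A B /facesP[d h ->] /facesP[d' h' ->].
  apply: contraNT => /pred0Pn[z /= /andP[]]; rewrite !mem_face => s s'.
  rewrite faceE //; apply: sface_trans s _.
  by rewrite sface_sym // (sface_darts h').
- by apply/negP => /facesP[d _] /setP/(_ d); rewrite inE mem_face sface_refl.
Qed.

Lemma sum_faces (E : 'I_n * 'I_n -> nat) :
  \sum_(d in darts T) E d = \sum_(A in faces T) \sum_(d in A) E d.
Proof. exact: set_partition_big faces_partition. Qed.

(** A set of darts closed under [nxt] is a union of faces. *)
Lemma card_face_closed (X : {set 'I_n * 'I_n}) : X \subset darts T ->
  (forall d, d \in X -> nxt T d \in X) ->
  #|X| = \sum_(A in faces T | A \subset X) #|A|.
Proof.
move=> XD cX; have cXf d d' : d \in X -> sface T d d' -> d' \in X.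
  by move=> dX /iter_findex <-; elim: (findex _ _ _) => //= k; apply: cX.
rewrite -sum1_card -(setIidPr XD).
transitivity (\sum_(d in darts T) (d \in X : nat)).
  by rewrite [RHS]big_mkcond [LHS]big_mkcond /=; apply: eq_bigr => d _; rewrite in_setI; case: (_ \in darts _); case: (_ \in X).
rewrite (setIidPr XD) sum_faces big_mkcondr; apply: eq_bigr => _ /facesP[d h ->].
case: ifP => [/subsetP s|/negP s]; first rewrite -sum1_card.
  by apply: eq_bigr => z /s ->.
rewrite big1 // => z zd; case zX: (z \in X) => //; case: s.
apply/subsetP => w; rewrite mem_face => dw; apply: cXf zX _.
rewrite mem_face in zd; apply: sface_trans dw.
by rewrite sface_sym // (sface_darts h).
Qed.

(** [nxt] followed by reversal is rotation about a vertex, so the closure spreads around each vertex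
    it meets and, by connectedness, to all vertices. This also provides connectedness of the dual
    graph. *)
Lemma darts_closed_full (X : {set 'I_n * 'I_n}) d0 : X \subset darts T ->
  (forall d, d \in X -> nxt T d \in X) -> (forall d, d \in X -> rev_dart d \in X) ->
  d0 \in X -> X = darts T.
Proof.
move=> XD cn cr d0X; apply/eqP; rewrite eqEsubset XD /=.
have rotX u v k : (u, v) \in X -> (iter k (rot T v) u, v) \in X.
  by elim: k => //= k IH /IH /cn /cr.
have allX u v w : (u, v) \in X -> adj T v w -> (w, v) \in X.
  move=> uv vw; have/rot_trans/(_ vw)/iter_findex <- : adj T v u.
    by have:= subsetP XD _ uv; rewrite inE /= adjC.
  exact: rotX.
have reach v : exists u, (u, v) \in X.
  have /connectP[p pp ->] := adj_connect d0.2 v.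
  have: exists u, (u, d0.2) \in X by exists d0.1; case: (d0) d0X.
  elim: p d0.2 pp => //= w p IH z /andP[zw pp] [u uz]; apply: IH pp _.
  by exists z; apply: (cr (w, z)); apply: allX uz zw.
apply/subsetP => -[w v]; rewrite inE /= adjC => vw.
by have [u uv] := reach v; apply: allX uv vw.
Qed.

End Faces.

(** * Counting reflex angles in a 4-PPT *)

Section Count.
Variables (n : nat) (T : emb n).
Hypothesis triT : tri4PPT T.
Implicit Types (u v w : 'I_n) (d : 'I_n * 'I_n).

Lemma tri_plane : is_plane T. Proof. by case: triT => -[]. Qed.
Let plT := tri_plane.

Definition rdarts := [set d in darts T | reflex T d.2 d.1].

Lemma fsize_outer : fsize T (odart T) = 3. Proof. by case: triT. Qed.
Lemma fsize_inner d : d \in darts T -> ~~ sface T (odart T) d ->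
  (fsize T d == 3) || (fsize T d == 4).
Proof. by case: triT => -[_ H _ _ _] _; rewrite inE; apply: H. Qed.
Lemma outer_reflex d : sface T (odart T) d -> reflex T d.2 d.1.
Proof. by case: triT => -[_ _ _ H _] _; apply: H. Qed.
Lemma vertex_reflex v : #|[set u | adj T v u && reflex T v u]| = 1.
Proof. by case: triT => -[_ _ _ _ H] _; apply: H. Qed.

Lemma reflex_uniq v u w : adj T v u -> reflex T v u -> adj T v w -> reflex T v w -> u = w.
Proof.
move=> a1 r1 a2 r2; have /eqP/cards1P[z Z] := vertex_reflex v.
have: u \in [set z] by rewrite -Z inE a1.
have: w \in [set z] by rewrite -Z inE a2.
by rewrite !inE => /eqP-> /eqP->.
Qed.

Lemma reflex_exists v : exists2 u, adj T v u & reflex T v u.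
Proof.
have /eqP/cards1P[z Z] := vertex_reflex v.
have: z \in [set z] by rewrite inE.
by rewrite -Z inE => /andP[]; exists z.
Qed.

(** Taking heads is a bijection onto the vertices, by pointedness. *)
Lemma card_rdarts : #|rdarts| = n.
Proof.
rewrite -[RHS]card_ord -cardsT.
have <- : snd @: rdarts = [set: 'I_n].
  apply/setP => v; rewrite inE; apply/imsetP.
  by have [u vu r] := reflex_exists v; exists (u, v) => //; rewrite !inE /= r adjC ?vu.
rewrite card_in_imset // => -[u v] [u' v']; rewrite !inE /= => /andP[a r] /andP[a' r'] e.
  subst v'; congr (_, _); apply: (reflex_uniq _ r _ r'); by rewrite adjC.
Qed.

Lemma card_face_reflex d : d \in darts T -> ~~ sface T (odart T) d ->
  #|face T d :&: rdarts| + 3 = #|face T d|.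
Proof.
move=> h i; rewrite -(cardsID rdarts (face T d)); congr (_ + _).
have [_ _ H _ _] := triT.1; have := H d; rewrite inE in h.
move=> /(_ h i) <-; rewrite /nconvex; apply: eq_card => z.
rewrite !inE; case s: (sface _ _ _) => //=; rewrite ?andbF // andbT.
by have := sface_darts plT (_ : d \in darts T) s; rewrite !inE => /(_ h) ->.
Qed.

Lemma outer_face_reflex : #|face T (odart T) :&: rdarts| = 3.
Proof.
rewrite -fsize_outer -card_face; congr #|pred_of_set _|; apply/setIidPl/subsetP => d.
rewrite mem_face => s; rewrite inE outer_reflex // andbT.
exact: sface_darts (odartP plT) s.
Qed.

Let ofc := face T (odart T).
Lemma outer_in_faces : ofc \in faces T.
Proof. exact/mem_faces/odartP. Qed.

Lemma not_outer A : A \in faces T -> A != ofc ->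
  exists2 d, d \in darts T & ~~ sface T (odart T) d /\ A = face T d.
Proof.
move=> /facesP[d h ->] ne; exists d => //; split=> //.
by move: ne; rewrite eq_sym (faceE plT) ?(odartP plT).
Qed.

Lemma sum_rdarts : n = \sum_(A in faces T) #|A :&: rdarts|.
Proof.
transitivity #|rdarts|; first by rewrite card_rdarts.
transitivity (\sum_(d in darts T) (d \in rdarts : nat)).
  rewrite -sum1_card [RHS]big_mkcond [LHS]big_mkcond /=; apply: eq_bigr => d _.
  by rewrite inE; case: (d \in darts T) => //=; case: (reflex _ _ _).
rewrite (sum_faces plT); apply: eq_bigr => A _.
rewrite -sum1_card [RHS]big_mkcond [LHS]big_mkcond /=; apply: eq_bigr => d _.
by rewrite in_setI; case: (d \in A); case: (_ \in rdarts).
Qed.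

(** Summing size = 3 + number of reflex angles over the inner faces gives darts = 3 + (n - 3) + 3
    (faces - 1); together with Euler's formula this determines both numbers. *)
Lemma card_faces_darts : #|faces T| + 1 = n /\ #|darts T| + 6 = 4 * n.
Proof.
have E := euler plT.
have H : \sum_(A in faces T :\ ofc) (#|A :&: rdarts| + 3) = \sum_(A in faces T :\ ofc) #|A|.
  apply: eq_bigr => A; rewrite in_setD1 => /andP[ne AF].
  by have [d h [i ->]] := not_outer AF ne; apply: card_face_reflex.
have S := sum_rdarts; rewrite (big_setD1 ofc) ?outer_in_faces //= outer_face_reflex in S.
have D : #|darts T| = \sum_(A in faces T) #|A|.
  by rewrite -sum1_card (sum_faces plT); apply: eq_bigr => A _; rewrite sum1_card.
rewrite (big_setD1 ofc) ?outer_in_faces //= card_face fsize_outer in D.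
have F := cardsD1 ofc (faces T); rewrite outer_in_faces in F.
rewrite big_split /= sum_nat_const in H.
move: E S D F H; move: #|faces T| #|darts T| #|faces T :\ ofc|.
by move: (\sum_(A in _) _) (\sum_(A in _) _) => s1 s2 f d m E S D F H; split; lia.
Qed.

Lemma card_inner : #|faces T :\ ofc| + 2 = n.
Proof.
have [F _] := card_faces_darts; move: F.
by rewrite (cardsD1 ofc) outer_in_faces /= add1n addn1 addn2.
Qed.

Lemma sum_inner_reflex : \sum_(A in faces T :\ ofc) #|A :&: rdarts| + 3 = n.
Proof.
have := sum_rdarts; rewrite (big_setD1 ofc) ?outer_in_faces //= outer_face_reflex.
by move=> e; rewrite [RHS]e addnC.
Qed.

Lemma inner_reflex_tri A : A \in faces T :\ ofc -> #|A :&: rdarts| + (#|A| == 3) = 1.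
Proof.
rewrite in_setD1 => /andP[ne AF]; have [d h [i ->]] := not_outer AF ne.
have := card_face_reflex h i; rewrite card_face.
by move: #|_ :&: _| => k; case/orP: (fsize_inner h i) => /eqP -> /=; lia.
Qed.

(** There are n - 2 inner faces and n - 3 reflex angles in them, and by [inner_reflex_tri] an inner
    face without a reflex angle is a triangle. *)
Lemma card_triangles : #|[set A in faces T :\ ofc | #|A| == 3]| = 1.
Proof.
have S : \sum_(A in faces T :\ ofc) (#|A :&: rdarts| + (#|A| == 3)) = #|faces T :\ ofc|.
  by rewrite -sum1_card; apply: eq_bigr => A; apply: inner_reflex_tri.
rewrite big_split /= in S; have := sum_inner_reflex; have := card_inner.
have -> : #|[set A in faces T :\ ofc | #|A| == 3]| = \sum_(A in faces T :\ ofc) (#|A| == 3).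
  rewrite -sum1_card [RHS]big_mkcond [LHS]big_mkcond; apply: eq_bigr => A _.
  by rewrite inE; case: (A \in _) => //=; case: (_ == 3).
rewrite -S; move: (\sum_(A in _) _) (\sum_(A in _) _) => s1 s2; lia.
Qed.

(** The triangle is located by any of its darts; [inner3_uniq] makes this unambiguous. *)
Definition inner3 d := [&& d \in darts T, ~~ sface T (odart T) d & fsize T d == 3].

Lemma inner3_face d : inner3 d -> face T d \in [set A in faces T :\ ofc | #|A| == 3].
Proof.
case/and3P=> h i t; rewrite !inE card_face t mem_faces // !andbT eq_sym.
by rewrite (faceE plT) ?(odartP plT).
Qed.

Lemma inner3_uniq d d' : inner3 d -> inner3 d' -> sface T d d'.
Proof.
move=> h h'; have /eqP/cards1P[A E] := card_triangles.
have := inner3_face h; have := inner3_face h'; rewrite E !inE => /eqP <- /eqP e.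
by case/and3P: h h' => h _ _ /and3P[h' _ _]; rewrite -faceE // e.
Qed.

Lemma inner3_exists : exists d, inner3 d.
Proof.
have /eqP/cards1P[A E] := card_triangles.
have : A \in [set A] by rewrite inE.
rewrite -E inE in_setD1 => /andP[/andP[ne AF] A3].
by have [d h [i e]] := not_outer AF ne; exists d; apply/and3P; rewrite -card_face -e.
Qed.

Lemma inner4 d : d \in darts T -> ~~ sface T (odart T) d -> ~~ inner3 d -> fsize T d = 4.
Proof.
move=> h i; rewrite /inner3 h i /= => /negbTE t.
by have:= fsize_inner h i; rewrite t /= => /eqP.
Qed.

Lemma iter_nxt_fsize d : d \in darts T -> iter (fsize T d) (nxt T) d = d.
Proof. exact: (iter_order_in (nxt_darts plT) (nxt_inj plT)). Qed.
End Count.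

(** * Homology mod 2 and the two sides of a 3-cycle *)

Section Incidence.
Local Open Scope ring_scope.

Lemma addF2_eq0 (x y : 'F_2) : x + y = 0 -> x = y.
Proof.
have c2 : 2 \in [pchar 'F_2] by rewrite pchar_Fp.
by move/eqP; rewrite addr_eq0 oppr_pchar2 // => /eqP.
Qed.

Variables (E V : finType) (s t : E -> V) (D : {set E}) (C : {set V}).

(** Adding the indicators of both ends lets loops vanish mod 2; they occur in the dual graph, at
    edges with the same face on both sides. *)
Definition incidence : 'M['F_2]_(#|D|, #|C|) :=
  \matrix_(i, j) ((enum_val j == s (enum_val i))%:R + (enum_val j == t (enum_val i))%:R).

(** A row vector killed by the transpose is a function on [C], extended by 0, that agrees at both
    ends of every edge. The hypothesis kills it; in the applications it comes from connectedness to
    a base point outside [C]. *)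
Lemma rank_incidence :
  (forall g : V -> 'F_2, (forall e, e \in D -> g (s e) = g (t e)) ->
     (forall v, v \notin C -> g v = 0) -> forall v, v \in C -> g v = 0) ->
  \rank incidence = #|C|.
Proof.
move=> H; rewrite -mxrank_tr; apply/eqP; rewrite -/(row_free _) -kermx_eq0.
apply/rowV0P => x /sub_kermxP xM.
pose g v : 'F_2 := \sum_j (enum_val j == v)%:R * x 0 j.
have gst e : e \in D -> g (s e) = g (t e).
  move=> eD; apply: addF2_eq0; have /rowP/(_ (enum_rank_in eD e)) := xM.
  rewrite !mxE => <-; rewrite /g -big_split /=; apply: eq_bigr => j _.
  by rewrite !mxE enum_rankK_in // -mulrDl mulrC.
have g0 v : v \notin C -> g v = 0.
  move=> vC; rewrite /g big1 // => j _; case: eqP => [e|]; rewrite ?mul0r //.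
  by rewrite -e enum_valP in vC.
apply/rowP => j; rewrite mxE -(H g gst g0 (enum_val j) (enum_valP j)).
rewrite /g (bigD1 j) //= eqxx mul1r big1 ?addr0 // => i ij.
by rewrite (inj_eq enum_val_inj) (negbTE ij) mul0r.
Qed.
End Incidence.

Section Homology.
Variables (n : nat) (T : emb n).
Hypothesis plT : is_plane T.
Implicit Types (u v w : 'I_n) (d : 'I_n * 'I_n).

(* one dart per edge, the increasing one *)
Definition odarts := [set d in darts T | d.1 < d.2].

Lemma sum_odarts (R : nmodType) (P : pred ('I_n * 'I_n)) (h : 'I_n * 'I_n -> R) :
  (forall d, d \in darts T -> P (rev_dart d) = P d) ->
  (\sum_(d in darts T | P d) h d = \sum_(d in odarts | P d) (h d + h (rev_dart d)))%R.
Proof.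
move=> Ps; rewrite big_split /= (bigID (fun d : 'I_n * 'I_n => d.1 < d.2)) /=.
congr (_ + _)%R; first by apply: eq_bigl => d; rewrite !inE andbAC.
rewrite (reindex_inj (inv_inj (@rev_dartK n))) /=; apply: eq_bigl => d.
rewrite (rev_darts plT) !inE; case h1: (adj T d.1 d.2) => //=.
have := adj_neq plT h1; rewrite -val_eqE /= Ps ?inE // => ne.
by case: (P d); rewrite ?andbF //= ?andbT; lia.
Qed.

Lemma sum_odarts_nat (h : 'I_n * 'I_n -> nat) :
  \sum_(d in darts T) h d = \sum_(d in odarts) (h d + h (rev_dart d)).
Proof.
have := @sum_odarts nat xpredT h (fun _ _ => erefl).
rewrite (eq_bigl (fun d => d \in darts T)) => [->|d]; last by rewrite andbT.
by apply: eq_bigl => d; rewrite andbT.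
Qed.

Lemma card_odarts : #|odarts| * 2 = #|darts T|.
Proof.
by rewrite -[RHS]sum1_card sum_odarts_nat sum_nat_const.
Qed.

Lemma const_on_darts (R : eqType) (g : 'I_n -> R) :
  (forall d, d \in darts T -> g d.1 = g d.2) -> forall u v, g u = g v.
Proof.
move=> H u v; have /connectP[p pp ->] := adj_connect plT u v.
elim: p u pp => //= w p IH u /andP[uw /IH <-].
by apply: (H (u, w)); rewrite inE.
Qed.

(** Connectedness of the dual graph, in the form needed for [rank_incidence]. *)
Lemma const_on_faces (R : eqType) (g : {set 'I_n * 'I_n} -> R) :
  (forall d, d \in darts T -> g (face T d) = g (face T (rev_dart d))) ->
  forall d d', d \in darts T -> d' \in darts T -> g (face T d) = g (face T d').
Proof.
move=> H d d' dD d'D; pose X := [set z in darts T | g (face T z) == g (face T d)].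
have XE z : (z \in X) = (z \in darts T) && (g (face T z) == g (face T d)) by rewrite in_set.
have : X = darts T.
  apply: (@darts_closed_full _ _ plT _ d).
  - by apply/subsetP => z; rewrite XE => /andP[].
  - move=> z; rewrite !XE => /andP[zD /eqP <-]; rewrite nxt_darts //=.
    suff /eqP <- : face T z == face T (nxt T z) by [].
    by rewrite faceE ?sface_nxt // nxt_darts.
  - by move=> z; rewrite !XE => /andP[zD /eqP <-]; rewrite rev_darts // zD -H //=.
  - by rewrite XE eqxx dD.
by move/setP/(_ d'); rewrite XE d'D => /eqP.
Qed.

Section Restricted.
(** A set [P] of edges containing all edges of the faces in [Cf], and a set [Cv] of vertices: the
    whole embedding in [cycle_bounds], one side of a 3-cycle in [card_Cv]. *)
Variables (P : pred ('I_n * 'I_n)) (Cf : {set {set 'I_n * 'I_n}}) (Cv : {set 'I_n}).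
Hypothesis Ps : forall d, d \in darts T -> P (rev_dart d) = P d.
Hypothesis CfP : forall A d, A \in Cf -> d \in A -> P d.
Hypothesis CfF : Cf \subset faces T.

Definition edges_in := [set d in odarts | P d].
Definition dual_inc := incidence (face T) (fun d => face T (rev_dart d)) edges_in Cf.
Definition prim_inc := incidence fst snd edges_in Cv.
Local Open Scope ring_scope.

(** The entry at a face and a vertex counts mod 2 the edge ends of the face walk at that vertex, and
    a closed walk leaves a vertex as often as it enters it. *)
Lemma boundary_boundary : dual_inc^T *m prim_inc = 0.
Proof.
apply/matrixP => i j; rewrite !mxE.
set A := enum_val i; set v := enum_val j.
have AC : A \in Cf := enum_valP i.
have /facesP[a aD Aa] : A \in faces T by apply: (subsetP CfF).
pose k d : 'F_2 := (v == d.1)%:R + (v == d.2)%:R.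
pose h d : 'F_2 := (d \in A)%:R * k d.
have AD d : d \in A -> d \in darts T.
  by rewrite Aa mem_face; apply: sface_darts.
have memA d : d \in darts T -> (A == face T d) = (d \in A).
  by move=> dD; rewrite Aa (faceE plT) // mem_face.
transitivity (\sum_(d in odarts | P d) (h d + h (rev_dart d))).
  rewrite [RHS](eq_bigl (fun d => d \in edges_in)); last by move=> d; rewrite [RHS]in_set.
  rewrite [RHS]big_enum_val; apply: eq_bigr => l _; rewrite !mxE.
  have := enum_valP l; rewrite in_set => /andP[]; rewrite in_set => /andP[dD _] _.
  rewrite !memA ?rev_darts // /h /k /= [X in _ = _ + _ * X]addrC -mulrDl //.
rewrite -(sum_odarts _ Ps).
transitivity (\sum_(d in A) k d).
  rewrite [LHS]big_mkcond [RHS]big_mkcond; apply: eq_bigr => d _.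
  rewrite /h; case dA: (d \in A); rewrite ?mul0r ?if_same // mul1r.
  by rewrite AD // (CfP AC dA).
(* [nxt] permutes [A] and makes the head of a dart the tail of the next one, so the two sums agree
   and cancel mod 2. *)
rewrite big_split /= [X in X + _](_ : _ = \sum_(d in A) (v == d.2)%:R).
  by rewrite -mulr2n -mulr_natl (_ : 2%:R = 0) ?mul0r //; apply/val_inj.
have nA d : d \in A -> nxt T d \in A.
  by rewrite Aa !mem_face => /sface_trans; apply; apply: sface_nxt.
have nAA : nxt T @: A = A.
  apply/eqP; rewrite eqEcard card_in_imset ?leqnn ?andbT.
    by apply/subsetP => _ /imsetP[d /nA dA ->].
  by move=> d d' /AD dD /AD d'D; apply: nxt_inj.
rewrite -[in LHS]nAA big_imset //= => d d' /AD dD /AD d'D; exact: nxt_inj.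
Qed.
End Restricted.

Lemma F2_cases (x : 'F_2) : x = 0%R \/ x = 1%R.
Proof. by case: x => -[|[|//]] lt; [left | right]; apply: val_inj. Qed.

(* The Jordan curve theorem mod 2: the face boundaries lie in the cycle space, and by Euler's
   formula both have dimension #|faces T| - 1. *)
Lemma cycle_bounds (sg : 'I_n * 'I_n -> bool) :
  (forall d, sg (rev_dart d) = sg d) ->
  (forall v, ~~ odd #|[set d in darts T | sg d && (v == d.2)]|) ->
  exists lam : 'I_n * 'I_n -> bool, forall d, d \in darts T ->
    lam (nxt T d) = lam d /\ lam (rev_dart d) = lam d (+) sg d.
Proof.
move=> sgs even; pose Cf := faces T :\ face T (odart T); pose Cv := [set~ (odart T).1].
have oD := odartP plT.
have CfF : Cf \subset faces T by apply: subD1set.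
pose P (d : 'I_n * 'I_n) := true.
have eE : #|edges_in P| = #|odarts| by apply: eq_card => d; rewrite [LHS]in_set andbT.
(* The outer face and one vertex are left out as base points; connectedness then gives full rank. *)
have rd : \rank (dual_inc P Cf) = #|Cf|.
  apply: rank_incidence => g gE g0 A /(subsetP CfF)/facesP[d dD ->].
  rewrite (@const_on_faces _ g _ d (odart T)) //.
    by apply: g0; rewrite in_setD1 eqxx.
  move=> d' d'D; have := adj_neq plT (_ : adj T d'.1 d'.2); rewrite -val_eqE /= neq_ltn.
  have := d'D; rewrite {1}inE => -> /(_ isT)/orP[lt|lt].
    by apply: gE; rewrite !inE andbT -in_darts -surjective_pairing d'D.
  have := gE (rev_dart d'); rewrite rev_dartK => -> //.
  by rewrite in_set andbT in_set rev_darts // d'D.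
have rp : \rank (prim_inc P Cv) = #|Cv|.
  apply: rank_incidence => g gE g0 v _.
  rewrite (@const_on_darts _ g _ v (odart T).1).
    by apply: g0; rewrite !inE eqxx.
  move=> d' d'D; have := adj_neq plT (_ : adj T d'.1 d'.2); rewrite -val_eqE /= neq_ltn.
  have := d'D; rewrite {1}inE => -> /(_ isT)/orP[lt|lt].
    by apply: gE; rewrite !inE andbT -in_darts -surjective_pairing d'D.
  have /= -> // := gE (rev_dart d').
  by rewrite in_set andbT in_set rev_darts // d'D.
have bb : (trmx (dual_inc P Cf) <= kermx (prim_inc P Cv))%MS.
  by rewrite sub_kermx boundary_boundary.
have {bb} : (kermx (prim_inc P Cv) <= trmx (dual_inc P Cf))%MS.
  rewrite -(mxrank_leqif_sup bb) mxrank_ker mxrank_tr rd rp eE.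
  have := cardsD1 (face T (odart T)) (faces T); rewrite mem_faces // -/Cf.
  have := cardsC1 (odart T).1; rewrite card_ord -/Cv => ->.
  have := euler plT; have := card_odarts; move: #|odarts| #|darts T| #|faces T| #|Cf|.
  have := leq_ltn_trans (leq0n _) (ltn_ord (odart T).1).
  by clear; case: n => // k _ e d f c; rewrite /= => h1 h2 h3; apply/eqP; lia.
pose row : 'rV['F_2]_(#|edges_in P|) := (\row_i (sg (enum_val i))%:R)%R.
have : (row <= kermx (prim_inc P Cv))%MS.
  rewrite sub_kermx; apply/eqP/rowP => j; rewrite !mxE.
  set v := enum_val j.
  pose h d : 'F_2 := ((sg d && (v == d.2))%:R)%R.
  transitivity (\sum_(d in odarts | P d) (h d + h (rev_dart d)))%R.
    rewrite [RHS](eq_bigl (fun d => d \in edges_in P)); last by move=> d; rewrite [RHS]in_set.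
    rewrite [RHS]big_enum_val; apply: eq_bigr => l _; rewrite !mxE /h /= sgs.
    by case: (sg _) => /=; rewrite ?mul0r ?mul1r ?addr0 // addrC.
  rewrite -sum_odarts // /h.
  have -> : (\sum_(d in darts T | P d) (sg d && (v == d.2))%:R = 
            #|[set d in darts T | sg d && (v == d.2)]|%:R :> 'F_2)%R.
    rewrite -sum1_card natr_sum [LHS]big_mkcond [RHS]big_mkcond; apply: eq_bigr => d _.
    by rewrite in_set andbT; case: (d \in _) => //=; case: (sg d && _).
  have := even v; move: #|_| => k; rewrite -[in X in _ -> X](odd_double_half k) => /negbTE ->.
  by rewrite add0n -mul2n natrM (_ : 2%:R = 0)%R ?mul0r //; apply: val_inj.
move=> s1 s2; have := submx_trans s1 s2 => /submxP[x xE].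
(* [x] writes the cycle as a sum of face boundaries; [mu] is its coefficient at a face, and 0 at the
   outer face, which is not in [Cf]. *)
pose mu A := (\sum_j (enum_val j == A)%:R * x 0 j)%R : 'F_2.
have muE d : d \in darts T -> (mu (face T d) + mu (face T (rev_dart d)) = (sg d)%:R)%R.
  move=> dD; wlog lt : d dD / d.1 < d.2 => [W|].
    have := adj_neq plT (_ : adj T d.1 d.2); rewrite -val_eqE /= neq_ltn.
    have := dD; rewrite {1}inE => -> /(_ isT)/orP[lt|lt]; first exact: W.
    by rewrite addrC -sgs -W ?rev_dartK // rev_darts.
  have dE : d \in edges_in P by rewrite in_set andbT in_set dD.
  have /rowP/(_ (enum_rank_in dE d)) := xE; rewrite !mxE enum_rankK_in // => ->.
  rewrite /mu -big_split /=; apply: eq_bigr => j _.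
  by rewrite !mxE enum_rankK_in // -mulrDl mulrC.
exists (fun d => mu (face T d) != 0%R) => d dD; split.
  suff /eqP <- : face T d == face T (nxt T d) by [].
  by rewrite faceE ?sface_nxt // nxt_darts.
have := muE d dD; case: (F2_cases (mu (face T d))) => ->; case: (F2_cases (mu (face T (rev_dart d)))) => ->; by case: (sg d).
Qed.
End Homology.

Section ThreeCycle.
Variables (n : nat) (T : emb n).
Hypothesis triT : tri4PPT T.
Let plT := tri_plane triT.
Implicit Types (u v w : 'I_n) (d : 'I_n * 'I_n).
Variables a b c : 'I_n.
Hypotheses (ab : adj T a b) (bc : adj T b c) (ca : adj T c a).

Definition cyc3 := [:: (a, b); (b, a); (b, c); (c, b); (c, a); (a, c)].
Let sg d := d \in cyc3.

Lemma cyc3_rev d : (rev_dart d \in cyc3) = (d \in cyc3).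
Proof.
case: d => u v; rewrite !inE /rev_dart /= !xpair_eqE.
by do 6![case: (_ == _)].
Qed.

Lemma cyc3_uniq : uniq cyc3.
Proof.
have := adj_neq plT ab; have := adj_neq plT bc; have := adj_neq plT ca.
rewrite /= !inE !xpair_eqE (eq_sym c a) (eq_sym c b) (eq_sym b a) !eqxx.
by do 3![case: (_ == _) => //=].
Qed.

Lemma cyc3_darts d : d \in cyc3 -> d \in darts T.
Proof.
have [ba cb ac] : [/\ adj T b a, adj T c b & adj T a c] by split; rewrite adjC.
by rewrite [d \in darts T]inE !inE; do ![case/predU1P => [->|] //]; move/eqP ->.
Qed.

Lemma card_cyc3 (p : pred ('I_n * 'I_n)) :
  #|[set d in darts T | sg d && p d]| = count p cyc3.
Proof.
rewrite -size_filter -(card_uniqP _) ?filter_uniq ?cyc3_uniq //.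
apply: eq_card => d; rewrite in_set mem_filter /sg.
by case s: (d \in cyc3); rewrite ?andbF //= andbT cyc3_darts.
Qed.

Lemma sum_odarts_cyc3 : \sum_(d in odarts T) (sg d : nat) = 3.
Proof.
have := card_cyc3 xpredT; rewrite count_predT /= => C.
have : \sum_(d in darts T) (sg d : nat) = 6.
  rewrite -C -sum1_card [LHS]big_mkcond [RHS]big_mkcond; apply: eq_bigr => d _.
  by rewrite in_set andbT; case: (d \in _); case: (sg d).
have e2 : \sum_(d in odarts T) (sg d + sg (rev_dart d)) = 2 * \sum_(d in odarts T) sg d.
  by rewrite big_distrr /=; apply: eq_bigr => d _; rewrite /sg cyc3_rev addnn mul2n.
by rewrite sum_odarts_nat // e2 => E; apply/eqP; rewrite -(eqn_pmul2l (isT : 0 < 2)) E.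
Qed.

Lemma cyc3_even v : ~~ odd #|[set d in darts T | sg d && (v == d.2)]|.
Proof.
rewrite card_cyc3 /= !oddD.
by do 3![case: (v == _) => //=].
Qed.

(** Adding a constant to the labelling makes the outer face false, so that true means the side away
    from it. *)
Lemma cyc3_label : exists lam : 'I_n * 'I_n -> bool,
  [/\ forall d, d \in darts T -> lam (nxt T d) = lam d,
      forall d, d \in darts T -> lam (rev_dart d) = lam d (+) (d \in cyc3)
    & lam (odart T) = false].
Proof.
have [lam H] := cycle_bounds plT cyc3_rev cyc3_even.
exists (fun d => lam d (+) lam (odart T)); split=> [d /H[-> _] //|d /H[_ ->]|].
  by rewrite addbAC.
exact: addbb.
Qed.

Variable lam : 'I_n * 'I_n -> bool.
Hypothesis lamn : forall d, d \in darts T -> lam (nxt T d) = lam d.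
Hypothesis lamr : forall d, d \in darts T -> lam (rev_dart d) = lam d (+) (d \in cyc3).
Hypothesis lamo : lam (odart T) = false.

Lemma lam_sface d d' : d \in darts T -> sface T d d' -> lam d' = lam d.
Proof.
move=> dD /iter_findex <-; elim: (findex _ _ _) => //= k IH.
rewrite lamn // (sface_darts plT dD) //; exact: fconnect_iter.
Qed.

Let X := [set d in darts T | lam d].
Let Y := [set d in darts T | ~~ lam d].

Lemma X_closed d : d \in X -> nxt T d \in X.
Proof. by rewrite !(in_set (fun _ => _ && _)) => /andP[dD l]; rewrite nxt_darts // lamn. Qed.
Lemma Y_closed d : d \in Y -> nxt T d \in Y.
Proof. by rewrite !(in_set (fun _ => _ && _)) => /andP[dD l]; rewrite nxt_darts // lamn. Qed.
Lemma face_subX d : d \in darts T -> (face T d \subset X) = lam d.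
Proof.
move=> dD; apply/subsetP/idP => [/(_ d)|l z].
  by rewrite mem_face sface_refl => /(_ isT); rewrite in_set => /andP[].
by rewrite mem_face => s; rewrite in_set (lam_sface dD s) l (sface_darts plT dD).
Qed.
Lemma face_subY d : d \in darts T -> (face T d \subset Y) = ~~ lam d.
Proof.
move=> dD; apply/subsetP/idP => [/(_ d)|l z].
  by rewrite mem_face sface_refl => /(_ isT); rewrite in_set => /andP[].
by rewrite mem_face => s; rewrite in_set (lam_sface dD s) l (sface_darts plT dD).
Qed.

(** Each edge of the cycle has exactly one of its two darts on the inner side. *)
Lemma sum_odarts_lam : \sum_(d in darts T) (lam d && sg d : nat) = 3.
Proof.
rewrite sum_odarts_nat // -sum_odarts_cyc3.
apply: eq_bigr => d; rewrite in_set => /andP[dD _].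
by rewrite lamr // /sg cyc3_rev; case: (lam d); case: (d \in _).
Qed.

(** Edges off the cycle have both or none of their darts in [X], the three edges of the cycle one
    each. *)
Lemma X_odd : odd #|X|.
Proof.
have -> : #|X| = \sum_(d in darts T) (lam d : nat).
  rewrite -sum1_card [LHS]big_mkcond [RHS]big_mkcond; apply: eq_bigr => d _.
  by rewrite in_set; case: (d \in _); case: (lam d).
rewrite sum_odarts_nat // (eq_bigr (fun d => 2 * (lam d && ~~ sg d) + sg d)) => [|d]; last first.
  rewrite in_set => /andP[dD _]; rewrite lamr // /sg.
  by case: (lam d); case: (d \in _).
by rewrite big_split /= sum_odarts_cyc3 -big_distrr /= oddD mul2n odd_double.
Qed.

(* By parity each side of a 3-cycle contains an odd number of odd faces, and T has only two. *)
Lemma lam_inner3 t : inner3 T t -> lam t.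
Proof.
move=> t3; have [tD ti /eqP ts] := and3P t3; apply/negPn/negP => nl.
have := X_odd; rewrite (card_face_closed plT (X := X)); last exact: X_closed.
  (* With the triangle outside, [X] would consist of quadrangles only. *)
  rewrite big_mkcondr /= (eq_bigr (fun A : {set _} => 4 * (A \subset X))).
    by rewrite -big_distrr /= oddM.
  move=> A /facesP[d dD ->]; rewrite face_subX // card_face.
  case l: (lam d); rewrite ?muln0 // inner4 //.
    apply: contraTN l => s; by rewrite (lam_sface _ s) ?odartP // lamo.
  apply: contraTN l => d3; by rewrite (lam_sface tD (inner3_uniq triT t3 d3)).
by apply/subsetP => d; rewrite in_set => /andP[].
Qed.

(** The outer side, cycle included: the edges with a dart there, the faces there, and the vertices
    there except the base point [a]. *)
Let P d := ~~ lam d || ~~ lam (rev_dart d).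
Let Cf := [set A in faces T | A \subset Y].
Let Cv := [set v | (v != a) && [|| v == b, v == c | [exists u, adj T v u && ~~ lam (u, v)]]].

Lemma Cf_face d : d \in darts T -> (face T d \in Cf) = ~~ lam d.
Proof. by move=> dD; rewrite in_set mem_faces // face_subY. Qed.

(** The label can change only across an edge of the cycle, and none of these ends at [v]. *)
Lemma lam_vertex v u w : v \notin [:: a; b; c] -> adj T v u -> adj T v w -> lam (w, v) = lam (u, v).
Proof.
move=> vS vu vw; have out x y : (x, y) \in cyc3 -> y \in [:: a; b; c] /\ x \in [:: a; b; c].
  rewrite !inE !xpair_eqE.
  by do ![case/orP => [/andP[-> ->]|]]; rewrite ?orbT // => /andP[-> ->]; rewrite !orbT.
have step x : adj T v x -> lam (rot T v x, v) = lam (x, v).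
  move=> vx; have xvD : (x, v) \in darts T by rewrite inE /= adjC.
  rewrite -(lamn xvD) /nxt /=; have := lamr (nxt_darts plT xvD).
  rewrite /nxt /rev_dart /= => ->; rewrite -[RHS]addbF; congr (_ (+) _).
  by apply/negP => /out[_]; apply/negP.
have /iter_findex <- := rot_trans plT vu vw.
elim: (findex _ _ _) => //= k IH; rewrite step //.
by elim: (k) => //= j; apply: adj_rot.
Qed.

(** The darts of these edges are those of [Y] and the inner darts of the three edges of the
    cycle. *)
Lemma card_edges_P : #|edges_in T P| * 2 = #|Y| + 3.
Proof.
have Ps d : d \in darts T -> P (rev_dart d) = P d by move=> _; rewrite /P rev_dartK orbC.
have -> : #|edges_in T P| * 2 = \sum_(d in odarts T) (P d + P (rev_dart d)).
  rewrite -sum_nat_const big_mkcond [RHS]big_mkcond; apply: eq_bigr => d _.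
  rewrite in_set; case dO: (d \in odarts T) => //=; have := dO; rewrite in_set => /andP[dD _].
  by rewrite Ps //; case: (P d).
rewrite -sum_odarts_nat // -sum_odarts_lam.
rewrite -sum1_card [X in X + _]big_mkcond [LHS]big_mkcond [X in _ + X]big_mkcond -big_split /=.
apply: eq_bigr => d _; rewrite [d \in Y]in_set; case dD: (d \in darts T) => //=.
by rewrite /P lamr // /sg; case: (lam d); case: (d \in _).
Qed.

(** By [lam_inner3] all faces on this side are quadrangles, except for the outer triangle. *)
Lemma card_Y : #|Y| + 1 = 4 * #|Cf|.
Proof.
rewrite (card_face_closed plT (X := Y)); first last.
- exact: Y_closed.
- by apply/subsetP => d; rewrite in_set => /andP[].
rewrite (eq_bigl (fun A => A \in Cf)) => [|A]; last by rewrite in_set.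
have oC : face T (odart T) \in Cf by rewrite Cf_face ?odartP // lamo.
rewrite (big_setD1 _ oC) /= card_face fsize_outer // (cardsD1 (face T (odart T)) Cf) oC.
rewrite (eq_bigr (fun=> 4)) ?sum_nat_const; first by move: #|_| => k; lia.
move=> A; rewrite in_setD1 => /andP[ne]; rewrite in_set => /andP[AF AY].
have [d dD [i E]] := not_outer triT AF ne; rewrite E card_face.
apply: inner4 => //; apply: contraTN AY => d3.
by rewrite E face_subY // (lam_inner3 d3).
Qed.

(* boundary_boundary bounds the sum of the ranks of the two incidence matrices, restricted to
   the edges on the outer side, by the number of these edges. *)
Lemma card_Cv : #|Cv| <= #|Cf| + 1.
Proof.
have Ps d : d \in darts T -> P (rev_dart d) = P d by move=> _; rewrite /P rev_dartK orbC.
have CfF : Cf \subset faces T by apply/subsetP => A; rewrite in_set => /andP[].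
have CfP A d : A \in Cf -> d \in A -> P d.
  by rewrite in_set => /andP[_ /subsetP AY] /AY; rewrite in_set /P => /andP[_ ->].
suff [rd rp] : \rank (dual_inc T P Cf) = #|Cf| /\ \rank (prim_inc T P Cv) = #|Cv|.
  have := mulmx0_rank_max (boundary_boundary plT Cv Ps CfP CfF).
  rewrite mxrank_tr rd rp; have := card_edges_P; have := card_Y.
  by move: #|_| #|_| #|_| #|_| => w x y z; lia.
split; apply: rank_incidence => g gE g0.
- move=> A AC; have /facesP[d dD ->] := subsetP CfF A AC.
  have [t t3] := inner3_exists triT; have [tD _ _] := and3P t3.
  rewrite (@const_on_faces _ _ plT _ g _ d t) //.
    by apply: g0; rewrite Cf_face // (lam_inner3 t3).
  move=> d' d'D; case Pd: (P d'); last first.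
    by rewrite !g0 // Cf_face ?rev_darts //; move: Pd; rewrite /P; case: (lam d'); case: (lam _).
  wlog lt : d' d'D Pd / d'.1 < d'.2 => [W|].
    have := adj_neq plT (_ : adj T d'.1 d'.2); rewrite -val_eqE /= neq_ltn.
    have := d'D; rewrite {1}inE => -> /(_ isT)/orP[lt|lt]; first exact: W.
    by rewrite -[in LHS](rev_dartK d') -W ?rev_darts ?Ps.
  by apply: gE; rewrite in_set Pd andbT in_set d'D.
- move=> v _; rewrite (@const_on_darts _ _ plT _ g _ v a).
    by apply: g0; rewrite in_set eqxx.
  have gP d' : d' \in darts T -> P d' -> g d'.1 = g d'.2.
    move=> d'D Pd; have := adj_neq plT (_ : adj T d'.1 d'.2); rewrite -val_eqE /= neq_ltn.
    have := d'D; rewrite {1}inE => -> /(_ isT)/orP[lt|lt].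
      by apply: gE; rewrite in_set Pd andbT in_set d'D.
    have /= -> // := gE (rev_dart d').
    by rewrite in_set Ps // Pd andbT in_set rev_darts // d'D.
  have gcyc d' : d' \in cyc3 -> g d'.1 = g d'.2.
    move=> dc; have d'D := cyc3_darts dc; apply: gP => //.
    by rewrite /P lamr // dc; case: (lam d').
  have ga : g a = 0%R by apply: g0; rewrite in_set eqxx.
  have gb : g b = 0%R by rewrite -ga (gcyc (b, a)) // !inE eqxx ?orbT.
  have gc : g c = 0%R by rewrite -ga (gcyc (c, a)) // !inE eqxx ?orbT.
  (* Both darts of such an edge are on the inner side, so its head is on the cycle, where [g] equals
     [g a], or outside [Cv]. This extends the constancy of [g] to all darts. *)
  have gz d' : d' \in darts T -> ~~ P d' -> g d'.2 = 0%R.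
    case: d' => u w /= uwD Pn; have wu : adj T w u by rewrite adjC //; move: uwD; rewrite inE.
    have [->//|wa] := eqVneq w a; have [->//|wb] := eqVneq w b; have [->//|wc] := eqVneq w c.
    apply: g0; rewrite in_set wa (negbTE wb) (negbTE wc) /=.
    apply/existsP => -[x /andP[wx]]; rewrite (@lam_vertex w u) //.
      by move: Pn; rewrite /P negb_or !negbK => /andP[->].
    by rewrite !inE (negbTE wa) (negbTE wb) (negbTE wc).
  move=> d' d'D; case Pd: (P d'); first exact: gP.
  rewrite (gz d') ?Pd // -[d'.1]/((rev_dart d').2) gz ?rev_darts ?Ps ?Pd //.
Qed.

(* By card_Cv there are, on the side of the inner triangle, at least as many vertices off the
   cycle as quadrangles, so that these vertices account for all reflex angles on that side. *)
Lemma cyc3_convex d : d \in darts T -> lam d -> reflex T d.2 d.1 -> d.2 \notin [:: a; b; c].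
Proof.
(* [H] collects the vertices with a reflex angle on the inner side, [W] the vertices strictly
   inside. [W] is contained in [H], and counting gives equality. *)
pose H := snd @: (rdarts T :&: X); pose W := ~: Cv :\ a.
have WP w : w \in W -> w \notin [:: a; b; c] /\ forall u, adj T w u -> lam (u, w).
  rewrite in_setD1 in_setC in_set negb_and negbK => /andP[wa]; rewrite (negbTE wa) /=.
  rewrite !negb_or => /and3P[wb wc /existsPn N]; rewrite wa wb wc.
  by split=> // u wu; have := N u; rewrite wu /= negbK.
have WH : W \subset H.
  apply/subsetP => w /WP[_ lw]; have [u wu r] := reflex_exists triT w.
  apply/imsetP; exists (u, w) => //; rewrite in_setI !(in_set (fun _ => _ && _)) /= r lw //.
  by rewrite inE /= adjC // wu.
have cH : #|H| <= #|W|.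
  have cW : #|W| + #|Cv| + 1 = n.
    rewrite -[RHS]card_ord -(cardsC Cv) (cardsD1 a (~: Cv)) in_setC in_set eqxx /= -/W.
    by move: #|W| #|Cv| => w x; lia.
  (* [H] has at most as many elements as there are quadrangles inside, that is n - 2 - |[Cf]|, and
     by [card_Cv] this is at most n - 1 - |[Cv]| = |[W]|. *)
  have : #|H| + #|Cf| + 1 <= #|faces T|; last first.
    have [] := card_faces_darts triT; have := card_Cv; move: cW.
    by move: #|W| #|Cv| #|H| #|Cf| #|faces T| #|darts T|; clear; lia.
  pose Df := [set A in faces T | A \subset X].
  have FD : #|faces T| = #|Cf| + #|Df|.
    rewrite -(cardsID Cf (faces T)); congr (_ + _); apply: eq_card => A.
      by rewrite in_setI andb_idl // in_set => /andP[].
    rewrite in_setD [RHS]in_set andbC; case AF: (A \in _) => //=.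
    by have /facesP[e eD ->] := AF; rewrite Cf_face // face_subX // negbK.
  rewrite FD addnAC [#|Cf| + _]addnC leq_add2r.
  have [t t3] := inner3_exists triT; have [tD ti /eqP tf] := and3P t3.
  have tDf : face T t \in Df by rewrite in_set mem_faces // face_subX // (lam_inner3 t3).
  rewrite addn1 (cardsD1 (face T t) Df) tDf ltnS.
  apply: leq_trans (leq_imset_card _ _) _.
  have -> : #|rdarts T :&: X| = \sum_(A in Df) #|A :&: rdarts T|.
    transitivity (\sum_(e in darts T) (e \in rdarts T :&: X : nat)).
      rewrite -sum1_card [LHS]big_mkcond [RHS]big_mkcond; apply: eq_bigr => e _.
      by rewrite in_setI in_set; case: (e \in darts T) => //; case: (_ && _).
    rewrite (sum_faces plT) (bigID (fun A : {set _} => A \subset X)) /= [X in _ + X]big1 => [|A /andP[]].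
      rewrite addn0; under [RHS]eq_bigl do rewrite in_set.
      apply: eq_bigr => A /andP[_ /subsetP AX].
      rewrite -sum1_card [LHS]big_mkcond [RHS]big_mkcond; apply: eq_bigr => e _.
      rewrite !in_setI; case eA: (e \in A) => //=; rewrite (AX e eA) andbT.
      by case: (_ \in _).
    move=> /facesP[e eD ->]; rewrite face_subX // => l; apply: big1 => z.
    rewrite mem_face => s; rewrite in_setI [z \in X]in_set (lam_sface eD s) (negbTE l).
    by rewrite !andbF.
  rewrite (big_setD1 _ tDf) /=; have tI : face T t \in faces T :\ face T (odart T).
    by rewrite in_setD1 mem_faces // andbT eq_sym faceE // odartP.
  have := inner_reflex_tri triT tI; rewrite card_face tf /= addn1 => -[->]; rewrite add0n.
  rewrite -sum1_card; apply: leq_sum => A; rewrite in_setD1 => /andP[_]; rewrite in_set.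
  move=> /andP[AF AX]; have AI : A \in faces T :\ face T (odart T).
    rewrite in_setD1 AF andbT; apply: contraTneq AX => ->.
    by rewrite face_subX ?odartP // lamo.
  by have <- := inner_reflex_tri triT AI; apply: leq_addr.
have /eqP WE : W == H by rewrite eqEcard WH.
move=> dD ld r; suff /WP[] : d.2 \in W by [].
rewrite WE; apply: imset_f; rewrite in_setI [d \in rdarts T]in_set dD r.
by rewrite in_set dD ld.
Qed.
End ThreeCycle.

Section Sides.
Variables (n : nat) (T : emb n).
Hypothesis triT : tri4PPT T.

Lemma cyc3_sides a b c : adj T a b -> adj T b c -> adj T c a ->
  exists lam : 'I_n * 'I_n -> bool,
  [/\ forall d, d \in darts T -> lam (nxt T d) = lam d,
      forall d, d \in darts T -> lam (rev_dart d) = lam d (+) (d \in cyc3 a b c),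
      forall t, inner3 T t -> lam t,
      forall v u w, v \notin [:: a; b; c] -> adj T v u -> adj T v w -> lam (w, v) = lam (u, v)
    & forall d, d \in darts T -> lam d -> reflex T d.2 d.1 -> d.2 \notin [:: a; b; c]].
Proof.
move=> ab bc ca; have [lam [ln lr lo]] := cyc3_label triT ab bc ca.
exists lam; split=> //.
- exact: lam_inner3 lr lo.
- exact: lam_vertex ln lr.
- exact: cyc3_convex lr lo.
Qed.
End Sides.

(** * Flips inside a pentagon *)

Lemma nxtE n (V : emb n) u v w : nxt V (u, v) = (v, w) -> Defs.rot V v u = w.
Proof. by case. Qed.

Section Move.
Variables (n : nat) (T : emb n).
Hypothesis triT : tri4PPT T.
Let plT := tri_plane triT.
Implicit Types (u v w : 'I_n) (d : 'I_n * 'I_n).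

(** The darts of the two merged faces: both darts of [ab] and the boundary walk. In a pentagon they
    are distinct, although the walk may repeat vertices. *)
Definition region (a b p0 p1 p2 p3 p4 : 'I_n) :=
  [:: (a, b); (b, a); (p0, p1); (p1, p2); (p2, p3); (p3, p4); (p4, p0)].

Definition is_edge (a b u v : 'I_n) := ((u == a) && (v == b)) || ((u == b) && (v == a)).

(* The region obtained from the inner triangle and the quadrangle F across its edge ab is
   bounded by the closed walk p0 p1 p2 p3 p4; r is the vertex of the reflex angle of F *)
Record pentagon (a b p0 p1 p2 p3 p4 r : 'I_n) : Prop := Pentagon {
  pent_tri : inner3 T (a, b);
  pent_rev : ~~ sface T (odart T) (b, a);
  pent_ne : ~~ sface T (a, b) (b, a);
  pent_n0 : nxt (del T a b) (p0, p1) = (p1, p2);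
  pent_n1 : nxt (del T a b) (p1, p2) = (p2, p3);
  pent_n2 : nxt (del T a b) (p2, p3) = (p3, p4);
  pent_n3 : nxt (del T a b) (p3, p4) = (p4, p0);
  pent_n4 : nxt (del T a b) (p4, p0) = (p0, p1);
  pent_mem : forall d, (sface T (a, b) d || sface T (b, a) d) = (d \in region a b p0 p1 p2 p3 p4);
  pent_uniq : uniq (region a b p0 p1 p2 p3 p4);
  pent_a : a \in [:: p0; p1; p2; p3; p4];
  pent_b : b \in [:: p0; p1; p2; p3; p4];
  pent_r : exists2 s, (s, r) \in region a b p0 p1 p2 p3 p4 & reflex T r s;
  pent_ru : forall d, d \in region a b p0 p1 p2 p3 p4 -> reflex T d.2 d.1 -> d.2 = r }.

Lemma region_rot a b p0 p1 p2 p3 p4 d :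
  (d \in region a b p1 p2 p3 p4 p0) = (d \in region a b p0 p1 p2 p3 p4).
Proof. by rewrite !inE; do !bool_congr; rewrite orbC -!orbA. Qed.

(** Rotation lets every corner play the part of [p0], the tip of the ear in [move]. *)
Lemma pentagon_rot a b p0 p1 p2 p3 p4 r :
  pentagon a b p0 p1 p2 p3 p4 r -> pentagon a b p1 p2 p3 p4 p0 r.
Proof.
case=> t i ne n0 n1 n2 n3 n4 m U A B [s sr rs] ru; split=> //.
- by move=> d; rewrite region_rot.
- by rewrite (eq_uniq _ (region_rot a b p0 p1 p2 p3 p4)).
- by move: A; rewrite !inE; do ![case/orP => [->|]; rewrite ?orbT //]; move->; rewrite ?orbT.
- by move: B; rewrite !inE; do ![case/orP => [->|]; rewrite ?orbT //]; move->; rewrite ?orbT.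
- by exists s => //; rewrite region_rot.
- by move=> d; rewrite region_rot; apply: ru.
Qed.

(** The chord [p1 p4] of the ear with tip [p0] replaces [ab]: at [p1] it is inserted between [p0]
    and [p2], at [p4] between [p3] and [p0]. The reflex angle of the new quadrangle is put at [r];
    [rd] is the dart of the quadrangle arriving there, the first fitting one if [r] occurs more than
    once. *)
Definition move (a b p0 p1 p2 p3 p4 r : 'I_n) : emb n :=
  let rd := if r == p1 then (p4, p1) else if r == p2 then (p1, p2)
            else if r == p3 then (p2, p3) else (p3, p4) in
  Emb (fun u v => adj T u v && ~~ is_edge a b u v || is_edge p1 p4 u v)
      (fun v u => if (v == p1) && (u == p4) then p2 else if (v == p4) && (u == p1) then p0
         else if (v == p1) && (u == p0) then p4 else if (v == p4) && (u == p3) then p1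
         else Defs.rot (del T a b) v u)
      (odart T)
      (fun v u => if (u, v) \in region p1 p4 p0 p1 p2 p3 p4 then (u, v) == rd else reflex T v u).

Lemma rot_delE (V : emb n) (x y v u : 'I_n) : Defs.rot (del V x y) v u =
  if is_edge x y v (Defs.rot V v u) then Defs.rot V v (Defs.rot V v u) else Defs.rot V v u.
Proof.
rewrite /= /is_edge; case: ifP => [/andP[/eqP-> /eqP->]//|_ /=].
by case: ifP => [/andP[/eqP-> /eqP->]|].
Qed.

(** * Cutting off an ear is a flip *)

Section Validity.
Variables a b p0 p1 p2 p3 p4 r : 'I_n.
Hypothesis pent : pentagon a b p0 p1 p2 p3 p4 r.
Hypothesis p14 : p1 != p4.
Hypothesis np14 : ~~ adj T p1 p4.
Hypothesis rP : r \in [:: p1; p2; p3; p4].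

Let U := move a b p0 p1 p2 p3 p4 r.
Let R := region a b p0 p1 p2 p3 p4.
Let R' := region p1 p4 p0 p1 p2 p3 p4.
Let P5 := [:: (p0, p1); (p1, p2); (p2, p3); (p3, p4); (p4, p0)].

Lemma pent_ab : (a, b) \in darts T. Proof. by case/and3P: (pent_tri pent). Qed.
Lemma pent_ab_adj : adj T a b. Proof. by have := pent_ab; rewrite inE. Qed.
Lemma pent_ba : (b, a) \in darts T. Proof. by rewrite -(rev_darts plT) pent_ab. Qed.

Lemma region_darts d : d \in R -> d \in darts T.
Proof.
by rewrite -(pent_mem pent) => /orP[]; apply: sface_darts => //; rewrite ?pent_ab ?pent_ba.
Qed.

Lemma region_nxt d : d \in darts T -> (nxt T d \in R) = (d \in R).
Proof. by move=> dD; rewrite -!(pent_mem pent) !sface_nxtr ?pent_ab ?pent_ba. Qed.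

Lemma P5_region d : d \in P5 -> d \in R. Proof. by move=> h; rewrite /R /region 2!in_cons -/P5 h !orbT. Qed.
Lemma P5_region' d : d \in P5 -> d \in R'. Proof. by move=> h; rewrite /R' /region 2!in_cons -/P5 h !orbT. Qed.

Lemma is_edge_dart u v : is_edge a b u v = ((u, v) == (a, b)) || ((u, v) == (b, a)).
Proof. by rewrite !xpair_eqE. Qed.

Lemma P5_not_edge u v : (u, v) \in P5 -> ~~ is_edge a b u v.
Proof.
move=> h; rewrite is_edge_dart; apply/negP => /orP[]/eqP E; rewrite E in h.
  by have := pent_uniq pent; rewrite /region cons_uniq in_cons -/P5 h orbT.
by have := pent_uniq pent; rewrite /region 2!cons_uniq -/P5 h andbF.
Qed.

Lemma P5_adj u v : (u, v) \in P5 -> adj T u v.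
Proof. by move/P5_region/region_darts; rewrite inE. Qed.

Lemma not_new d : d \in darts T -> d != (p1, p4) /\ d != (p4, p1).
Proof.
by rewrite inE => h; split; apply: contraTneq h => ->; rewrite /= ?(adjC plT p4).
Qed.

Lemma region'_out d : d \in darts T -> d \notin R -> d \notin R'.
Proof.
move=> dD; have [/negbTE n1 /negbTE n2] := not_new dD; apply: contra.
by rewrite /R' /region 2!in_cons n1 n2; apply: P5_region.
Qed.

Lemma adj_move u v : adj U u v = adj T u v && ~~ is_edge a b u v || is_edge p1 p4 u v.
Proof. by []. Qed.

Lemma darts_move d : (d \in darts U) = (d \in R') || (d \in darts T) && (d \notin R).
Proof.
case: d => u v; rewrite inE adj_move /= in_darts.
have -> : is_edge p1 p4 u v = ((u, v) == (p1, p4)) || ((u, v) == (p4, p1)) by rewrite !xpair_eqE.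
rewrite /R' /region 2!in_cons -/P5; case: (_ == (p1, p4)); rewrite ?orbT //=.
case: (_ == (p4, p1)); rewrite ?orbT // orbF /=.
case h: ((u, v) \in P5); first by rewrite P5_adj // P5_not_edge.
by rewrite /= /R /region 2!in_cons -/P5 h is_edge_dart orbF.
Qed.

(** The new entries of [rot] belong to darts of the region or of the chord, and deleting [ab]
    redirects only the darts that precede it on its two faces. *)
Lemma nxt_move_out d : d \in darts T -> d \notin R -> nxt U d = nxt T d.
Proof.
case: d => u v dD dR; rewrite /nxt /=; congr (_, _).
have [n1 n2] := not_new dD; have dP : (u, v) \notin P5 by apply: contra dR; apply: P5_region.
rewrite -!xpair_eqE.
rewrite (_ : (v, u) == (p1, p4) = false); last by apply: contraNF n2; rewrite !xpair_eqE andbC.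
rewrite (_ : (v, u) == (p4, p1) = false); last by apply: contraNF n1; rewrite !xpair_eqE andbC.
rewrite (_ : (v, u) == (p1, p0) = false); last first.
  by apply: contraNF dP; rewrite !xpair_eqE => /andP[/eqP-> /eqP->]; rewrite inE eqxx.
rewrite (_ : (v, u) == (p4, p3) = false); last first.
  by apply: contraNF dP; rewrite !xpair_eqE => /andP[/eqP-> /eqP->]; rewrite !inE eqxx !orbT.
have nR : nxt T (u, v) \notin R by rewrite region_nxt.
rewrite /=.
by do 2![case: eqP nR => [E|_ nR]; first by rewrite /nxt /= E /R /region !in_cons eqxx ?orbT].
Qed.

Lemma p0_ne4 : p0 != p4.
Proof. by rewrite eq_sym (adj_neq plT) // P5_adj // !inE eqxx !orbT. Qed.
(** A coincidence would make the chord an edge of the walk. *)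
Lemma p1_ne3 : p1 != p3.
Proof. by apply: contraNneq np14 => ->; rewrite P5_adj // !inE eqxx !orbT. Qed.
Lemma p2_ne4 : p2 != p4.
Proof. by apply: contraNneq np14 => <-; rewrite P5_adj // !inE eqxx !orbT. Qed.
Lemma p0_ne1 : p0 != p1.
Proof. by rewrite (adj_neq plT) // P5_adj // !inE eqxx. Qed.
Lemma p1_ne2 : p1 != p2.
Proof. by rewrite (adj_neq plT) // P5_adj // !inE eqxx !orbT. Qed.
Lemma p3_ne4 : p3 != p4.
Proof. by rewrite (adj_neq plT) // P5_adj // !inE eqxx !orbT. Qed.

Lemma move_n0 : nxt U (p0, p1) = (p1, p4).
Proof. by rewrite /nxt /= !eqxx (negbTE p0_ne4) (negbTE p14). Qed.
Lemma move_n1 : nxt U (p1, p4) = (p4, p0).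
Proof. by rewrite /nxt /= !eqxx (eq_sym p4 p1) (negbTE p14). Qed.
Lemma move_n2 : nxt U (p4, p0) = (p0, p1).
Proof.
rewrite -(pent_n4 pent) /nxt; congr (_, _).
by rewrite [LHS]/= (negbTE p0_ne1) (negbTE p0_ne4).
Qed.
Lemma move_m0 : nxt U (p3, p4) = (p4, p1).
Proof. by rewrite /nxt /= !eqxx (eq_sym p4 p1) (negbTE p14) (eq_sym p3 p1) (negbTE p1_ne3). Qed.
Lemma move_m1 : nxt U (p4, p1) = (p1, p2).
Proof. by rewrite /nxt /= !eqxx. Qed.
Lemma move_m2 : nxt U (p1, p2) = (p2, p3).
Proof.
rewrite -(pent_n1 pent) /nxt; congr (_, _).
by rewrite [LHS]/= (eq_sym p2 p1) (negbTE p1_ne2) (negbTE p2_ne4).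
Qed.
Lemma move_m3 : nxt U (p2, p3) = (p3, p4).
Proof.
rewrite -(pent_n2 pent) /nxt; congr (_, _).
by rewrite [LHS]/= (eq_sym p3 p1) (negbTE p1_ne3) (negbTE p3_ne4).
Qed.

Lemma region'_uniq : uniq R'.
Proof.
have := pent_uniq pent; rewrite /region 2!cons_uniq => /and3P[_ _ u].
have D d : d \in P5 -> d != (p1, p4) /\ d != (p4, p1).
  by move/P5_region/region_darts; apply: not_new.
rewrite /R' /region 2!cons_uniq u andbT in_cons xpair_eqE (negbTE p14) /=.
by apply/andP; split; apply/negP => /D[]; rewrite eqxx.
Qed.

Definition tri' := [:: (p0, p1); (p1, p4); (p4, p0)].
Definition quad' := [:: (p1, p2); (p2, p3); (p3, p4); (p4, p1)].

Lemma region'_split d : (d \in R') = (d \in tri') || (d \in quad').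
Proof. by rewrite !inE -!orbA; do ![bool_congr]; rewrite orbCA; do ![bool_congr]; rewrite orbC. Qed.

Lemma tri'_cycle : fcycle (nxt U) tri'.
Proof. by rewrite /= move_n0 move_n1 move_n2 !eqxx. Qed.
Lemma quad'_cycle : fcycle (nxt U) quad'.
Proof. by rewrite /= move_m0 move_m1 move_m2 move_m3 !eqxx. Qed.

Lemma tri'_uniq : uniq tri' /\ uniq quad'.
Proof.
have e : R' =i tri' ++ quad' by move=> d; rewrite mem_cat region'_split.
have := region'_uniq; rewrite (eq_uniq _ e) // cat_uniq.
by case/and3P.
Qed.

Lemma sface_tri' d d' : d \in tri' -> sface U d d' = (d' \in tri').
Proof. by move=> dt; apply: fconnect_cycle dt d'; apply: tri'_cycle. Qed.
Lemma sface_quad' d d' : d \in quad' -> sface U d d' = (d' \in quad').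
Proof. by move=> dt; apply: fconnect_cycle dt d'; apply: quad'_cycle. Qed.
Lemma fsize_tri' d : d \in tri' -> fsize U d = 3.
Proof. by move=> dt; rewrite /fsize (order_cycle tri'_cycle) //; case: tri'_uniq. Qed.
Lemma fsize_quad' d : d \in quad' -> fsize U d = 4.
Proof. by move=> dt; rewrite /fsize (order_cycle quad'_cycle) //; case: tri'_uniq. Qed.

Lemma iter_move k d : d \in darts T -> d \notin R ->
  [/\ iter k (nxt U) d = iter k (nxt T) d, iter k (nxt T) d \in darts T & iter k (nxt T) d \notin R].
Proof.
move=> dD dR; elim: k => //= k [-> kD kR]; split; rewrite ?nxt_move_out ?nxt_darts //.
by rewrite region_nxt.
Qed.

Lemma sface_out d d' : d \in darts T -> d \notin R -> sface U d d' = sface T d d'.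
Proof.
move=> dD dR; apply/idP/idP => /iter_findex <-.
  by have [-> _ _] := iter_move (findex (nxt U) d d') dD dR; apply: fconnect_iter.
by have [<- _ _] := iter_move (findex (nxt T) d d') dD dR; apply: fconnect_iter.
Qed.

Lemma sface_out_region d d' : d \in darts T -> d \notin R -> sface T d d' ->
  d' \in darts T /\ d' \notin R.
Proof. by move=> dD dR /iter_findex <-; have [] := iter_move (findex (nxt T) d d') dD dR. Qed.

Lemma fsize_out d : d \in darts T -> d \notin R -> fsize U d = fsize T d.
Proof. by move=> dD dR; apply: eq_card => d'; exact: sface_out. Qed.

Lemma odart_out : odart T \notin R.
Proof.
have oD := odartP plT; have /and3P[_ i _] := pent_tri pent.
rewrite -(pent_mem pent) negb_or !(sface_sym plT _ oD) ?pent_ab ?pent_ba // i.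
exact: (pent_rev pent).
Qed.

Lemma sface_outer d : sface U (odart U) d = sface T (odart T) d.
Proof. by apply: sface_out; [apply: odartP plT | apply: odart_out]. Qed.

Lemma region'_inner d : d \in R' -> ~~ sface U (odart U) d.
Proof.
move=> dR; rewrite sface_outer; apply/negP => s.
have [dD dnR] := sface_out_region (odartP plT) odart_out s.
by have := region'_out dD dnR; rewrite dR.
Qed.

Lemma region'_nxt d : d \in R' -> nxt U d \in R'.
Proof.
rewrite !region'_split => /orP[] h; apply/orP; [left|right].
  by rewrite -(sface_tri' _ h); apply: fconnect1.
by rewrite -(sface_quad' _ h); apply: fconnect1.
Qed.

Lemma move_darts_nxt d : d \in darts U -> nxt U d \in darts U.
Proof.
rewrite !darts_move => /orP[/region'_nxt->//|/andP[dD dR]].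
by rewrite nxt_move_out // nxt_darts // region_nxt // dR orbT.
Qed.

Lemma move_adjC u v : adj U u v = adj U v u.
Proof.
rewrite !adj_move /is_edge (adjC plT u v); congr (_ && ~~ _ || _).
  by rewrite orbC andbC [X in _ || X]andbC.
by rewrite orbC andbC [X in _ || X]andbC.
Qed.

Lemma move_adjxx u : ~~ adj U u u.
Proof.
rewrite adj_move adjxx //= /is_edge negb_or.
by apply/andP; split; apply: contra p14 => /andP[/eqP<- /eqP<-].
Qed.

Lemma adj_move_P5 u v : (u, v) \in P5 -> adj U u v.
Proof. by move=> h; rewrite adj_move P5_adj // P5_not_edge. Qed.

(** The boundary walk still joins the ends of the deleted edge. *)
Lemma move_connect u v : connect (adj U) u v.
Proof.
have symU : connect_sym (adj U) by apply: sym_connect_sym => x y; apply: move_adjC.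
have P0 x : x \in [:: p0; p1; p2; p3; p4] -> connect (adj U) p0 x.
  have c1 : connect (adj U) p0 p1 by apply/connect1/adj_move_P5; rewrite !inE eqxx.
  have c2 : connect (adj U) p0 p2.
    by apply: connect_trans c1 _; apply/connect1/adj_move_P5; rewrite !inE eqxx !orbT.
  have c3 : connect (adj U) p0 p3.
    by apply: connect_trans c2 _; apply/connect1/adj_move_P5; rewrite !inE eqxx !orbT.
  have c4 : connect (adj U) p0 p4.
    by apply: connect_trans c3 _; apply/connect1/adj_move_P5; rewrite !inE eqxx !orbT.
  by rewrite !inE; do ![case/orP => [/eqP->//|]] => /eqP ->.
have ab_conn : connect (adj U) a b.
  by apply: connect_trans (P0 b (pent_b pent)); rewrite symU (P0 a (pent_a pent)).
apply: connect_sub (adj_connect plT u v) => x y xy.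
case e: (is_edge a b x y); last by apply: connect1; rewrite adj_move xy e.
by case/orP: e => /andP[/eqP-> /eqP->]; rewrite // symU.
Qed.

Let surv v u := adj T v u && ~~ is_edge a b v u.

(** A step of the rotation without [ab] is one step of the new rotation, or two where the chord is
    inserted. *)
Lemma rot_del_step v u : surv v u ->
  fconnect (Defs.rot U v) u (Defs.rot (del T a b) v u).
Proof.
case/andP=> vu nab; have nn : ~~ is_edge p1 p4 v u.
  apply/negP => /orP[]/andP[/eqP e1 /eqP e2]; rewrite e1 e2 in vu; case/negP: np14 => //.
  by rewrite (adjC plT).
have [e|n1] := eqVneq (v, u) (p1, p0).
  case: e => -> ->; rewrite (nxtE (pent_n0 pent)).
  by apply: (@connect_trans _ _ p4); apply/connect1/eqP; [exact: nxtE move_n0 | exact: nxtE move_m1].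
have [e|n2] := eqVneq (v, u) (p4, p3).
  case: e => -> ->; rewrite (nxtE (pent_n3 pent)).
  by apply: (@connect_trans _ _ p1); apply/connect1/eqP; [exact: nxtE move_m0 | exact: nxtE move_n1].
apply: connect1; rewrite /= -!xpair_eqE (negbTE n1) (negbTE n2).
by move: nn; rewrite /is_edge negb_or -!xpair_eqE => /andP[/negbTE-> /negbTE->].
Qed.

Lemma rot_surv v u w : surv v u -> surv v w -> fconnect (Defs.rot U v) u w.
Proof.
move=> su sw; have [vu nu] := andP su; have [vw nw] := andP sw.
have vi k : adj T v (iter k (Defs.rot T v) u) by elim: k => //= k; apply: adj_rot.
(* Invariant along the old rotation: when the iterate is the deleted edge, the claim concerns its
   successor instead. *)
suff H k : let z := iter k (Defs.rot T v) u in
    if is_edge a b v z then fconnect (Defs.rot U v) u (Defs.rot T v z)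
    else fconnect (Defs.rot U v) u z.
  have /iter_findex <- := rot_trans plT vu vw.
  by have := H (findex (Defs.rot T v) u w); rewrite /= iter_findex ?rot_trans // (negbTE nw).
elim: k => /= [|k IH]; first by rewrite (negbTE nu).
set z := iter k _ u in IH *; have vz := vi k; rewrite -/z in vz.
case ez: (is_edge a b v z) IH => IH; last first.
  have := rot_del_step (_ : surv v z); rewrite /surv vz ez => /(_ isT) c.
  have {}c := connect_trans IH c; rewrite rot_delE in c.
  by case: ifP c.
(* If the successor is the deleted edge as well, [ab] is the only edge at [v], contrary to
   [surv v u]. *)
case: ifP => // ez'; have zz : Defs.rot T v z = z.
  move: ez ez' (adj_neq plT pent_ab_adj); rewrite /is_edge.
  case/orP=> /andP[/eqP-> /eqP->]; rewrite !eqxx ?orbF /=.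
    by case/orP=> [/eqP->|/andP[/eqP->]]; rewrite ?eqxx.
  by case/orP=> [/andP[/eqP->]|/eqP->]; rewrite ?eqxx.
have /iter_findex := rot_trans plT vz vu.
have -> k' : iter k' (Defs.rot T v) z = z by elim: k' => //= k' ->.
by move=> zu; rewrite -zu ez in nu.
Qed.

Lemma is_edgeC u v x y : is_edge u v x y = is_edge u v y x.
Proof. by rewrite /is_edge orbC andbC [X in _ || X]andbC. Qed.

Lemma surv_P5 u v : (u, v) \in P5 -> surv u v /\ surv v u.
Proof.
move=> h; rewrite /surv (adjC plT v) (is_edgeC _ _ v) (P5_adj h) (P5_not_edge h) //.
Qed.

Lemma rot_move_trans v u w : adj U v u -> adj U v w -> fconnect (Defs.rot U v) u w.
Proof.
have toS x : adj U v x -> exists2 y, surv v y & fconnect (Defs.rot U v) x y.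
  rewrite adj_move => /orP[sx|/orP[]/andP[/eqP-> /eqP->]]; first by exists x.
    exists p2; last by apply/connect1/eqP; exact: nxtE move_m1.
    by have [] := @surv_P5 p1 p2; rewrite // !inE eqxx !orbT.
  exists p0; last by apply/connect1/eqP; exact: nxtE move_n1.
  by have [] := @surv_P5 p4 p0; rewrite // !inE eqxx !orbT.
have fromS x : adj U v x -> exists2 y, surv v y & fconnect (Defs.rot U v) y x.
  rewrite adj_move => /orP[sx|/orP[]/andP[/eqP-> /eqP->]]; first by exists x.
    exists p0; last by apply/connect1/eqP; exact: nxtE move_n0.
    by have [] := @surv_P5 p0 p1; rewrite // !inE eqxx.
  exists p3; last by apply/connect1/eqP; exact: nxtE move_m0.
  by have [] := @surv_P5 p3 p4; rewrite // !inE eqxx !orbT.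
move=> /toS[y sy uy] /fromS[z sz zw]; apply: connect_trans uy (connect_trans _ zw).
exact: rot_surv.
Qed.

Let rest := darts T :\: [set d in R].

Lemma mem_rest d : (d \in rest) = (d \in darts T) && (d \notin R).
Proof. by rewrite in_setD in_set andbC. Qed.

Lemma card_darts_move : #|darts U| = #|darts T|.
Proof.
have c7 (s : seq ('I_n * 'I_n)) : uniq s -> size s = 7 -> #|[set d in s]| = 7.
  by move=> /card_uniqP us <-; rewrite -us; apply: eq_card => d; rewrite inE.
rewrite -[RHS](cardsID [set d in R]) -[LHS](cardsID [set d in R']); congr (_ + _).
  rewrite (setIidPr _) ?(setIidPr _) ?c7 ?region'_uniq ?(pent_uniq pent) //.
    by apply/subsetP => d; rewrite in_set; apply: region_darts.
  by apply/subsetP => d; rewrite in_set darts_move => ->.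
apply: eq_card => d; rewrite -/rest mem_rest in_setD in_set darts_move.
case dD: (d \in darts T); rewrite ?orbF ?andNb //=.
case dR: (d \in R); rewrite ?orbF ?orbT ?andbT ?andNb //=.
by rewrite region'_out ?dR.
Qed.

Lemma faces_move_rest : faces U = [set face U (p0, p1); face U (p1, p2)] :|: [set face T d | d in rest].
Proof.
apply/setP => A; rewrite in_setU in_set2; apply/idP/idP.
  case/facesP => d; rewrite darts_move region'_split -mem_rest -orbA => /or3P[dt|dq|dr] ->.
  - by apply/orP; left; apply/orP; left; apply/eqP/setP => z; rewrite !mem_face !sface_tri' // inE eqxx.
  - by apply/orP; left; apply/orP; right; apply/eqP/setP => z; rewrite !mem_face !sface_quad' // inE eqxx.
  - apply/orP; right; apply/imsetP; exists d => //; apply/setP => z; rewrite !mem_face.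
    by move: dr; rewrite mem_rest => /andP[dD dR]; rewrite sface_out.
have tD : (p0, p1) \in darts U by rewrite darts_move region'_split !inE eqxx.
have qD : (p1, p2) \in darts U by rewrite darts_move region'_split !inE eqxx !orbT.
case/orP => [/orP[]/eqP->|/imsetP[d dr ->]]; try exact: mem_faces.
apply/facesP; exists d; first by rewrite darts_move -mem_rest dr orbT.
apply/setP => z; rewrite !mem_face.
by move: dr; rewrite mem_rest => /andP[dD dR]; rewrite sface_out.
Qed.

Lemma faces_rest : faces T = [set face T (a, b); face T (b, a)] :|: [set face T d | d in rest].
Proof.
have [abD baD] := (pent_ab, pent_ba).
apply/setP => A; rewrite in_setU in_set2; apply/idP/idP.
  case/facesP => d dD ->; case dR: (d \in R); last first.
    by rewrite (imset_f (face T)) ?orbT // mem_rest dD dR.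
  by rewrite !(eq_sym (face T d)) !(faceE plT) // (pent_mem pent) -/R dR.
case/orP => [/orP[]/eqP->|/imsetP[d]]; try exact: mem_faces.
by rewrite mem_rest => /andP[dD _] ->; exact: mem_faces.
Qed.

(** Two faces are exchanged for two; with [card_darts_move] Euler's formula carries over. *)
Lemma card_faces_move : #|faces U| = #|faces T|.
Proof.
have [abD baD] := (pent_ab, pent_ba).
have c2 (A B : {set 'I_n * 'I_n}) (C : {set {set 'I_n * 'I_n}}) :
    A != B -> A \notin C -> B \notin C -> #|[set A; B] :|: C| = #|C| + 2.
  move=> AB AC BC; rewrite cardsU cards2 AB addnC (_ : _ :&: _ = set0) ?cards0 ?subn0 //.
  apply/setP => D; rewrite !inE; apply/negP => /andP[/orP[]/eqP->]; exact/negP.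
have Rd d : d \in rest -> face T d \subset [predC [in R]].
  rewrite mem_rest => /andP[dD dR]; apply/subsetP => z; rewrite mem_face => s.
  by have [] := sface_out_region dD dR s.
have Rd' d : d \in rest -> face T d \subset [predC [in R']].
  rewrite mem_rest => /andP[dD dR]; apply/subsetP => z; rewrite mem_face => s.
  have [h1 h2] := sface_out_region dD dR s; exact: region'_out.
have not V e (Q : seq ('I_n * 'I_n)) : e \in Q -> (forall d, d \in rest -> face T d \subset [predC [in Q]]) ->
    face V e \notin [set face T d | d in rest].
  move=> eQ H; apply/negP => /imsetP[d dr E].
  have := subsetP (H d dr) e; rewrite -E mem_face sface_refl inE /= eQ => /(_ isT) //.
rewrite faces_move_rest faces_rest !c2 //.
- by rewrite (faceE plT) // (pent_ne pent).
- by apply: (not _ _ R) Rd; rewrite !inE eqxx.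
- by apply: (not _ _ R) Rd; rewrite !inE eqxx !orbT.
- apply/eqP => /setP/(_ (p1, p2)); rewrite !mem_face sface_refl sface_tri' ?inE ?eqxx //=.
  by rewrite !xpair_eqE (eq_sym p1 p0) (negbTE p0_ne1) (negbTE p2_ne4) (negbTE p14) andbF.
- by apply: (not _ _ R') Rd'; rewrite !inE eqxx !orbT.
- by apply: (not _ _ R') Rd'; rewrite !inE eqxx !orbT.
Qed.

Lemma move_plane : is_plane U.
Proof.
split; first exact: move_adjC.
split; first exact: move_adjxx.
split; first exact: move_connect.
split.
  move=> v u vu; have := @move_darts_nxt (u, v); rewrite /nxt !in_darts.
  by rewrite move_adjC vu => /(_ isT).
split; first exact: rot_move_trans.
split; last by rewrite card_faces_move card_darts_move; apply: euler.
have := darts_move (odart T); rewrite inE => ->.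
by rewrite odart_out odartP // orbT.
Qed.

Let rd := if r == p1 then (p4, p1) else if r == p2 then (p1, p2)
          else if r == p3 then (p2, p3) else (p3, p4).

Lemma rd_quad' : rd \in quad'.
Proof. by rewrite /rd; do ![case: ifP => _]; rewrite !inE eqxx ?orbT. Qed.
Lemma rd2 : rd.2 = r.
Proof.
have := rP; rewrite /rd !inE; case: eqP => [->//|_ /=]; case: eqP => [->//|_ /=].
by case: eqP => [->//|_ /= /eqP->].
Qed.
Lemma rd_region' : rd \in R'. Proof. by rewrite region'_split rd_quad' orbT. Qed.

Lemma reflex_region' d : d \in R' -> reflex U d.2 d.1 = (d == rd).
Proof. by move=> dR; rewrite /= -surjective_pairing -/R' dR. Qed.
Lemma reflex_out d : d \in darts T -> d \notin R -> reflex U d.2 d.1 = reflex T d.2 d.1.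
Proof. by move=> dD dR; rewrite /= -surjective_pairing -/R' (negbTE (region'_out dD dR)). Qed.

Lemma tri_quad_disjoint d : d \in tri' -> d \notin quad'.
Proof.
move=> dt; apply/negP => dq; have := sface_tri' (p1, p2) dt.
rewrite (sface_quad' _ dq) !inE !xpair_eqE !eqxx /=.
by rewrite (eq_sym p1 p0) (negbTE p0_ne1) (negbTE p2_ne4) (negbTE p14).
Qed.

Lemma nconvex_region' d : d \in R' -> nconvex U d = 3.
Proof.
have [ut uq] := tri'_uniq; rewrite region'_split => /orP[dt|dq]; rewrite /nconvex.
  rewrite -[3]/(size tri') -(card_uniqP ut); apply: eq_card => z; rewrite inE sface_tri' //.
  case zt: (z \in tri'); last by [].
  rewrite andTb reflex_region' ?region'_split ?zt //.
  by apply: contraTneq zt => ->; apply: contraL rd_quad'; apply: tri_quad_disjoint.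
have <- : #|[set z in quad'] :\ rd| = 3.
  have := cardsD1 rd [set z in quad']; rewrite in_set rd_quad' /=.
  rewrite (_ : #|[set z in quad']| = 4) ?add1n; first by case.
  by rewrite -[4]/(size quad') -(card_uniqP uq); apply: eq_card => z; rewrite inE.
apply: eq_card => z; rewrite inE sface_quad' // in_setD1 in_set andbC.
by case zt: (z \in quad'); rewrite ?andbF ?andbT // reflex_region' // region'_split zt orbT.
Qed.

Lemma nconvex_out d : d \in darts T -> d \notin R -> nconvex U d = nconvex T d.
Proof.
move=> dD dR; apply: eq_card => z; rewrite !in_set sface_out //.
case s: (sface T d z); last by [].
by have [zD zR] := sface_out_region dD dR s; rewrite !andTb reflex_out.
Qed.

(** At [r] the reflex angle stays in the region and moves to [rd]; at any other vertex it lies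
    outside the region and is unchanged. *)
Lemma vertex_reflex_move v : #|[set u | adj U v u && reflex U v u]| = 1.
Proof.
have split_adj u : adj U v u = ((u, v) \in R') || ((u, v) \in darts T) && ((u, v) \notin R).
  by rewrite -darts_move in_darts move_adjC.
apply/eqP/cards1P; have [vr|vr] := eqVneq v r.
  exists rd.1; apply/setP => u; rewrite in_set1 in_set; apply/andP/eqP => [[]|->].
    rewrite split_adj => /orP[uR|/andP[uD uR]].
      by rewrite (reflex_region' uR) => /eqP <-.
    have [s sR rs] := pent_r pent; rewrite (reflex_out uD uR) => ru.
    have sD := region_darts sR; case/negP: uR; rewrite (_ : u = s) ?vr //.
    move: uD sD; rewrite !in_darts !(adjC plT _ v) vr !(adjC plT _ r) => uD sD.
    apply: (reflex_uniq triT _ _ sD rs); by rewrite // -vr.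
  have E : (rd.1, v) = rd by rewrite vr -rd2 -surjective_pairing.
  by rewrite split_adj E rd_region' -[reflex _ _ _]/(reflex U (rd.1, v).2 (rd.1, v).1) E reflex_region' ?rd_region'.
have [u vu ru] := reflex_exists triT v; exists u; apply/setP => w; rewrite in_set1 in_set.
have uvD : (u, v) \in darts T by rewrite in_darts adjC.
have uvR : (u, v) \notin R by apply: contraNN vr => /(pent_ru pent)/(_ ru)/= ->.
apply/andP/eqP => [[]|->].
  rewrite split_adj => /orP[wR|/andP[wD wR]].
    rewrite (reflex_region' wR) => /eqP E; case/negP: vr.
    by rewrite -rd2 -E.
  rewrite (reflex_out wD wR) => rw; apply: (reflex_uniq triT _ rw vu ru).
  by move: wD; rewrite in_darts adjC.
by rewrite split_adj uvD uvR orbT; split=> //; rewrite (reflex_out uvD uvR).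
Qed.

Lemma move_tri : tri4PPT U.
Proof.
have inR d : d \in darts U -> d \notin R' -> d \in darts T /\ d \notin R.
  by rewrite darts_move => /orP[->|/andP[]].
have toD d : adj U d.1 d.2 -> d \in darts U by rewrite in_set.
split; last first.
  have oD := odartP plT.
  by rewrite fsize_out ?odart_out // fsize_outer.
split; first exact: move_plane.
- move=> d /toD dD i; case dR: (d \in R').
    by move: dR; rewrite region'_split => /orP[] h; rewrite ?(fsize_tri' h) ?(fsize_quad' h).
  have [dT dnR] := inR d dD (negbT dR); rewrite fsize_out //.
  by apply: (fsize_inner triT dT); rewrite -sface_outer.
- move=> d /toD dD i; case dR: (d \in R'); first exact: nconvex_region'.
  have [dT dnR] := inR d dD (negbT dR); rewrite nconvex_out //.
  have [[_ _ H _ _] _] := triT; apply: H; last by rewrite -sface_outer.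
  by move: dT; rewrite in_set.
- move=> d; rewrite sface_outer => s.
  have [dD dR] := sface_out_region (odartP plT) odart_out s.
  by rewrite (reflex_out dD dR); apply: outer_reflex.
- exact: vertex_reflex_move.
Qed.

Lemma move_flip : flip T U.
Proof.
split; first by case: triT.
split; first by case: move_tri.
have /and3P[abD abi /eqP ab3] := pent_tri pent.
exists a, b, p1, p4; split; first exact: pent_ab_adj.
split; first exact: np14.
split; first by rewrite adj_move /is_edge !eqxx orbT.
split; first exact: ab3.
split; first by rewrite abi (pent_rev pent).
split.
  split; last exact: connect0.
    move=> u v; rewrite -[LHS]/(adj T u v && ~~ is_edge a b u v) -[RHS]/(adj U u v && ~~ is_edge p1 p4 u v) adj_move.
    case e: (is_edge p1 p4 u v); rewrite ?orbF ?andbF ?andbT //=.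
    have -> // : adj T u v = false.
    case/orP: e => /andP[/eqP-> /eqP->]; apply/negbTE; rewrite // (adjC plT); exact: np14.
  move=> v u vu; rewrite [RHS]rot_delE; have {}vu : surv v u := vu.
  have [e|n1] := eqVneq (v, u) (p1, p0).
    case: e => -> ->; rewrite (nxtE (pent_n0 pent)) (nxtE move_n0) (nxtE move_m1).
    by rewrite /is_edge !eqxx.
  have [e|n2] := eqVneq (v, u) (p4, p3).
    case: e => -> ->; rewrite (nxtE (pent_n3 pent)) (nxtE move_m0) (nxtE move_n1).
    by rewrite /is_edge !eqxx orbT.
  have nn x : adj T v x -> ~~ is_edge p1 p4 v x.
    move=> vx; apply/negP => /orP[]/andP[/eqP e1 /eqP e2]; rewrite e1 e2 in vx; case/negP: np14 => //.
    by rewrite (adjC plT).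
  have [vuT _] := andP vu.
  have -> : Defs.rot U v u = Defs.rot (del T a b) v u.
    have := nn u vuT; rewrite /is_edge negb_or -!xpair_eqE => /andP[/negbTE m1 /negbTE m2].
    by rewrite [LHS]/= -!xpair_eqE (negbTE n1) (negbTE n2) m1 m2.
  rewrite (negbTE (nn _ _)) // rot_delE; case: ifP => _; rewrite ?adj_rot //.
(* [flip] identifies the region by the successor of [(a, b)]. It is on the boundary walk: it differs
   from [(a, b)] as the face has size 3, and from [(b, a)] as the two faces differ. *)
have nR : nxt T (a, b) \in P5.
  have : nxt T (a, b) \in R by rewrite region_nxt // /R /region in_cons eqxx.
  rewrite /R /region 2!in_cons -/P5 => /or3P[/eqP E|/eqP E|//].
    have c : fcycle (nxt T) [:: (a, b)] by rewrite /= E eqxx.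
    by have := order_le_cycle c (mem_head _ _); rewrite -/(fsize T (a, b)) ab3.
  by have := pent_ne pent; rewrite -E sface_nxt.
split.
  have := P5_region' nR; rewrite region'_split => /orP[] h; [left|right].
    by rewrite sface_tri' // !inE eqxx orbT.
  by rewrite sface_quad' // !inE eqxx !orbT.
split.
  left; rewrite fsize_tri' ?fsize_quad' ?(inner4 triT) ?pent_ba ?(pent_rev pent) //.
  - apply/negP => ba3; case/negP: (pent_ne pent); apply: (inner3_uniq triT _ ba3).
    exact: pent_tri pent.
  - by rewrite !inE eqxx !orbT.
  - by rewrite !inE eqxx !orbT.
move=> v u vu s1 s2; have uvD : (u, v) \in darts T by rewrite in_darts adjC.
apply: (reflex_out uvD); rewrite -(pent_mem pent) negb_or.
by rewrite s1 s2.
Qed.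
End Validity.
End Move.

(** The interface of [move] for all that follows. It forgets where the new reflex angle is, which
    [conf_pentagon] recovers by counting. *)
Record moved n (T : emb n) (a b p0 p1 p2 p3 p4 : 'I_n) (U : emb n) : Prop := Moved {
  mv_tri : tri4PPT U;
  mv_flip : flip T U;
  mv_adj : forall u v, adj U u v = adj T u v && ~~ is_edge a b u v || is_edge p1 p4 u v;
  mv_n2 : nxt U (p4, p0) = (p0, p1);
  mv_m0 : nxt U (p3, p4) = (p4, p1);
  mv_m1 : nxt U (p4, p1) = (p1, p2);
  mv_m2 : nxt U (p1, p2) = (p2, p3);
  mv_m3 : nxt U (p2, p3) = (p3, p4);
  mv_out : forall d, d \in darts T -> d \notin region a b p0 p1 p2 p3 p4 -> nxt U d = nxt T d;
  mv_reflex : forall d, d \in darts T -> d \notin region a b p0 p1 p2 p3 p4 ->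
    reflex U d.2 d.1 = reflex T d.2 d.1;
  mv_odart : odart U = odart T;
  mv_inner3 : forall d, d \in [:: (p0, p1); (p1, p4); (p4, p0)] -> inner3 U d;
  mv_inner4 : forall d, d \in [:: (p1, p2); (p2, p3); (p3, p4); (p4, p1)] -> ~~ sface U (odart U) d }.

(** * The inner triangle and an adjacent quadrangle *)

Section Configuration.
Variables (n : nat) (T : emb n).
Hypothesis triT : tri4PPT T.
Let plT := tri_plane triT.
Implicit Types (u v w a b c d p t : 'I_n).

Lemma moved_exists a b p0 p1 p2 p3 p4 r :
  pentagon T a b p0 p1 p2 p3 p4 r -> p1 != p4 -> ~~ adj T p1 p4 -> r \in [:: p1; p2; p3; p4] ->
  exists U, moved T a b p0 p1 p2 p3 p4 U.
Proof.
move=> pt p14 np14 rP; exists (move T a b p0 p1 p2 p3 p4 r); split.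
- exact: move_tri.
- exact: move_flip.
- by [].
- exact: (move_n2 triT pt).
- exact: (move_m0 triT pt).
- exact: move_m1.
- exact: (move_m2 triT pt).
- exact: (move_m3 triT pt).
- exact: (nxt_move_out triT pt).
- exact: reflex_out.
- by [].
- move=> d dt; have dR : d \in region p1 p4 p0 p1 p2 p3 p4 by rewrite region'_split dt.
  apply/and3P; split; last by rewrite (fsize_tri' triT pt).
    by rewrite (darts_move triT pt) dR.
  exact: (region'_inner triT pt).
- move=> d dq; apply: (region'_inner triT pt) => //.
  by rewrite region'_split dq orbT.
Qed.

(** The triangle [a b t] and the quadrangle [b a c d] across [ab]; [t] may coincide with [c] or
    [d]. *)
Record conf a b t c d : Prop := Conf {
  cf_tri : inner3 T (a, b);
  cf_in : ~~ sface T (odart T) (b, a);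
  cf_t0 : nxt T (a, b) = (b, t);
  cf_t1 : nxt T (b, t) = (t, a);
  cf_t2 : nxt T (t, a) = (a, b);
  cf_q0 : nxt T (b, a) = (a, c);
  cf_q1 : nxt T (a, c) = (c, d);
  cf_q2 : nxt T (c, d) = (d, b);
  cf_q3 : nxt T (d, b) = (b, a) }.

Lemma tri_third a b : inner3 T (a, b) ->
  exists t, [/\ nxt T (a, b) = (b, t), nxt T (b, t) = (t, a) & nxt T (t, a) = (a, b)].
Proof.
case/and3P=> abD _ /eqP e3; have := iter_nxt_fsize triT abD; rewrite e3 /=.
set t := Defs.rot T b a; rewrite -[nxt T (a, b)]/(b, t); set u := Defs.rot T t b.
rewrite -[nxt T (b, t)]/(t, u) => E; exists t; have ua : u = a by case: E.
by rewrite -[nxt T (b, t)]/(t, u) ua; split=> //; rewrite -[in LHS]ua.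
Qed.

Lemma conf_exists a b : inner3 T (a, b) -> ~~ sface T (odart T) (b, a) ->
  exists t c d, conf a b t c d.
Proof.
move=> ab3 bai; have [t [t0 t1 t2]] := tri_third ab3.
have abD : (a, b) \in darts T by case/and3P: ab3.
have baD : (b, a) \in darts T by rewrite -(rev_darts plT).
(* With both darts of [ab] on the triangle, its third vertex would be [a] or [b], which gives a
   loop. *)
have ne : ~~ inner3 T (b, a).
  apply/negP => ba3; have := inner3_uniq triT ab3 ba3.
  have cy : fcycle (nxt T) [:: (a, b); (b, t); (t, a)] by rewrite /= t0 t1 t2 !eqxx.
  rewrite /sface (fconnect_cycle cy (mem_head _ _)) !inE !xpair_eqE.
  have ab : adj T a b by rewrite -in_darts.
  rewrite (eq_sym b a) (negbTE (adj_neq plT ab)) !eqxx /= andbT => /orP[]/eqP E; subst t.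
    by have := nxt_darts plT (nxt_darts plT abD); rewrite t0 t1 in_darts adjxx.
  by have := nxt_darts plT abD; rewrite t0 in_darts adjxx.
have := iter_nxt_fsize triT baD; rewrite (inner4 triT) //=.
set c := Defs.rot T a b; rewrite -[nxt T (b, a)]/(a, c); set d := Defs.rot T c a.
rewrite -[nxt T (a, c)]/(c, d); set u := Defs.rot T d c; rewrite -[nxt T (c, d)]/(d, u) => E.
exists t, c, d; have ub : u = b by case: E.
by split=> //; [rewrite -[nxt T (c, d)]/(d, u) ub | rewrite -[in LHS]ub].
Qed.

Section OfConf.
Variables a b t c d : 'I_n.
Hypothesis cf : conf a b t c d.

Lemma conf_ab : adj T a b. Proof. by rewrite -in_darts; case/and3P: (cf_tri cf). Qed.
Lemma conf_abD : (a, b) \in darts T. Proof. by rewrite in_darts conf_ab. Qed.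
Lemma conf_baD : (b, a) \in darts T. Proof. by rewrite -(rev_darts plT) conf_abD. Qed.
Lemma conf_bt : adj T b t.
Proof. by rewrite -in_darts -(cf_t0 cf) nxt_darts // conf_abD. Qed.
Lemma conf_ta : adj T t a.
Proof. by rewrite -in_darts -(cf_t1 cf) nxt_darts // in_darts conf_bt. Qed.
Lemma conf_ac : adj T a c.
Proof. by rewrite -in_darts -(cf_q0 cf) nxt_darts // conf_baD. Qed.
Lemma conf_cd : adj T c d.
Proof. by rewrite -in_darts -(cf_q1 cf) nxt_darts // in_darts conf_ac. Qed.
Lemma conf_db : adj T d b.
Proof. by rewrite -in_darts -(cf_q2 cf) nxt_darts // in_darts conf_cd. Qed.

Lemma conf_tri z : sface T (a, b) z = (z \in [:: (a, b); (b, t); (t, a)]).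
Proof.
rewrite /sface (@fconnect_cycle _ _ [:: (a, b); (b, t); (t, a)]) ?mem_head //.
by rewrite /= (cf_t0 cf) (cf_t1 cf) (cf_t2 cf) !eqxx.
Qed.
Lemma conf_quad z : sface T (b, a) z = (z \in [:: (b, a); (a, c); (c, d); (d, b)]).
Proof.
rewrite /sface (@fconnect_cycle _ _ [:: (b, a); (a, c); (c, d); (d, b)]) ?mem_head //.
by rewrite /= (cf_q0 cf) (cf_q1 cf) (cf_q2 cf) (cf_q3 cf) !eqxx.
Qed.

Lemma conf_ne : ~~ sface T (a, b) (b, a).
Proof.
rewrite conf_tri !inE !xpair_eqE (eq_sym b a) (negbTE (adj_neq plT conf_ab)) /=.
by rewrite (eq_sym a t) (negbTE (adj_neq plT conf_ta)) (negbTE (adj_neq plT conf_bt)) andbF.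
Qed.

Lemma conf_disjoint z : z \in [:: (a, b); (b, t); (t, a)] -> z \notin [:: (b, a); (a, c); (c, d); (d, b)].
Proof.
move=> z1; apply/negP => z2; case/negP: conf_ne; apply: (sface_trans (d2 := z)).
  by rewrite conf_tri.
rewrite (sface_sym plT) ?conf_baD ?conf_quad //.
by apply: (sface_darts plT conf_baD); rewrite conf_quad.
Qed.

Lemma conf_uniq : uniq ([:: (a, b); (b, t); (t, a)] ++ [:: (b, a); (a, c); (c, d); (d, b)]).
Proof.
have e3 : fsize T (a, b) = 3 by case/and3P: (cf_tri cf) => _ _ /eqP.
have e4 : fsize T (b, a) = 4.
  apply: (inner4 triT conf_baD (cf_in cf)); apply/negP => h.
  by have := conf_ne; rewrite (inner3_uniq triT (cf_tri cf) h).
rewrite cat_uniq; apply/and3P; split.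
- have := orbit_uniq (nxt T) (a, b); rewrite /fingraph.orbit -[fingraph.order _ _]/(fsize T (a, b)) e3.
  by rewrite [traject _ _ _]/= (cf_t0 cf) (cf_t1 cf).
- by apply/hasPn => z z2; apply: contraL z2; apply: conf_disjoint.
- have := orbit_uniq (nxt T) (b, a); rewrite /fingraph.orbit -[fingraph.order _ _]/(fsize T (b, a)) e4.
  by rewrite [traject _ _ _]/= (cf_q0 cf) (cf_q1 cf) (cf_q2 cf).
Qed.

Lemma conf_cb : c != b.
Proof.
apply/eqP => E; have := conf_disjoint (mem_head (a, b) _).
by rewrite !inE E eqxx !orbT.
Qed.
Lemma conf_da : d != a.
Proof.
apply/eqP => E; have := conf_disjoint (mem_head (a, b) _).
by rewrite !inE E eqxx !orbT.
Qed.

(** The quadrangle has exactly one reflex angle and the triangle none, so the reflex vertex is a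
    corner of the quadrangle. *)
Lemma conf_pentagon : exists2 r, pentagon T a b t a c d b r & r \in [:: a; c; d; b].
Proof.
have nta := adj_neq plT conf_ta; have nbt := adj_neq plT conf_bt.
have nac := adj_neq plT conf_ac; have ndb := adj_neq plT conf_db.
have /eqP/cards1P[z Z] : #|face T (b, a) :&: rdarts T| = 1.
  have := card_face_reflex triT conf_baD (cf_in cf); rewrite card_face.
  rewrite (inner4 triT conf_baD (cf_in cf)); first by move: #|_| => k; lia.
  by apply/negP => h; have := conf_ne; rewrite (inner3_uniq triT (cf_tri cf) h).
have zr : z \in face T (b, a) :&: rdarts T by rewrite Z in_set1.
have /andP[zq zrd] : (z \in face T (b, a)) && (z \in rdarts T) by rewrite -in_setI.
have mem y : (y \in region a b t a c d b) =
   (y \in [:: (a, b); (b, t); (t, a)]) || (y \in [:: (b, a); (a, c); (c, d); (d, b)]).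
  by rewrite !inE; do ![case: (y == _); rewrite ?orbT //=].
exists z.2; last first.
  move: zq; rewrite mem_face conf_quad !inE.
  by do ![case/orP => [/eqP->|]; rewrite ?eqxx ?orbT //]; move/eqP->; rewrite eqxx !orbT.
split.
- exact: cf_tri cf.
- exact: cf_in cf.
- exact: conf_ne.
- rewrite /nxt /snd rot_delE (nxtE (cf_t2 cf)) /is_edge !eqxx /=.
  by rewrite -[Defs.rot T a b]/(nxt T (b, a)).2 (cf_q0 cf).
- rewrite /nxt /snd rot_delE (nxtE (cf_q1 cf)) /is_edge.
  by rewrite (eq_sym c a) (negbTE nac) (negbTE conf_cb).
- rewrite /nxt /snd rot_delE (nxtE (cf_q2 cf)) /is_edge.
  by rewrite (negbTE conf_da) (negbTE ndb).
- rewrite /nxt /snd rot_delE (nxtE (cf_q3 cf)) /is_edge !eqxx orbT /=.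
  by rewrite -[Defs.rot T b a]/(nxt T (a, b)).2 (cf_t0 cf).
- rewrite /nxt /snd rot_delE (nxtE (cf_t1 cf)) /is_edge.
  by rewrite (negbTE nta) (eq_sym t b) (negbTE nbt).
- by move=> y; rewrite conf_tri conf_quad mem.
- rewrite (eq_uniq (s2 := [:: (a, b); (b, t); (t, a)] ++ [:: (b, a); (a, c); (c, d); (d, b)])) ?conf_uniq //.
  by move=> y; rewrite mem mem_cat.
- by rewrite !inE eqxx orbT.
- by rewrite !inE eqxx !orbT.
- exists z.1; first by rewrite mem -surjective_pairing -conf_quad -mem_face zq orbT.
  by move: zrd; rewrite in_set => /andP[].
- move=> y; rewrite mem -conf_tri -conf_quad => yR yr; have yD : y \in darts T.
    by case/orP: yR; apply: sface_darts => //; rewrite ?conf_abD ?conf_baD.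
  have yrd : y \in rdarts T by rewrite in_set yD.
  case/orP: yR => [yt|yq]; last first.
    have : y \in face T (b, a) :&: rdarts T by rewrite in_setI mem_face yq.
    by rewrite Z in_set1 => /eqP ->.
  have /and3P[_ ai /eqP e3] := cf_tri cf.
  have := card_face_reflex triT conf_abD ai; rewrite card_face e3.
  by rewrite (cardD1 y) in_setI mem_face yt yrd; move: #|_| => k; lia.
Qed.
End OfConf.
End Configuration.

(** * Ears of the pentagon and chords outside it *)

Section Ears.
Variables (n : nat) (T : emb n).
Hypothesis triT : tri4PPT T.
Let plT := tri_plane triT.
Implicit Types (u v w : 'I_n) (d : 'I_n * 'I_n).

Lemma rot_iter_adj v u k : adj T v u -> adj T v (iter k (Defs.rot T v) u).
Proof. by move=> vu; elim: k => //= k; apply: adj_rot. Qed.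

Lemma rot_ind (Q : 'I_n -> Prop) v u : adj T v u -> Q u ->
  (forall x, adj T v x -> Q x -> Q (Defs.rot T v x)) -> forall w, adj T v w -> Q w.
Proof.
move=> vu Qu Qs w vw; have /iter_findex <- := rot_trans plT vu vw.
by elim: (findex _ _ _) => //= k; apply: Qs; apply: rot_iter_adj.
Qed.

(** If the rotation without [ab] fixes [u], the full rotation at [v] can only pass from [u] to [ab]
    and back. *)
Lemma rot_del_leaf a b v u w : adj T v u -> Defs.rot (del T a b) v u = u ->
  adj T v w -> w = u \/ is_edge a b v w.
Proof.
move=> vu; rewrite rot_delE => E vw.
suff : [\/ w = u | is_edge a b v w /\ Defs.rot T v w = u] by case=> [|[]]; [left | right].
move: w vw; apply: (rot_ind vu); first by left.
move=> x vx [-> | [_ ->]]; last by left.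
by move: E; case: ifP => e E; [right | left].
Qed.

Section Pent.
Variables a b p0 p1 p2 p3 p4 r : 'I_n.
Hypothesis pent : pentagon T a b p0 p1 p2 p3 p4 r.
Let R := region a b p0 p1 p2 p3 p4.

Lemma pent_dart d : d \in R -> d \in darts T.
Proof. exact: (region_darts triT pent). Qed.

(** The edge [p2 p4] closes the 3-cycle [p2 p3 p4]. As [ab] is not on it, both merged faces lie on
    the side of the inner triangle, where the vertices of the cycle are not reflex. At [p3] the walk
    turns directly from [p2] to [p4], so all other edges there except [ab] are on the outer side and
    do not reach a corner off the cycle. *)
Lemma chord : adj T p2 p4 -> ~~ is_edge a b p2 p4 ->
  r \notin [:: p2; p3; p4] /\
  forall w, w \in [:: p0; p1; p2; p3; p4] -> w \notin [:: p2; p3; p4] -> adj T p3 w -> is_edge a b p3 w.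
Proof.
move=> a24 e24; have inR d : d \in [:: (p0, p1); (p1, p2); (p2, p3); (p3, p4); (p4, p0)] -> d \in R.
  by move=> h; rewrite /R /region 2!in_cons h !orbT.
have a23 : adj T p2 p3 by rewrite -in_darts pent_dart // inR // !inE eqxx !orbT.
have a34 : adj T p3 p4 by rewrite -in_darts pent_dart // inR // !inE eqxx !orbT.
have e23 : ~~ is_edge a b p2 p3 by apply: (P5_not_edge pent); rewrite !inE eqxx !orbT.
have e34 : ~~ is_edge a b p3 p4 by apply: (P5_not_edge pent); rewrite !inE eqxx !orbT.
have a42 : adj T p4 p2 by rewrite (adjC plT).
have [lam [ln lr l3 lv lc]] := cyc3_sides triT a23 a34 a42.
set S := cyc3 p2 p3 p4 in lr.
have nS x y : (x, y) \in S -> ~~ is_edge a b x y.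
  rewrite /S !inE !xpair_eqE.
  by do ![case/orP => [/andP[/eqP-> /eqP->]|]; rewrite ?(is_edgeC _ _ p3 p2) ?(is_edgeC _ _ p4 p3) ?(is_edgeC _ _ p4 p2) //];
     move/andP=> [/eqP-> /eqP->].
have eS x y : is_edge a b x y -> ((x, y) \in S) = false.
  by move=> e; apply/negbTE/negP => /nS; rewrite e.
have abD := pent_ab pent; have baD := pent_ba triT pent.
have lR d : d \in R -> lam d.
  have lab : lam (a, b) by apply: l3; exact: pent_tri pent.
  have lba : lam (b, a).
    by have := lr _ abD; rewrite /rev_dart /= => ->; rewrite lab eS // /is_edge !eqxx.
  have sf e e' : e \in darts T -> sface T e e' -> lam e' = lam e.
    move=> eD /iter_findex <-; elim: (findex _ _ _) => //= k IH; rewrite ln //.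
    exact: (sface_darts plT eD (fconnect_iter _ _ _)).
  by rewrite -(pent_mem pent) => /orP[] /sf ->.
split.
  have [s sR rs] := pent_r pent.
  exact: (lc (s, r) (pent_dart sR) (lR _ sR) rs).
have l34 : lam (p4, p3) = false.
  have := lr (p3, p4); rewrite in_darts => /(_ a34); rewrite /rev_dart /= => ->.
  by rewrite lR ?inR ?inE ?eqxx ?orbT.
have l23 : lam (p2, p3) by rewrite lR ?inR // !inE eqxx !orbT.
have rot23 := nxtE (pent_n2 pent); rewrite rot_delE in rot23.
have ln' x y : adj T y x -> lam (y, Defs.rot T y x) = lam (x, y).
  by move=> yx; rewrite -(ln (x, y)) // in_darts (adjC plT).
have lr' x y : adj T x y -> lam (y, x) = lam (x, y) (+) ((x, y) \in S).
  by move=> xy; rewrite -lr // in_darts.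
(* Turning at [p3] from [p4] on, edges stay on the outer side until [p2]; between [p2] and [p4] only
   [ab] can lie. *)
have key w : adj T p3 w -> [\/ lam (w, p3) = false, w = p2 | is_edge a b p3 w /\ Defs.rot T p3 w = p4].
  move: w; apply: (rot_ind a34); first by constructor 1.
  move=> x ax; have ay := adj_rot plT ax; have lx := ln' x p3 ax; have ly := lr' _ _ ay.
  case=> [l|e|[e1 e2]]; last by rewrite e2; constructor 1.
    have [->|y2] := eqVneq (Defs.rot T p3 x) p2; first by constructor 2.
    have [->|y4] := eqVneq (Defs.rot T p3 x) p4; first by constructor 1.
    constructor 1; rewrite ly lx l !inE !xpair_eqE !eqxx (negbTE y2) (negbTE y4).
    by rewrite (negbTE (adj_neq plT a34)) (eq_sym p3 p2) (negbTE (adj_neq plT a23)).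
  by subst x; move: rot23; case: ifP => e; [constructor 3 | move=> ->; constructor 1].
move=> w wp wS aw; apply/negPn/negP => ne.
have w2 : w != p2 by apply: contraNneq wS => ->; rewrite !inE eqxx.
have lw : lam (w, p3) = false.
  by case: (key w aw) => // [e|[e _]]; [rewrite e eqxx in w2 | rewrite e in ne].
have [u uw uR] : exists2 u, adj T w u & (u, w) \in R.
  have: exists u, (u, w) \in [:: (p0, p1); (p1, p2); (p2, p3); (p3, p4); (p4, p0)].
    move: wp; rewrite !inE; do ![case/orP => [/eqP->|]]; last move/eqP->.
    - by exists p4; rewrite !inE eqxx !orbT.
    - by exists p0; rewrite !inE eqxx.
    - by exists p1; rewrite !inE eqxx !orbT.
    - by exists p2; rewrite !inE eqxx !orbT.
    - by exists p3; rewrite !inE eqxx !orbT.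
  case=> u /inR uR; exists u => //; by rewrite (adjC plT) -in_darts pent_dart.
have := lv w u p3 wS uw; rewrite (adjC plT) => /(_ aw); rewrite (lR _ uR) lr' ?(adjC plT w) //.
rewrite lw; suff -> : ((w, p3) \in S) = false by [].
apply: contraNF wS; rewrite /S !inE !xpair_eqE.
by do 5![case/orP => [/andP[/eqP-> _]|]; first by rewrite eqxx ?orbT]; case/andP=> /eqP->; rewrite eqxx.
Qed.
End Pent.

(* The chords of two consecutive ears cross; and if one of them is already an edge, it closes
   a 3-cycle around the pentagon, so that the tip of the other ear is not reflex. *)
Lemma two_ears a b p0 p1 p2 p3 p4 r : pentagon T a b p0 p1 p2 p3 p4 r -> p0 != p2 ->
  ~~ is_edge a b p2 p4 -> ~~ is_edge a b p3 p0 ->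
  (exists U, moved T a b p3 p4 p0 p1 p2 U) \/ (exists U, moved T a b p4 p0 p1 p2 p3 U).
Proof.
move=> pent p02 e24 e30.
have inR d : d \in [:: (p0, p1); (p1, p2); (p2, p3); (p3, p4); (p4, p0)] -> adj T d.1 d.2.
  move=> h; rewrite -in_darts -surjective_pairing; apply: (region_darts triT pent).
  by rewrite /region 2!in_cons h !orbT.
have a01 : adj T p0 p1 by apply: (inR (p0, p1)); rewrite !inE eqxx ?orbT.
have a12 : adj T p1 p2 by apply: (inR (p1, p2)); rewrite !inE eqxx ?orbT.
have a23 : adj T p2 p3 by apply: (inR (p2, p3)); rewrite !inE eqxx ?orbT.
have a34 : adj T p3 p4 by apply: (inR (p3, p4)); rewrite !inE eqxx ?orbT.
have a40 : adj T p4 p0 by apply: (inR (p4, p0)); rewrite !inE eqxx ?orbT.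
have pent1 := pentagon_rot pent; have pent2 := pentagon_rot pent1.
have pent3 := pentagon_rot pent2; have pent4 := pentagon_rot pent3.
(* [ear3] has tip [p3] and chord [p2 p4], [ear4] has tip [p4] and chord [p3 p0]. *)
have ear3 : p2 != p4 -> ~~ adj T p2 p4 -> r \in [:: p0; p1; p2; p4] -> exists U, moved T a b p3 p4 p0 p1 p2 U.
  move=> n24 na rP; apply: (moved_exists triT pent3); rewrite ?(eq_sym p4) ?(adjC plT p4) //.
  by move: rP; rewrite !inE; do ![case: (r == _); rewrite ?orbT //=].
have ear4 : p3 != p0 -> ~~ adj T p3 p0 -> r \in [:: p0; p1; p2; p3] -> exists U, moved T a b p4 p0 p1 p2 p3 U.
  move=> n30 na rP; apply: (moved_exists triT pent4); rewrite ?(eq_sym p0) ?(adjC plT p0) //.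
have rP : r \in [:: p0; p1; p2; p3; p4].
  have [s sR _] := pent_r pent; have := pent_a pent; have := pent_b pent.
  move: sR; rewrite /region in_cons xpair_eqE => /orP[/andP[_ /eqP->]//|].
  rewrite in_cons xpair_eqE => /orP[/andP[_ /eqP->]//|].
  rewrite !inE !xpair_eqE => h _ _; move: h.
  by do ![case/orP => [/andP[_ ->]|]; rewrite ?orbT //]; case/andP=> _ ->.
(* The chord of [ear3] would be a loop; but then [p3] is pendant once [ab] is deleted, so [p3 p0] is
   not an edge. *)
have [e|n24] := eqVneq p2 p4.
  right; have leaf w : adj T p3 w -> w = p2 \/ is_edge a b p3 w.
    apply: rot_del_leaf; first by rewrite (adjC plT).
    by rewrite (nxtE (pent_n2 pent)) e.
  have n30 : p3 != p0.
    apply/eqP => e'; have := leaf p1; rewrite e' a01 => /(_ isT)[e''|].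
      by rewrite e'' adjxx in a12.
    by apply/negP; rewrite (P5_not_edge pent) // !inE eqxx.
  apply: ear4 => //.
    by apply/negP => /leaf[E|]; [rewrite E eqxx in p02 | apply/negP].
  by move: rP; rewrite !inE -e; do ![case: (r == _); rewrite ?orbT //=].
have [e|n30] := eqVneq p3 p0.
  left; have leaf w : adj T p4 w -> w = p3 \/ is_edge a b p4 w.
    apply: rot_del_leaf; first by rewrite (adjC plT).
    by rewrite (nxtE (pent_n3 pent)) e.
  apply: ear3 => //.
    apply/negP; rewrite (adjC plT) => /leaf[E|].
      by rewrite E adjxx in a23.
    by rewrite is_edgeC; apply/negP.
  by move: rP; rewrite !inE -e; do ![case: (r == _); rewrite ?orbT //=].
case c24: (adj T p2 p4).
  right; have [rN nb] := chord pent c24 e24.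
  apply: ear4 => //.
    apply: contraNN e30; apply: nb; first by rewrite !inE eqxx.
    by rewrite !inE !negb_or p02 (eq_sym p0 p3) n30 (eq_sym p0 p4) (adj_neq plT a40).
  by move: rP rN; rewrite !inE; do ![case: (r == _); rewrite ?orbT //=].
case c30: (adj T p3 p0).
  left; have [rN nb] := chord pent1 c30 e30.
  apply: ear3 => //; first by rewrite c24.
  by move: rP rN; rewrite !inE; do ![case: (r == _); rewrite ?orbT //=].
(* Neither chord is an edge: cut off an ear whose tip is not [r]. *)
have [e3|n3] := eqVneq r p3.
  by right; apply: ear4; rewrite // ?c30 // e3 !inE eqxx !orbT.
left; apply: ear3; rewrite ?c24 //.
by move: rP; rewrite !inE (negbTE n3); do ![case: (r == _); rewrite ?orbT //=].
Qed.
End Ears.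

(** * Moving the inner triangle *)

(** Directed sequences of flips between actual embeddings; isomorphisms enter only with [freach]. *)
Inductive flips n : nat -> emb n -> emb n -> Prop :=
| flips0 T : flips 0 T T
| flipsS k T W U : tri4PPT T -> tri4PPT W -> flip T W -> flips k W U -> flips k.+1 T U.

Lemma flips_cat n j k (T W U : emb n) : flips j T W -> flips k W U -> flips (j + k) T U.
Proof.
elim=> [//|i T' W' U' tT tW f _ IH] /IH; rewrite addSn; exact: flipsS tT tW f.
Qed.

Lemma flips1 n (T U : emb n) : tri4PPT T -> tri4PPT U -> flip T U -> flips 1 T U.
Proof. by move=> tT tU f; apply: flipsS tT tU f (flips0 _). Qed.

Record keeps n (T U : emb n) (X : {set 'I_n * 'I_n}) : Prop := Keeps {
  kp_darts : {subset X <= darts U};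
  kp_nxt : forall d, d \in X -> nxt U d = nxt T d;
  kp_reflex : forall d, d \in X -> reflex U d.2 d.1 = reflex T d.2 d.1;
  kp_odart : odart U = odart T }.

(** The part to be left alone: a union of faces that contains the outer one. Flips between other
    faces preserve it. *)
Record closed_part n (T : emb n) (X : {set 'I_n * 'I_n}) : Prop := ClosedPart {
  cp_darts : {subset X <= darts T};
  cp_nxt : forall d, d \in X -> nxt T d \in X;
  cp_odart : odart T \in X }.

Lemma keeps_closed n (T U : emb n) X : closed_part T X -> keeps T U X -> closed_part U X.
Proof.
by move=> [XD Xn Xo] [kD kn kr ko]; split=> // [d dX|]; rewrite ?ko // kn // Xn.
Qed.

Lemma keeps_refl n (T : emb n) X : closed_part T X -> keeps T T X.
Proof. by case=> XD _ _; split. Qed.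

Lemma keeps_trans n (T W U : emb n) X : keeps T W X -> keeps W U X -> keeps T U X.
Proof.
move=> [d1 n1 r1 o1] [d2 n2 r2 o2]; split=> // [d dX|d dX|].
- by rewrite n2 // n1.
- by rewrite r2 // r1.
- by rewrite o2.
Qed.

(** Used with a face for [P]: the path after its last visit to the face avoids it, so it survives a
    flip that alters the face. *)
Lemma last_exit (D : eqType) (e : rel D) (P : pred D) x p :
  path e x p -> has P (x :: p) -> ~~ P (last x p) ->
  exists y z q, [/\ P y, e y z, path e z q, all (predC P) (z :: q) &
    [/\ last z q = last x p, size q < size p, y \in x :: p & {subset z :: q <= p}]].
Proof.
elim: p x => [|z p IH] x; first by rewrite /= orbF => _ ->.
move=> /= /andP[xz zp] h Pl; case: (boolP (has P (z :: p))) => [A|nA].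
  have [y [w [q [Py yw wq B [l s yp sub]]]]] := IH z zp A Pl.
  exists y, w, q; split=> //; split=> //; first exact: ltnW.
    by rewrite in_cons yp orbT.
  by move=> u /sub up; rewrite in_cons up orbT.
exists x, z, p; split=> //; first by case/orP: h => // h; case/negP: nA.
  by rewrite all_predC -negb_or; exact: nA.
by split=> //; rewrite mem_head.
Qed.

Section InnerFaces.
Variables (n : nat) (T : emb n).
Hypothesis triT : tri4PPT T.
Let plT := tri_plane triT.

Lemma inner_sface d z : d \in darts T -> ~~ sface T (odart T) d -> sface T d z -> ~~ sface T (odart T) z.
Proof.
move=> dD i s; apply: contra i => o; apply: sface_trans o _.
by rewrite (sface_sym plT) // (sface_darts plT dD).
Qed.

Lemma inner3_sface d z : inner3 T d -> sface T d z -> inner3 T z.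
Proof.
case/and3P=> dD i f s; have zD := sface_darts plT dD s.
apply/and3P; split=> //; first exact: inner_sface s.
have /eqP fz : face T d == face T z by rewrite faceE.
by rewrite -card_face -fz card_face.
Qed.
End InnerFaces.

(** * Moving the triangle across an edge *)

Section Cross.
Variables (n : nat) (T : emb n).
Hypothesis triT : tri4PPT T.
Let plT := tri_plane triT.

(** One flip across the edge of [e] that puts the dart [g] on the inner triangle and touches only
    the two faces at [e]. *)
Record crossed (e : 'I_n * 'I_n) (g : 'I_n * 'I_n) (U : emb n) : Prop := Crossed {
  cr_tri : tri4PPT U;
  cr_flip : flip T U;
  cr_inner : inner3 U g;
  cr_nxt : forall d, d \in darts T -> ~~ sface T e d -> ~~ sface T (rev_dart e) d -> nxt U d = nxt T d;
  cr_reflex : forall d, d \in darts T -> ~~ sface T e d -> ~~ sface T (rev_dart e) d ->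
    reflex U d.2 d.1 = reflex T d.2 d.1;
  cr_darts : forall d, d \in darts T -> ~~ sface T e d -> ~~ sface T (rev_dart e) d -> d \in darts U;
  cr_odart : odart U = odart T }.

Lemma closed_part_sface X d d' : closed_part T X -> d \in darts T -> sface T d d' ->
  (d' \in X) = (d \in X).
Proof.
move=> [XD Xn _] dD s; have Xs e e' : e \in X -> sface T e e' -> e' \in X.
  by move=> eX /iter_findex <-; elim: (findex _ _ _) => //= k; apply: Xn.
by apply/idP/idP => h; apply: Xs h _; rewrite // (sface_sym plT) // (sface_darts plT dD).
Qed.

Lemma crossed_keeps e g U X : crossed e g U -> closed_part T X -> e \in darts T ->
  e \notin X -> rev_dart e \notin X -> keeps T U X.
Proof.
case=> tU fU i3 nn rr dd oo cp eD eX reX; have [XD _ _] := cp.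
have out d : d \in X -> ~~ sface T e d /\ ~~ sface T (rev_dart e) d.
  move=> dX; split; apply/negP => s; [case/negP: eX | case/negP: reX].
    by rewrite -(closed_part_sface cp eD s).
  by rewrite -(closed_part_sface cp _ s) // rev_darts.
by split=> // d dX; have [n1 n2] := out d dX; have dD := XD d dX; [exact: dd | exact: nn | exact: rr].
Qed.

Lemma crossed_moved a b p0 p1 p2 p3 p4 r U g : pentagon T a b p0 p1 p2 p3 p4 r ->
  moved T a b p0 p1 p2 p3 p4 U -> g \in [:: (p0, p1); (p1, p4); (p4, p0)] -> crossed (a, b) g U.
Proof.
move=> pt mv gP; have out d : ~~ sface T (a, b) d -> ~~ sface T (b, a) d -> d \notin region a b p0 p1 p2 p3 p4.
  by move=> s1 s2; rewrite -(pent_mem pt) negb_or s1.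
split.
- exact: mv_tri mv.
- exact: mv_flip mv.
- exact: mv_inner3 mv _ gP.
- by move=> d dD s1 s2; apply: (mv_out mv dD); apply: out.
- by move=> d dD s1 s2; apply: (mv_reflex mv dD); apply: out.
- move=> d dD s1 s2; have := out d s1 s2; rewrite [d \in darts U]in_set (mv_adj mv).
  rewrite is_edge_dart -surjective_pairing /region 2!in_cons !negb_or => /and3P[-> -> _].
  by move: dD; rewrite in_set => ->.
- exact: mv_odart mv.
Qed.

(** The ears with tips [c] and [d] both contain the edge [cd], so either outcome of [two_ears] will
    do, and its side conditions always hold here. *)
Lemma cross_mid a b t c d : conf T a b t c d -> exists U, crossed (a, b) (c, d) U.
Proof.
move=> cf; have [r pt _] := conf_pentagon triT cf.
have pt1 := pentagon_rot pt; have pt2 := pentagon_rot pt1.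
have pt3 := pentagon_rot pt2; have pt4 := pentagon_rot pt3.
have ba : b != a by rewrite eq_sym (adj_neq plT (conf_ab cf)).
have e1 : ~~ is_edge a b a d.
  by rewrite /is_edge (negbTE (adj_neq plT (conf_db triT cf))) (eq_sym a b) (negbTE ba) !andbF.
have e2 : ~~ is_edge a b c b.
  rewrite /is_edge (eq_sym c a) (negbTE (adj_neq plT (conf_ac triT cf))) /=.
  by rewrite (negbTE (conf_cb triT cf)).
have [[U mv]|[U mv]] := two_ears triT pt4 ba e1 e2; exists U.
  apply: (crossed_moved (pentagon_rot (pentagon_rot (pentagon_rot pt4))) mv).
  by rewrite !inE eqxx.
apply: (crossed_moved (pentagon_rot (pentagon_rot (pentagon_rot (pentagon_rot pt4)))) mv).
by rewrite !inE eqxx !orbT.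
Qed.

(** [crossed] depends on [e] only through the two faces at [e]. *)
Lemma eq_crossed e e' g U : e \in darts T -> e' \in darts T ->
  sface T e' e -> sface T (rev_dart e') (rev_dart e) -> crossed e' g U -> crossed e g U.
Proof.
move=> eD eD' s1 s2 [tU f i3 nn rr dd oo].
have st d : d \in darts T -> ~~ sface T e d -> ~~ sface T e' d.
  by move=> dD; apply: contra => h; apply: sface_trans h; rewrite (sface_sym plT).
have sq d : d \in darts T -> ~~ sface T (rev_dart e) d -> ~~ sface T (rev_dart e') d.
  by move=> dD; apply: contra => h; apply: sface_trans h; rewrite (sface_sym plT) ?rev_darts.
by split=> // d dD /(st d dD) n1 /(sq d dD) n2; [exact: nn | exact: rr | exact: dd].
Qed.

(* When the far end of the new boundary edge is pendant after deleting ab, the edge of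
   the inner triangle to be deleted is another common edge of the two faces. *)
Lemma cross a b t c d g : conf T a b t c d -> g \in [:: (a, c); (c, d); (d, b)] ->
  exists U, crossed (a, b) g U.
Proof.
move=> cf; have abD := conf_abD cf; have baD := conf_baD triT cf.
have nab := adj_neq plT (conf_ab cf); have nbt := adj_neq plT (conf_bt triT cf).
have nta := adj_neq plT (conf_ta triT cf); have nac := adj_neq plT (conf_ac triT cf).
have ndb := adj_neq plT (conf_db triT cf); have ncb := conf_cb triT cf; have nda := conf_da triT cf.
have sq z : sface T (b, a) z = (z \in [:: (b, a); (a, c); (c, d); (d, b)]) := conf_quad cf z.
have st z : sface T (a, b) z = (z \in [:: (a, b); (b, t); (t, a)]) := conf_tri cf z.
have i3 z : z \in [:: (a, b); (b, t); (t, a)] -> inner3 T z.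
  by rewrite -st; apply: (inner3_sface triT (cf_tri cf)).
have iq z : z \in [:: (b, a); (a, c); (c, d); (d, b)] -> ~~ sface T (odart T) z.
  by rewrite -sq; apply: (inner_sface triT baD (cf_in cf)).
have [r pt _] := conf_pentagon triT cf.
have pt1 := pentagon_rot pt; have pt2 := pentagon_rot pt1.
have pt3 := pentagon_rot pt2; have pt4 := pentagon_rot pt3.
rewrite !inE => /or3P[]/eqP->.
(* The ears with tips [a] and [c] contain [ac], and [two_ears] needs [d != t]. If [d = t], then [bd]
   is a second common edge, and [ac] is opposite to it in the quadrangle. *)
- have [dt|dt] := eqVneq d t.
    subst t; have cf' : conf T b d a a c.
      by case: cf => ? ? ? ? ? ? ? ? ?; split=> //; [apply: i3 | apply: iq]; rewrite !inE eqxx ?orbT.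
    have [U cU] := cross_mid cf'; exists U; apply: eq_crossed cU => //.
    - by rewrite in_darts; exact: conf_bt cf.
    - by rewrite (sface_sym plT) ?in_darts ?(conf_bt triT cf) ?(conf_ab cf) // st !inE eqxx orbT.
    - rewrite (sface_sym plT) ?rev_darts ?in_darts ?(conf_bt triT cf) ?(conf_ab cf) // sq.
      by rewrite !inE eqxx !orbT.
  have e1 : ~~ is_edge a b t c by rewrite /is_edge (negbTE nta) (eq_sym t b) (negbTE nbt).
  have e2 : ~~ is_edge a b a d by rewrite /is_edge (negbTE ndb) (negbTE nab) andbF.
  have [[U mv]|[U mv]] := two_ears triT pt3 dt e1 e2; exists U.
    apply: (crossed_moved (pentagon_rot (pentagon_rot (pentagon_rot pt3))) mv).
    by rewrite !inE eqxx.
  apply: (crossed_moved (pentagon_rot (pentagon_rot (pentagon_rot (pentagon_rot pt3)))) mv).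
  by rewrite !inE eqxx !orbT.
- exact: cross_mid cf.
- have [tc|tc] := eqVneq t c.
    subst t; have cf' : conf T c a b d b.
      by case: cf => ? ? ? ? ? ? ? ? ?; split=> //; [apply: i3 | apply: iq]; rewrite !inE eqxx ?orbT.
    have [U cU] := cross_mid cf'; exists U; apply: eq_crossed cU => //.
    - by rewrite in_darts; exact: conf_ta cf.
    - by rewrite (sface_sym plT) ?in_darts ?(conf_ta triT cf) ?(conf_ab cf) // st !inE eqxx !orbT.
    - rewrite (sface_sym plT) ?rev_darts ?in_darts ?(conf_ta triT cf) ?(conf_ab cf) // sq.
      by rewrite !inE eqxx !orbT.
  have e1 : ~~ is_edge a b c b by rewrite /is_edge (eq_sym c a) (negbTE nac) (negbTE ncb).
  have e2 : ~~ is_edge a b d t by rewrite /is_edge (negbTE nda) (negbTE ndb).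
  have [[U mv]|[U mv]] := two_ears triT pt tc e1 e2; exists U.
    apply: (crossed_moved (pentagon_rot (pentagon_rot (pentagon_rot pt))) mv).
    by rewrite !inE eqxx.
  apply: (crossed_moved (pentagon_rot (pentagon_rot (pentagon_rot (pentagon_rot pt)))) mv).
  by rewrite !inE eqxx !orbT.
Qed.
End Cross.

(** Moving along a face or across an edge: a path of darts stands for a path of faces and records
    the edges crossed. *)
Definition dual_step n (T : emb n) : rel ('I_n * 'I_n) := fun d d' => (d' == nxt T d) || (d' == rev_dart d).

(** Each flip crosses one edge of the path. It destroys the triangle and the quadrangle behind that
    edge, so the path is cut at its last exit from each of them. The rest is shorter and still a
    path after the flip, which is chosen so that the second exit edge bounds the new triangle. *)
Lemma bring n m (T : emb n) (X : {set 'I_n * 'I_n}) d0 p :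
  tri4PPT T -> closed_part T X -> inner3 T d0 -> path (dual_step T) d0 p ->
  all (fun d => d \notin X) (d0 :: p) -> rev_dart (last d0 p) \in X -> size p <= m ->
  exists k U, [/\ k <= m, flips k T U, tri4PPT U, keeps T U X & inner3 U (last d0 p)].
Proof.
elim: m T d0 p => [|m IH] T d0 p triT cpX d03 pp pX gX sz.
  by move: sz; rewrite leqn0 => /nilP ->; exists 0, T; split=> //; [exact: flips0 | exact: keeps_refl].
have plT := tri_plane triT; have [XD Xn Xo] := cpX; have /and3P[d0D d0i _] := d03.
have Xs d d' : d \in X -> sface T d d' -> d' \in X.
  by move=> dX /iter_findex <-; elim: (findex _ _ _) => //= k; apply: Xn.
have Xs' d d' : d \in darts T -> d' \in darts T -> d \notin X -> sface T d d' -> d' \notin X.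
  by move=> dD d'D dX s; apply: contra dX => d'X; apply: (Xs d') => //; rewrite (sface_sym plT).
set g := last d0 p in gX *.
have [gT|gT] := boolP (sface T d0 g).
  exists 0, T; split=> //; [exact: flips0 | exact: (inner3_sface triT d03)].
have h0 : has (sface T d0) (d0 :: p) by rewrite /= sface_refl.
have [y [z [q [Py yz zq A [l sq _ sub]]]]] := last_exit pp h0 gT.
have yD := sface_darts plT d0D Py; have y3 := inner3_sface triT d03 Py.
have zE : z = rev_dart y.
  case/orP: yz => /eqP // zn; have /andP[/= /negP nz _] := A; case: nz.
  by rewrite zn; apply: sface_trans Py (sface_nxt _ _).
have zD : z \in darts T by rewrite zE rev_darts.
have qX : all (fun d => d \notin X) (z :: q).
  by apply/allP => d /sub dp; move/allP: pX => /(_ d); apply; rewrite in_cons dp orbT.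
have zX : z \notin X by case/andP: qX.
have yX : y \notin X by apply: Xs' Py => //; case/andP: pX.
have zi : ~~ sface T (odart T) z by apply: contra zX; apply: Xs.
case: y => a b in Py yz zE yD y3 yX *; rewrite /rev_dart /= in zE; subst z.
have [t [c [d cf]]] := conf_exists triT y3 zi.
have tri_face e : sface T (a, b) e = sface T d0 e.
  apply/idP/idP => s; first exact: sface_trans Py s.
  by apply: sface_trans s; rewrite (sface_sym plT).
have crossX g' U : crossed T (a, b) g' U -> keeps T U X by move=> cU; apply: (crossed_keeps triT cU cpX yD yX zX).
have quadP e : sface T (b, a) e -> e != (b, a) -> e \in [:: (a, c); (c, d); (d, b)].
  by rewrite (conf_quad cf) in_cons => /orP[->|].
have [gF|gF] := boolP (sface T (b, a) g).
  (* The reverse of [g] is in [X], that of [(b, a)] is not. *)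
  have gba : g != (b, a) by apply: contraNneq yX => E; move: gX; rewrite E.
  have [U cU] := cross triT cf (quadP g gF gba); exists 1, U; split=> //.
  - by apply: (flips1 triT); [exact: cr_tri cU | exact: cr_flip cU].
  - exact: cr_tri cU.
  - exact: crossX cU.
  - exact: cr_inner cU.
have gF' : ~~ sface T (b, a) (last (b, a) q) by rewrite l.
have h1 : has (sface T (b, a)) ((b, a) :: q) by rewrite /= sface_refl.
have [y2 [z2 [q2 [Py2 yz2 zq2 A2 [l2 sq2 _ sub2]]]]] := last_exit zq h1 gF'.
have y2D := sface_darts plT zD Py2.
have z2E : z2 = rev_dart y2.
  case/orP: yz2 => /eqP // zn; have /andP[/= /negP nz _] := A2; case: nz.
  by rewrite zn; apply: sface_trans Py2 (sface_nxt _ _).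
have out2 e : e \in z2 :: q2 -> [/\ e \in z2 :: q2, e \notin X, ~~ sface T (a, b) e & ~~ sface T (b, a) e].
  move=> eq2; have eq := sub2 _ eq2; split=> //.
  - by move/allP: qX; apply; rewrite in_cons eq orbT.
  - by rewrite tri_face; move/allP: A => /(_ e); apply; rewrite in_cons eq orbT.
  - by move/allP: A2 => /(_ e); apply.
have y2ba : y2 != (b, a).
  apply: contraTneq (mem_head z2 q2) => E; apply/negP => /out2[_ _ /negP[]].
  rewrite z2E E; exact: sface_refl.
have [U cU] := cross triT cf (quadP y2 Py2 y2ba).
have kU := crossX _ _ cU; have tU := cr_tri cU.
have nxtU e : e \in z2 :: q2 -> e \in darts T -> nxt U e = nxt T e.
  by move=> /out2[_ _ n1 n2] eD; apply: (cr_nxt cU).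
have pU : path (dual_step U) y2 (z2 :: q2).
  rewrite /= {1}/dual_step z2E eqxx orbT /= -z2E.
  have z2D : z2 \in darts T by rewrite z2E rev_darts.
  elim: (q2) (z2) z2D zq2 nxtU => //= w s IHs v vD /andP[vw ws] H.
  have wD : w \in darts T by case/orP: vw => /eqP ->; rewrite ?nxt_darts ?rev_darts.
  rewrite {1}/dual_step H ?mem_head // -/(dual_step T v w) vw /=.
  by apply: IHs => // e es; apply: H; rewrite in_cons es orbT.
have y2X : y2 \notin X by apply: Xs' Py2.
have [|||k [W [km fl tW kW i3]]] := IH U y2 (z2 :: q2) tU (keeps_closed cpX kU) (cr_inner cU) pU.
- by apply/allP => e; rewrite in_cons => /orP[/eqP->//|/out2[]].
- by rewrite /= l2 l.
- by apply: leq_trans sq2 _; rewrite -ltnS (leq_trans sq).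
exists k.+1, W; split=> //.
- by apply: flipsS fl => //; exact: cr_flip cU.
- exact: keeps_trans kU kW.
- by move: i3; rewrite /= l2 l.
Qed.

(** * Sweeping around a vertex *)

Definition link n (T : emb n) (X : {set 'I_n * 'I_n}) (x y u w : 'I_n) :=
  [&& (x, u) \in X, nxt T (x, u) == (u, y), nxt T (u, y) == (y, w) & nxt T (w, x) == (x, u)].

(* The finished part: v1, ..., v are adjacent to both ends of the outer edge xy, consecutive
   ones are opposite corners of a quadrangle, all but possibly v have degree 2, and X
   consists of the darts of the outer face and of these quadrangles. *)
Record chain n (T : emb n) (X : {set 'I_n * 'I_n}) (x y v1 : 'I_n) (s : seq 'I_n) : Prop := Chain {
  ch_tri : tri4PPT T;
  ch_closed : closed_part T X;
  ch_outer : odart T = (x, y);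
  ch_uniq : uniq [:: x, y, v1 & s];
  ch_first : nxt T (x, y) = (y, v1);
  ch_last : nxt T (v1, x) = (x, y);
  ch_path : path (link T X x y) v1 s;
  ch_side : forall u, u \in v1 :: s -> [/\ (y, u) \in X, nxt T (y, u) = (u, x) & reflex T u y];
  ch_head : forall d, d \in X -> d.2 \in [:: x, y, v1 & s];
  ch_v : forall u, (u, last v1 s) \in X -> u = y }.

Lemma chain_keeps n (T U : emb n) X x y v1 s :
  chain T X x y v1 s -> keeps T U X -> tri4PPT U -> chain U X x y v1 s.
Proof.
case=> tT cT oT uT fT lT pT sT hT vT [kd kn kr ko] tU.
have [Xd Xn Xo] := cT; have oyX : (x, y) \in X by rewrite -oT.
have v1s : v1 \in v1 :: s by rewrite mem_head.
have [yv nyv _] := sT v1 v1s; have vxX : (v1, x) \in X by rewrite -nyv; apply: Xn.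
split=> //.
- exact: (keeps_closed cT (Keeps kd kn kr ko)).
- by rewrite ko.
- by rewrite kn.
- by rewrite kn.
- apply: sub_in_path pT; last exact: allss.
  move=> u w us ws /and4P[xuX /eqP n1 /eqP n2 /eqP n3].
  have uyX : (u, y) \in X by rewrite -n1; apply: Xn.
  have [ywX nyw _] := sT w ws; have wxX : (w, x) \in X by rewrite -nyw; apply: Xn.
  by rewrite /link xuX !kn // n1 n2 n3 !eqxx.
- move=> u us; have [yu nyu ru] := sT u us; split; rewrite ?kn //.
  by rewrite (kr (y, u)).
Qed.

Section Sweep.
Variables (n : nat) (X : {set 'I_n * 'I_n}) (x y v1 : 'I_n) (s : seq 'I_n).
Let v := last v1 s.
Implicit Types (T U : emb n).

Definition degree T (u : 'I_n) := #|[set w | adj T u w]|.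

Section Basics.
Variables (T : emb n).
Hypothesis ch : chain T X x y v1 s.
Let triT := ch_tri ch.
Let plT := tri_plane triT.

Lemma ch_mem : v \in v1 :: s. Proof. exact: mem_last. Qed.
Lemma ch_yvX : (y, v) \in X. Proof. by case: (ch_side ch ch_mem). Qed.
Lemma ch_nyv : nxt T (y, v) = (v, x). Proof. by case: (ch_side ch ch_mem). Qed.
Lemma ch_vxX : (v, x) \in X. Proof. by rewrite -ch_nyv; case: (ch_closed ch) => _ H _; apply/H/ch_yvX. Qed.
Lemma ch_vy : adj T v y.
Proof. by rewrite (adjC plT) -in_darts; case: (ch_closed ch) => H _ _; apply/H/ch_yvX. Qed.
Lemma ch_vx : adj T v x.
Proof. by rewrite -in_darts; case: (ch_closed ch) => H _ _; apply/H/ch_vxX. Qed.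
Lemma ch_xy : x != y. Proof. by case/and3P: (ch_uniq ch); rewrite in_cons negb_or => /andP[]. Qed.
Lemma ch_xyD : adj T x y.
Proof. by rewrite -in_darts -(ch_outer ch) odartP. Qed.
Lemma ch_rot : Defs.rot T v y = x. Proof. exact: nxtE ch_nyv. Qed.
Lemma ch_outX d : d \in darts T -> d \notin X -> ~~ sface T (odart T) d.
Proof.
move=> dD; apply: contra => h.
by rewrite (closed_part_sface triT (ch_closed ch) (odartP plT) h); case: (ch_closed ch).
Qed.
Lemma ch_notX u : u != y -> (u, v) \notin X.
Proof. by apply: contra => /(ch_v ch) ->. Qed.
Lemma ch_rot_y q : adj T v q -> Defs.rot T v q = x -> q = y.
Proof. by move=> vq e; apply: (adj_rot_inj plT vq ch_vy); rewrite ch_rot. Qed.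

(** Only [(y, v)] enters [v] within [X], and [(v, x)] follows it; on a triangle the next dart would
    be [(x, y)], which is outer. *)
Lemma ch_inner3 u : inner3 T (u, v) -> (u, v) \notin X.
Proof.
move=> u3; apply/negP => uX; have [t [n0 n1 n2]] := tri_third triT u3.
have uy := ch_v ch uX; have tx : t = x by move: n0; rewrite uy ch_nyv => -[].
have /and3P[uD /negP o _] := u3; apply: o; rewrite (ch_outer ch) -tx -uy (sface_sym plT) //.
  by apply: sface_trans (sface_nxt _ _) _; rewrite n0 -n1 sface_nxt.
by rewrite -n1 -n0; do 2!apply: (nxt_darts plT).
Qed.

(** The reflex angle of [v] is spent in the finished part, so the tags never prevent [v] from being
    the tip of an ear. *)
Lemma ch_r a b p0 p1 p2 p3 p4 r : pentagon T a b p0 p1 p2 p3 p4 r ->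
  (a, b) \notin X -> (b, a) \notin X -> r != v.
Proof.
move=> pt abX baX; apply/eqP => rv; have [u uR ru] := pent_r pt.
have uD := region_darts triT pt uR; rewrite rv in uR ru uD.
have [_ _ rvy] := ch_side ch ch_mem.
have uy : u = y by apply: (reflex_uniq triT _ ru ch_vy rvy); rewrite (adjC plT) -in_darts.
have := ch_yvX; rewrite -uy => uX; move: uR; rewrite -(pent_mem pt) => /orP[] h.
  by case/negP: abX; rewrite -(closed_part_sface triT (ch_closed ch) (pent_ab pt) h).
by case/negP: baX; rewrite -(closed_part_sface triT (ch_closed ch) (pent_ba triT pt) h).
Qed.

Lemma ch_moved a b p0 p1 p2 p3 p4 r U : pentagon T a b p0 p1 p2 p3 p4 r ->
  moved T a b p0 p1 p2 p3 p4 U -> (a, b) \notin X -> (b, a) \notin X ->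
  [/\ keeps T U X, chain U X x y v1 s & flips 1 T U].
Proof.
move=> pt mv abX baX; have cr := crossed_moved pt mv (mem_head _ _).
have kp := crossed_keeps triT cr (ch_closed ch) (pent_ab pt) abX baX.
split=> //; first exact: (chain_keeps ch kp (mv_tri mv)).
by apply: (flips1 triT); [exact: mv_tri mv | exact: mv_flip mv].
Qed.
End Basics.

(** The round for [v] is over: [x v y w] is a quadrangle, and the triangle has a dart into the next
    vertex [w]. *)
Record closed_off U (w : 'I_n) : Prop := ClosedOff {
  co_chain : chain U X x y v1 s;
  co_n1 : nxt U (x, v) = (v, y);
  co_n2 : nxt U (v, y) = (y, w);
  co_n3 : nxt U (y, w) = (w, x);
  co_n4 : nxt U (w, x) = (x, v);
  co_inner : ~~ sface U (odart U) (x, v);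
  co_tri : exists u, inner3 U (u, w) }.

(** Cutting off the ear with tip [p3] or [p4] keeps [x v y] on the quadrangle; its fourth corner [w]
    is then [p4] or [p3]. *)
Lemma finish T a b p3 p4 r : chain T X x y v1 s -> pentagon T a b x v y p3 p4 r ->
  (a, b) \notin X -> (b, a) \notin X -> ~~ is_edge a b y p4 -> ~~ is_edge a b p3 x ->
  exists U w, [/\ flips 1 T U, keeps T U X & closed_off U w].
Proof.
move=> ch pt abX baX e1 e2; have triT := ch_tri ch.
have pt3 := pentagon_rot (pentagon_rot (pentagon_rot pt)).
have pt4 := pentagon_rot pt3.
have [[U mv]|[U mv]] := two_ears triT pt (ch_xy ch) e1 e2.
  have [kp cU fl] := ch_moved ch pt3 mv abX baX; exists U, p4; split=> //; split=> //.
  - exact: mv_m3 mv.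
  - exact: mv_m0 mv.
  - exact: mv_m1 mv.
  - exact: mv_m2 mv.
  - by apply: (mv_inner4 mv); rewrite !inE eqxx ?orbT.
  - by exists p3; apply: (mv_inner3 mv); rewrite !inE eqxx.
have [kp cU fl] := ch_moved ch pt4 mv abX baX; exists U, p3; split=> //; split=> //.
- exact: mv_m2 mv.
- exact: mv_m3 mv.
- exact: mv_m0 mv.
- exact: mv_m1 mv.
- by apply: (mv_inner4 mv); rewrite !inE eqxx ?orbT.
- by exists x; apply: (mv_inner3 mv); rewrite !inE eqxx ?orbT.
Qed.

(* The inner triangle is the first face at v after the finished part (state A) or the second
   one (state B). *)
Definition stateA T := inner3 T (x, v) /\ Defs.rot T v x != y.
Definition stateB T := inner3 T (Defs.rot T v x, v).

Lemma degree_lt T U q : adj T v q -> (forall u, adj U v u -> adj T v u /\ u != q) ->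
  degree U v < degree T v.
Proof.
move=> vq H; apply: proper_card; apply/properP; split.
  by apply/subsetP => u; rewrite !inE => /H[].
by exists q; rewrite !inE //; apply/negP => /H[_]; rewrite eqxx.
Qed.

(** Let [x v q] be the triangle and [q v d c] the quadrangle across [vq]. If [d = y], [finish]
    applies. The ear at [v] with chord [dx] is best, as it removes an edge at [v]. If [dx] is
    already an edge, [vq] is exchanged for [vc]; and if [c = x], then [q] is adjacent to [x] and [v]
    only, and [qx] is exchanged for [qd]. *)
Lemma stepA T : chain T X x y v1 s -> stateA T ->
  [\/ exists U w, [/\ flips 1 T U, keeps T U X & closed_off U w],
      exists U, [/\ flips 1 T U, keeps T U X, chain U X x y v1 s, stateA U & degree U v < degree T v] |
      exists U, [/\ flips 1 T U, keeps T U X, chain U X x y v1 s, stateB U & degree U v <= degree T v]].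
Proof.
move=> ch [xv3 qy]; have triT := ch_tri ch; have plT := tri_plane triT.
have [q [nq0 nq1 nq2]] := tri_third triT xv3.
rewrite (nxtE nq0) in qy; have vq3 : inner3 T (v, q).
  by apply: (inner3_sface triT xv3); rewrite -nq0 sface_nxt.
have qx3 : inner3 T (q, x) by apply: (inner3_sface triT vq3); rewrite -nq1 sface_nxt.
have [vqD vqi _] := and3P vq3; have [qxD _ _] := and3P qx3; have [xvD _ _] := and3P xv3.
have vq : adj T v q by rewrite -in_darts. have qx : adj T q x by rewrite -in_darts.
have qvD : (q, v) \in darts T by rewrite -(rev_darts plT).
have qvX : (q, v) \notin X := ch_notX ch qy.
have xvX : (x, v) \notin X := ch_notX ch (ch_xy ch).
have sX d d' : d \in darts T -> sface T d d' -> (d' \in X) = (d \in X).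
  exact: (closed_part_sface triT (ch_closed ch)).
have vqX : (v, q) \notin X by rewrite -nq0 (sX (x, v)) ?sface_nxt.
have [t [d [c cf]]] := conf_exists triT vq3 (ch_outX ch qvD qvX).
have tx : t = x by have := cf_t0 cf; rewrite nq1 => -[].
subst t; have [r pt rP] := conf_pentagon triT cf.
have pt1 := pentagon_rot pt; have pt2 := pentagon_rot pt1; have pt3 := pentagon_rot pt2.
have rv := ch_r ch pt vqX qvX.
have xv := ch_vx ch; have xvn := adj_neq plT xv.
have nvd : adj T v d := conf_ac triT cf. have ndc := conf_cd triT cf. have ncq := conf_db triT cf.
have dx : d != x.
  apply: contraNneq qy => dx; apply/eqP; apply: (ch_rot_y ch vq).
  by rewrite (nxtE (cf_q0 cf)).
have vnq := adj_neq plT vq; have vnd := adj_neq plT nvd.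
case adx: (adj T d x); last first.
  have [U mv] : exists U, moved T v q v d c q x U.
    apply: (moved_exists triT pt1 dx (negbT adx)).
    by move: rP; rewrite !inE (negbTE rv); do ![case: (r == _); rewrite ?orbT //=].
  have [kp cU fl] := ch_moved ch pt1 mv vqX qvX.
  constructor 2; exists U; split=> //.
    split; first by apply: (mv_inner3 mv); rewrite !inE eqxx ?orbT.
    rewrite (nxtE (mv_n2 mv)); apply: contraFneq adx => ->.
    by rewrite (adjC plT) (ch_xyD ch).
  apply: (degree_lt vq) => u; rewrite (mv_adj mv) /is_edge eqxx (negbTE vnd) (negbTE xvn) /= orbF.
  by rewrite negb_or => /andP[-> /andP[-> _]].
have [dy|dy] := eqVneq d y.
  rewrite dy in pt; constructor 1; apply: (finish ch pt vqX qvX).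
    by rewrite /is_edge -dy (eq_sym d v) (negbTE vnd) (eq_sym q v) (negbTE vnq) andbF.
  rewrite /is_edge (eq_sym x q) (negbTE (adj_neq plT qx)) (eq_sym x v) (negbTE xvn).
  by rewrite !andbF.
have dq : d != q := conf_cb triT cf. have cv : c != v := conf_da triT cf.
have [cx|cx] := eqVneq c x; last first.
  have exd : ~~ is_edge v q x d.
    by rewrite /is_edge (eq_sym x v) (negbTE xvn) (eq_sym x q) (negbTE (adj_neq plT qx)).
  have axd : adj T x d by rewrite (adjC plT).
  (* The 3-cycle [x v d] prevents an edge [vc] and keeps [d] from being the reflex vertex, so the
     ear at [d] can be cut off. *)
  have [rN nb] := chord triT pt3 axd exd.
  have nvc : ~~ adj T c v.
    rewrite (adjC plT); apply/negP => /(nb c); rewrite !inE eqxx !negb_or cx cv.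
    rewrite (eq_sym c d) (adj_neq plT ndc) /= => /(_ isT isT).
    by rewrite /is_edge eqxx (negbTE (adj_neq plT ncq)) (negbTE vnq).
  have [U mv] : exists U, moved T v q d c q x v U.
    apply: (moved_exists triT pt2 cv nvc).
    by move: rP rN; rewrite !inE; do ![case: (r == _); rewrite ?orbT //=].
  have [kp cU fl] := ch_moved ch pt2 mv vqX qvX.
  constructor 3; exists U; split=> //.
    by rewrite /stateB (nxtE (mv_m0 mv)); apply: (mv_inner3 mv); rewrite !inE eqxx ?orbT.
  have sub : [set w | adj U v w] \subset c |: ([set w | adj T v w] :\ q).
    apply/subsetP => u; rewrite !inE (mv_adj mv) /is_edge eqxx (eq_sym v c) (negbTE cv) (negbTE vnq) /=.
    by case: (u == c) => //=; case: (u == q); rewrite ?andbF ?andbT ?orbF.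
  apply: leq_trans (subset_leq_card sub) _; rewrite cardsU1 /degree (cardsD1 q [set w | adj T v w]).
  by rewrite inE vq leq_add2r leq_b1.
subst c; have xqD : (x, q) \in darts T by rewrite in_darts (adjC plT).
have sxq : sface T (q, v) (x, q).
  by rewrite (conf_quad cf) !inE eqxx ?orbT.
have xqX : (x, q) \notin X by rewrite (sX (q, v)).
have qxX : (q, x) \notin X by rewrite -nq1 (sX (v, q)) ?sface_nxt.
have cf' : conf T q x v v d.
  by have [_ _ _ _ _ q0 q1 q2 q3] := cf; split=> //; exact: (ch_outX ch).
have [r' pt' r'P] := conf_pentagon triT cf'; have pt2' := pentagon_rot (pentagon_rot pt').
have leaf w : adj T q w -> w = x \/ w = v.
  move: w; apply: (rot_ind triT qx); first by left.
  move=> w _ [->|->]; first by rewrite (nxtE (cf_q3 cf)); right.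
  by left; rewrite (nxtE nq1).
have ndq : ~~ adj T d q.
  rewrite (adjC plT); apply/negP => /leaf[e|e]; first by rewrite e eqxx in dx.
  by rewrite e eqxx in vnd.
have [U mv] : exists U, moved T q x v d x v q U.
  apply: (moved_exists triT pt2' dq ndq).
  by move: r'P; rewrite !inE; do ![case: (r' == _); rewrite ?orbT //=].
have [kp cU fl] := ch_moved ch pt2' mv qxX xqX.
constructor 3; exists U; split=> //.
  by rewrite /stateB (nxtE (mv_m3 mv)); apply: (mv_inner3 mv); rewrite !inE eqxx ?orbT.
apply: subset_leq_card; apply/subsetP => u; rewrite !inE (mv_adj mv) /is_edge.
by rewrite (negbTE vnd) (negbTE vnq) /= orbF => /andP[].
Qed.

(** Let [v q c] be the triangle. If [q = y], [finish] applies. If [qx] is not an edge, exchanging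
    [vc] for it leads to state A. Otherwise the 3-cycle [x v q] separates [c] from [d], the
    neighbour of [v] after [q], and [vq] is exchanged for [cd]. *)
Lemma stepB T : chain T X x y v1 s -> stateB T ->
  [\/ exists U w, [/\ flips 1 T U, keeps T U X & closed_off U w],
      exists U, [/\ flips 1 T U, keeps T U X, chain U X x y v1 s, stateA U & degree U v < degree T v] |
      exists U, [/\ flips 1 T U, keeps T U X, chain U X x y v1 s, stateB U & degree U v < degree T v]].
Proof.
move=> ch; rewrite /stateB; set c := Defs.rot T v x => cv3.
have triT := ch_tri ch; have plT := tri_plane triT.
have sX d d' : d \in darts T -> sface T d d' -> (d' \in X) = (d \in X).
  exact: (closed_part_sface triT (ch_closed ch)).
have vx := ch_vx ch; have vnx := adj_neq plT vx.
have xvD : (x, v) \in darts T by rewrite in_darts (adjC plT).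
have xvX : (x, v) \notin X := ch_notX ch (ch_xy ch).
have nxv : nxt T (x, v) = (v, c) by [].
have vc : adj T v c by apply: adj_rot.
have vcD : (v, c) \in darts T by rewrite in_darts.
have vcX : (v, c) \notin X by rewrite -nxv (sX (x, v)) ?sface_nxt.
have cvD : (c, v) \in darts T by rewrite in_darts (adjC plT).
have cx : c != x.
  by apply/eqP => e; have := ch_xy ch; rewrite (ch_rot_y ch vx e) eqxx.
have vnc := adj_neq plT vc.
have [q [nq0 nq1 nq2]] := tri_third triT cv3.
have vq : adj T v q by rewrite -in_darts -nq0 nxt_darts.
have vnq := adj_neq plT vq.
have qc : adj T q c by rewrite -in_darts -nq1 nxt_darts // in_darts.
have cvX := ch_inner3 ch cv3.
have cy : c != y by apply: contraNneq cvX => ->; exact: ch_yvX ch.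
have vqX : (v, q) \notin X by rewrite -nq0 (sX (c, v)) ?sface_nxt.
have rvq : q != x.
  by apply: contraNneq cy => e; apply/eqP/(ch_rot_y ch vc); rewrite (nxtE nq0).
have [t [b1 [x' cf]]] := conf_exists triT cv3 (ch_outX ch vcD vcX).
have tq : t = q by have := cf_t0 cf; rewrite nq0 => -[].
have xx : x' = x.
  have ax : adj T v x' by rewrite (adjC plT); exact: (conf_db triT cf).
  by apply: (adj_rot_inj plT ax vx); rewrite (nxtE (cf_q3 cf)).
subst t x'; have [r pt rP] := conf_pentagon triT cf.
have pt1 := pentagon_rot pt; have pt2 := pentagon_rot pt1; have pt3 := pentagon_rot pt2.
have pt4 := pentagon_rot pt3; have rv := ch_r ch pt cvX vcX.
have [qy|qy] := eqVneq q y.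
  subst q; constructor 1; apply: (finish ch pt3 cvX vcX).
    by rewrite /is_edge (eq_sym y c) (negbTE cy) (eq_sym y v) (negbTE vnq).
  by rewrite /is_edge (eq_sym x v) (negbTE vnx) (eq_sym x c) (negbTE cx) !andbF.
case aqx: (adj T q x); last first.
  have [U mv] : exists U, moved T c v v q c b1 x U.
    apply: (moved_exists triT pt4 rvq (negbT aqx)).
    by move: rP; rewrite !inE (negbTE rv); do ![case: (r == _); rewrite ?orbT //=].
  have [kp cU fl] := ch_moved ch pt4 mv cvX vcX.
  constructor 2; exists U; split=> //.
    split; first by apply: (mv_inner3 mv); rewrite !inE eqxx ?orbT.
    by rewrite (nxtE (mv_n2 mv)).
  apply: (degree_lt vc) => u; rewrite (mv_adj mv) /is_edge eqxx (negbTE vnc) (negbTE vnq) (negbTE vnx) /= orbF.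
  by case/andP=> ->.
have qvX : (q, v) \notin X := ch_notX ch qy.
have qvD : (q, v) \in darts T by rewrite in_darts (adjC plT).
have vq3 : inner3 T (v, q) by apply: (inner3_sface triT cv3); rewrite -nq0 sface_nxt.
have [t [d [c2 cf2]]] := conf_exists triT vq3 (ch_outX ch qvD qvX).
have tc : t = c by have := cf_t0 cf2; rewrite nq1 => -[].
subst t; have [r2 pt' r2P] := conf_pentagon triT cf2; have pt1' := pentagon_rot pt'.
have r2v := ch_r ch pt' vqX qvX.
have vd : adj T v d := conf_ac triT cf2; have vnd := adj_neq plT vd.
have nqv : nxt T (q, v) = (v, d) := cf_q0 cf2.
have dx : d != x.
  by apply: contraNneq qy => e; apply/eqP/(ch_rot_y ch vq); rewrite (nxtE nqv).
have dq : d != q := conf_cb triT cf2.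
have dc : d != c.
  apply: contraNneq rvq => e; apply/eqP/(adj_rot_inj plT vq vx).
  by rewrite (nxtE nqv) e.
(* The angles at [v] from [x] to [q] and the one from [q] to [d] are on different sides of the
   cycle, and labels are constant around [c] and around [d]; an edge [cd] would make them equal. *)
have ndc : ~~ adj T d c.
  have vx' : adj T x v by rewrite (adjC plT).
  have [lam [ln lr _ lv _]] := cyc3_sides triT vx' vq aqx.
  set S := cyc3 x v q in lr.
  have lr' a b : adj T a b -> lam (b, a) = lam (a, b) (+) ((a, b) \in S).
    by move=> ab; rewrite -lr // in_darts.
  have nS a b : a \notin [:: x; v; q] -> ((a, b) \in S) = false.
    move=> h; apply: contraNF h; rewrite /S !inE !xpair_eqE.
    by do 5![case/orP => [/andP[/eqP-> _]|]; first by rewrite eqxx ?orbT]; case/andP=> /eqP->; rewrite eqxx.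
  have nS' a b : b \notin [:: x; v; q] -> ((a, b) \in S) = false.
    by move=> /(nS b a) <-; rewrite -[(b, a)]/(rev_dart (a, b)) cyc3_rev.
  have cS : c \notin [:: x; v; q].
    by rewrite !inE !negb_or cx (eq_sym c v) vnc (eq_sym c q) (adj_neq plT qc).
  have dS : d \notin [:: x; v; q] by rewrite !inE !negb_or dx (eq_sym d v) vnd dq.
  have lc : lam (c, v) = lam (x, v).
    by rewrite lr' // nS' // addbF -nxv ln.
  have lq : lam (q, v) = ~~ lam (x, v).
    rewrite lr' // -nq0 ln // lc nq0 (_ : (v, q) \in S) ?addbT //.
    by rewrite /S !inE eqxx ?orbT.
  have ld : lam (d, v) = ~~ lam (x, v).
    by rewrite lr' // nS' // addbF -nqv ln.
  apply/negP => adc; have acd : adj T c d by rewrite (adjC plT).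
  have cv' : adj T c v by rewrite (adjC plT). have dv' : adj T d v by rewrite (adjC plT).
  have := lr' d c adc; rewrite (nS d c dS) addbF.
  rewrite (lv d v c dS) // (lv c v d cS) //.
  by rewrite (lr' d v dv') (nS d v dS) addbF ld (lr' c v cv') (nS c v cS) addbF lc; case: (lam _).
have [U mv] : exists U, moved T v q v d c2 q c U.
  apply: (moved_exists triT pt1' dc ndc).
  by move: r2P; rewrite !inE (negbTE r2v); do ![case: (r2 == _); rewrite ?orbT //=].
have [kp cU fl] := ch_moved ch pt1' mv vqX qvX.
have nUx : nxt U (x, v) = (v, c).
  rewrite (mv_out mv xvD) // -(pent_mem pt1') (conf_tri cf2) (conf_quad cf2) !inE !xpair_eqE.
  rewrite (eq_sym x v) (negbTE vnx) (eq_sym x q) (negbTE rvq) (eq_sym x c) (negbTE cx).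
  by rewrite (eq_sym x d) (negbTE dx) (negbTE vnq) !andbF.
constructor 3; exists U; split=> //.
  by rewrite /stateB (nxtE nUx); apply: (mv_inner3 mv); rewrite !inE eqxx ?orbT.
apply: (degree_lt vq) => u; rewrite (mv_adj mv) /is_edge eqxx (negbTE vnd) (negbTE vnc) (negbTE vnq) /= orbF.
by rewrite orbF => /andP[].
Qed.

(* every flip decreases 2 deg v + [state A] *)
Lemma sweep m T : chain T X x y v1 s ->
  (stateA T /\ (degree T v).*2.+1 <= m) \/ (stateB T /\ (degree T v).*2 <= m) ->
  exists k U w, [/\ k <= m.+1, flips k T U, keeps T U X & closed_off U w].
Proof.
elim: m T => [|m IH] T ch.
  (* The degree cannot decrease any further, so this flip ends the round. *)
  case=> [[]//|[B d0]]; have [[U [w [f k c]]]|[U [_ _ _ _ dl]]|[U [_ _ _ _ dl]]] := stepB ch B.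
  - by exists 1, U, w.
  - by move: dl d0; case: (degree T v).
  - by move: dl d0; case: (degree T v).
have next k U : flips 1 T U -> keeps T U X -> k <= m.+1 ->
    (exists W w, [/\ flips k U W, keeps U W X & closed_off W w]) ->
    exists k U w, [/\ k <= m.+2, flips k T U, keeps T U X & closed_off U w].
  move=> f kp km [W [w [f' kp' c]]]; exists k.+1, W, w; split=> //.
    by rewrite -add1n; apply: flips_cat f f'.
  exact: keeps_trans kp kp'.
case=> [[A dm]|[B dm]].
  have [[U [w [f k c]]]|[U [f kp cU AU dl]]|[U [f kp cU BU dl]]] := stepA ch A.
  - by exists 1, U, w.
  - have [|k [W [w [km f' kp' c]]]] := IH U cU.
      by left; split=> //; move: dl dm; lia.
    by apply: (next k U) => //; exists W, w.
  - have [|k [W [w [km f' kp' c]]]] := IH U cU.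
      by right; split=> //; move: dl dm; lia.
    by apply: (next k U) => //; exists W, w.
have [[U [w [f k c]]]|[U [f kp cU AU dl]]|[U [f kp cU BU dl]]] := stepB ch B.
- by exists 1, U, w.
- have [|k [W [w [km f' kp' c]]]] := IH U cU.
    by left; split=> //; move: dl dm; lia.
  by apply: (next k U) => //; exists W, w.
- have [|k [W [w [km f' kp' c]]]] := IH U cU.
    by right; split=> //; move: dl dm; lia.
  by apply: (next k U) => //; exists W, w.
Qed.
End Sweep.

(** * Paths that avoid the finished part *)

Section Free.
Variables (n : nat) (T : emb n) (X : {set 'I_n * 'I_n}).
Hypothesis triT : tri4PPT T.
Hypothesis cpX : closed_part T X.
Let plT := tri_plane triT.

Definition free_step : rel ('I_n * 'I_n) :=
  fun d d' => [&& d \in darts T, d \notin X, d' \notin X & dual_step T d d'].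

(** A step along a face is undone by going on around the face, which avoids [X] as soon as one of
    its darts does. *)
Lemma free_sym : connect_sym free_step.
Proof.
suff H a b : connect free_step a b -> connect free_step b a.
  by move=> a b; apply/idP/idP; apply: H.
case/connectP => p; elim: p a => [|c p IH] a /=; first by move=> _ ->; apply: connect0.
case/andP=> /and4P[aD aX cX ac] pp l; apply: connect_trans (IH c pp l) _.
have cD : c \in darts T by case/orP: ac => /eqP ->; rewrite ?nxt_darts ?rev_darts.
case/orP: ac => /eqP E; last first.
  by apply: connect1; rewrite /free_step cD cX aX E /dual_step rev_dartK eqxx orbT.
have : sface T c a by rewrite (sface_sym plT) // E sface_nxt.
move/iter_findex <-; elim: (findex _ _ _) => [|k IHk]; first exact: connect0.
apply: connect_trans IHk _; apply: connect1; rewrite iterS /free_step.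
have s : sface T c (iter k (nxt T) c) by apply: fconnect_iter.
have kD := sface_darts plT cD s.
have kX : iter k (nxt T) c \notin X by rewrite (closed_part_sface triT cpX cD s).
rewrite kD kX /dual_step eqxx /= andbT (closed_part_sface triT cpX cD (d' := _)) //.
by apply: sface_trans s (sface_nxt _ _).
Qed.

(** Among the darts into [v] only the one from [z] may be in [X], so turning around [v] meets free
    darts until [z] comes up again. *)
Lemma free_around v z u : adj T v z -> (forall w, (w, v) \in X -> w = z) ->
  Defs.rot T v z != z -> adj T v u -> u != z -> connect free_step (Defs.rot T v z, v) (u, v).
Proof.
move=> vz zX rz vu uz; move: u vu uz; apply: (rot_ind triT (adj_rot plT vz)); first by rewrite connect0.
move=> w vw IH wz; have [e|nwz] := eqVneq w z; first by rewrite e connect0.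
have nX w' : w' != z -> (w', v) \notin X by apply: contra => /zX ->.
have D w' : adj T v w' -> (w', v) \in darts T by rewrite in_darts (adjC plT).
have vw' := adj_rot plT vw; have E : nxt T (w, v) = (v, Defs.rot T v w) by [].
have vX : (v, Defs.rot T v w) \notin X.
  by rewrite -E (closed_part_sface triT cpX (D _ vw) (sface_nxt _ _)) nX.
apply: connect_trans (IH nwz) _; apply: (@connect_trans _ _ (v, Defs.rot T v w)).
  by apply: connect1; rewrite /free_step D // nX // vX /dual_step -E eqxx.
by apply: connect1; rewrite /free_step in_darts vw' vX nX //= /dual_step eqxx orbT.
Qed.

Lemma free_around_end v z : adj T v z -> (forall w, (w, v) \in X -> w = z) ->
  Defs.rot T v z != z -> (v, z) \notin X -> connect free_step (Defs.rot T v z, v) (v, z).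
Proof.
move=> vz zX rz vzX; have [u vu E] : exists2 u, adj T v u & Defs.rot T v u = z.
  have := rot_trans plT (adj_rot plT vz) vz => /iter_findex.
  case: (findex _ _ _) => [|k] /=; first by move=> e; rewrite e eqxx in rz.
  by move=> <-; eexists; last reflexivity; apply/rot_iter_adj/adj_rot.
have uz : u != z by apply: contraNneq rz => e; rewrite -{2}E e.
apply: connect_trans (free_around vz zX rz vu uz) _; apply: connect1.
rewrite /free_step in_darts (adjC plT) vu vzX /dual_step /nxt /= E eqxx ?andbT.
by apply: contra uz => /zX ->.
Qed.

(** A simple path visits each of the 4n - 6 darts at most once. *)
Lemma bring_connect d0 g : inner3 T d0 -> d0 \notin X -> connect free_step d0 g -> rev_dart g \in X ->
  exists k U, [/\ k <= 4 * n, flips k T U, tri4PPT U, keeps T U X & inner3 U g].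
Proof.
move=> d03 d0X /connectP[p0 pp0 lg] gX.
have [p [pp up lp]] : exists p, [/\ path free_step d0 p, uniq (d0 :: p) & g = last d0 p].
  by case/shortenP: pp0 lg => p pp up _ lg; exists p.
have [d0D _ _] := and3P d03.
have all_p (P : pred ('I_n * 'I_n)) : P d0 -> (forall a b, free_step a b -> P b) -> all P (d0 :: p).
  move=> P0 Ps; rewrite /= P0; elim: (p) (d0) pp => //= b q IH a /andP[ab bq].
  by rewrite (Ps _ _ ab) (IH b).
have pX : all (fun d => d \notin X) (d0 :: p) by apply: all_p => // a b /and4P[].
have pD : all (fun d => d \in darts T) (d0 :: p).
  apply: all_p => // a b /and4P[aD _ _ /orP[]/eqP ->]; by rewrite ?nxt_darts ?rev_darts.
have sz : size p <= 4 * n.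
  have [_ <-] := card_faces_darts triT; apply: leq_trans (leq_addr _ _).
  have /card_uniqP c := up; apply: (@leq_trans (size (d0 :: p))) => //; rewrite -c.
  by apply/subset_leq_card/subsetP => d; move/allP: pD; apply.
have pp' : path (dual_step T) d0 p by apply: sub_path pp => a b /and4P[].
have gX' : rev_dart (last d0 p) \in X by rewrite -lp.
have [k [U [h1 h2 h3 h4 h5]]] := bring triT cpX d03 pp' pX gX' sz.
by exists k, U; rewrite lp.
Qed.
End Free.

Lemma chain_extend n (X : {set 'I_n * 'I_n}) x y v1 s (U : emb n) w :
  closed_off X x y v1 s U w ->
  let v := last v1 s in
  chain U (X :|: [set d in [:: (x, v); (v, y); (y, w); (w, x)]]) x y v1 (rcons s w).
Proof.
case=> ch n1 n2 n3 n4 inn [u u3] v; rewrite -/v in n1 n2 n4 inn.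
set Q := [:: _; _; _; _]; set X' := _ :|: _.
have triU := ch_tri ch; have plU := tri_plane triU; have [Xd Xn Xo] := ch_closed ch.
have inX' d : (d \in X') = (d \in X) || (d \in Q) by rewrite in_setU in_set.
have vs : v \in v1 :: s := mem_last _ _.
have xvX : (x, v) \notin X := ch_notX ch (ch_xy ch).
have vx := ch_vx ch; have vy := ch_vy ch.
have cy : fcycle (nxt U) Q by rewrite /= n1 n2 n3 n4 !eqxx.
have xvD : (x, v) \in darts U by rewrite in_darts (adjC plU).
have QD d : d \in Q -> d \in darts U.
  by move=> dQ; apply: (sface_darts plU xvD); rewrite /sface (fconnect_cycle cy (mem_head _ _)).
have yw : adj U y w by rewrite -in_darts QD // !inE eqxx ?orbT.
have wx : adj U w x by rewrite -in_darts QD // !inE eqxx ?orbT.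
have wy : w != y by rewrite eq_sym (adj_neq plU).
have wnx : w != x by rewrite (adj_neq plU).
have side a : a \in v1 :: s -> [/\ (y, a) \in X, nxt U (y, a) = (a, x) & reflex U a y] := @ch_side _ _ _ _ _ _ _ ch a.
have ws : w \notin v1 :: s.
  apply: contra xvX => /side[ywX _ _]; rewrite -n4; apply/Xn; rewrite -n3; exact: Xn.
have wv : w != v by apply: contraNneq ws => ->.
(* The new quadrangle has one reflex angle. That of [v] is spent in [X], those of [x] and [y] on the
   outer face, so it is at [w]. *)
have rw : reflex U w y.
  have c4 : #|face U (x, v) :&: rdarts U| = 1.
    have := card_face_reflex triU xvD inn.
    have -> : #|face U (x, v)| = 4; last by rewrite -[4]/(1 + 3) => /addIn.
    rewrite card_face /fsize (order_cycle cy) ?mem_head //= !inE !xpair_eqE.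
    rewrite (eq_sym x v) (negbTE (adj_neq plU vx)) (negbTE (ch_xy ch)) (negbTE (adj_neq plU vy)).
    by rewrite (eq_sym x w) (negbTE wnx) (eq_sym v w) (negbTE wv) (eq_sym y w) (negbTE wy).
  have /eqP/cards1P[z Z] := c4.
  have : z \in face U (x, v) :&: rdarts U by rewrite Z in_set1.
  rewrite in_setI mem_face /sface (fconnect_cycle cy (mem_head _ _)) in_set => /andP[zQ /andP[_ zr]].
  have [yvX nyv rvy] := side v vs.
  have oxy : adj U y x by rewrite (adjC plU); exact: ch_xyD ch.
  move: zQ zr; rewrite !inE => /or4P[]/eqP-> //= r.
  - have := reflex_uniq triU _ r (ch_vy ch) rvy; rewrite (ch_vx ch) => /(_ isT) e.
    by have := ch_xy ch; rewrite e eqxx.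
  - have ryx : reflex U y x.
      by apply: (outer_reflex triU (d := (x, y))); rewrite (ch_outer ch) sface_refl.
    have := reflex_uniq triU _ r oxy ryx; rewrite (adjC plU) => /(_ vy) e.
    by have := adj_neq plU vx; rewrite -/v e eqxx.
  - have [yv1X nyv1 _] := side v1 (mem_head _ _).
    have rxv : reflex U x v1.
      apply: (outer_reflex triU (d := (v1, x))); rewrite (ch_outer ch) -nyv1 -(ch_first ch).
      exact: sface_trans (sface_nxt _ _) (sface_nxt _ _).
    have xv1 : adj U x v1 by rewrite (adjC plU) -in_darts -nyv1 nxt_darts // Xd.
    have := reflex_uniq triU _ r xv1 rxv; rewrite (adjC plU) => /(_ wx) e.
    by move: ws; rewrite e mem_head.
split=> //.
- split=> [d|d|]; rewrite ?inX'.
  + by case/orP => [/Xd//|/QD].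
  + case/orP => [/Xn->//|]; rewrite !inE => /or4P[]/eqP->; rewrite ?n1 ?n2 ?n3 ?n4;
    by rewrite eqxx ?orbT.
  + by rewrite Xo.
- exact: ch_outer ch.
- have := ch_uniq ch; rewrite -!rcons_cons rcons_uniq => ->; rewrite andbT.
  by rewrite in_cons negb_or wnx in_cons negb_or wy.
- exact: ch_first ch.
- exact: ch_last ch.
- rewrite rcons_path; apply/andP; split.
    apply: sub_path (ch_path ch) => a b; rewrite /link inX' => /and4P[-> -> -> ->] //.
  by rewrite /link -/v n1 n2 n4 !eqxx inX' mem_head orbT.
- move=> a; rewrite -rcons_cons mem_rcons in_cons => /orP[/eqP->|/side[yaX ? ?]].
    by split; rewrite // inX' !inE eqxx ?orbT.
  by split; rewrite // inX' yaX.
- move=> d; rewrite inX' -!rcons_cons mem_rcons in_cons => /orP[/(ch_head ch)->|]; first by rewrite orbT.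
  rewrite !inE => /or4P[]/eqP->; rewrite ?eqxx ?orbT //=.
  by move: vs; rewrite in_cons => /orP[->|->]; rewrite ?orbT.
- move=> a; rewrite last_rcons inX' => /orP[/(ch_head ch)|].
    by rewrite !in_cons (negbTE wnx) (negbTE wy) /= => h; rewrite in_cons h in ws.
  rewrite !inE !xpair_eqE (negbTE wv) (negbTE wy) (negbTE wnx) !andbF ?orbF /= => /andP[/eqP//].
Qed.

Record terminal n (T : emb n) (X : {set 'I_n * 'I_n}) x y v1 s : Prop := Terminal {
  tm_chain : chain T X x y v1 s;
  tm_n1 : nxt T (x, last v1 s) = (last v1 s, y);
  tm_n2 : nxt T (last v1 s, y) = (y, x);
  tm_n3 : nxt T (y, x) = (x, last v1 s) }.

(** At most 4n flips bring the triangle to [xv], and the sweep takes at most 2 deg(v) + 2 more. *)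
Lemma level n (T : emb n) X x y v1 s u : chain T X x y v1 s -> inner3 T (u, last v1 s) ->
  exists k U, [/\ k <= 6 * n + 2, flips k T U &
    terminal U X x y v1 s \/
    exists X' w u', chain U X' x y v1 (rcons s w) /\ inner3 U (u', w)].
Proof.
move=> ch u3; set v := last v1 s in u3 *; have triT := ch_tri ch; have plT := tri_plane triT.
have uX := ch_inner3 ch u3; have vx := ch_vx ch; have vy := ch_vy ch; rewrite -/v in vx vy.
have rvy : Defs.rot T v y = x := ch_rot ch.
have vu : adj T v u by rewrite (adjC plT) -in_darts; case/and3P: u3.
have uy : u != y by apply: contraNneq uX => ->; exact: ch_yvX ch.
have con : connect (free_step T X) (u, v) (x, v).
  rewrite (free_sym triT (ch_closed ch)) -rvy.
  apply: (free_around triT (ch_closed ch) vy (ch_v ch)) => //.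
  by rewrite rvy (ch_xy ch).
have [k1 [U1 [k1n f1 t1 kp1 i1]]] := bring_connect triT (ch_closed ch) u3 uX con (ch_vxX ch).
have ch1 := chain_keeps ch kp1 t1; have pl1 := tri_plane t1.
(* In the first case the triangle is [x v y], and no round is left. *)
have [e|ne] := eqVneq (Defs.rot U1 v x) y.
  exists k1, U1; split; [by apply: leq_trans k1n _; lia | exact: f1 | left].
  have [t [n0 n1 n2]] := tri_third t1 i1.
  have ty : t = y by rewrite -e; exact/esym/(nxtE n0).
  by rewrite ty in n0 n1 n2; split.
have [|k2 [U2 [w [k2n f2 kp2 co]]]] := @sweep n X x y v1 s (degree U1 v).*2.+1 U1 ch1.
  by left; split=> //; split.
have dn : degree U1 v <= n by rewrite /degree -[X in _ <= X]card_ord max_card.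
exists (k1 + k2), U2; split.
- by move: dn k1n k2n; rewrite -/v; move: (degree _ _) => d; lia.
- exact: flips_cat f1 f2.
right; have [u' u'3] := co_tri co; do 3!eexists; split; last exact: u'3.
exact: chain_extend co.
Qed.

(** A chain lists [size s + 3] distinct vertices, so [m] bounds the number of rounds left. *)
Lemma reach_terminal n m (T : emb n) X x y v1 s u :
  chain T X x y v1 s -> inner3 T (u, last v1 s) -> n <= size s + m ->
  exists k U X' s', [/\ k <= m * (6 * n + 2) , flips k T U & terminal U X' x y v1 s'].
Proof.
elim: m T X s u => [|m IH] T X s u ch u3 sz.
  have /card_uniqP c := ch_uniq ch; have := max_card [in [:: x, y, v1 & s]].
  by rewrite c card_ord /=; move: sz; lia.
have [k1 [U1 [k1n f1 [tm|[X' [w [u' [ch' u'3]]]]]]]] := level ch u3.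
  exists k1, U1, X, s; split=> //; apply: leq_trans k1n _; rewrite mulSn; exact: leq_addr.
have [||k2 [U [X2 [s2 [k2n f2 tm]]]]] := IH U1 X' (rcons s w) u' ch'.
- by rewrite last_rcons.
- by rewrite size_rcons addSnnS.
exists (k1 + k2), U, X2, s2; split=> //; first by rewrite mulSn leq_add.
exact: flips_cat f1 f2.
Qed.

(** The first finished part is the outer face alone; the triangle is brought to the inner side of
    the outer edge [zx]. *)
Lemma initial n (T : emb n) : tri4PPT T ->
  exists k U X x y z u, [/\ k <= 4 * n, flips k T U, chain U X x y z [::] & inner3 U (u, z)].
Proof.
move=> triT; have plT := tri_plane triT; have oD := odartP plT.
have o3 := fsize_outer triT.
case E: (odart T) => [x y]; rewrite E in oD o3.
have xy : adj T x y by rewrite -in_darts.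
pose z := Defs.rot T y x; have n1 : nxt T (x, y) = (y, z) by [].
have := iter_nxt_fsize triT oD; rewrite o3 [iter _ _ _]/= n1.
rewrite -[nxt T (y, z)]/(z, Defs.rot T z y); set x' := Defs.rot T z y => n3.
have xx : x' = x by case: n3.
have n2 : nxt T (y, z) = (z, x) by rewrite -xx.
rewrite xx in n3.
have yz : adj T y z by rewrite -in_darts -n1 nxt_darts.
have zx : adj T z x by rewrite -in_darts -n2 nxt_darts // in_darts.
have nxy := adj_neq plT xy; have nyz := adj_neq plT yz; have nzx := adj_neq plT zx.
pose X := [set d in [:: (x, y); (y, z); (z, x)]].
have inX d : (d \in X) = (d \in [:: (x, y); (y, z); (z, x)]) by rewrite in_set.
have XD d : d \in X -> d \in darts T.
  by rewrite inX !inE => /or3P[]/eqP->.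
have outX d : d \in X -> sface T (odart T) d.
  have cy : fcycle (nxt T) [:: (x, y); (y, z); (z, x)] by rewrite /= n1 n2 n3 !eqxx.
  by rewrite inX E /sface (fconnect_cycle cy (mem_head _ _)).
have refl a b : (b, a) \in X -> reflex T a b by move/outX/(outer_reflex triT).
have ch : chain T X x y z [::].
  split=> //.
  - split=> //; last by rewrite inX E mem_head.
    by move=> d; rewrite !inX !inE => /or3P[]/eqP->; rewrite ?n1 ?n2 ?n3 eqxx ?orbT.
  - by rewrite /= !inE negb_or nxy (eq_sym x) nzx nyz.
  - move=> u; rewrite inE => /eqP->; have yzX : (y, z) \in X by rewrite inX !inE eqxx ?orbT.
    by split=> //; apply: refl.
  - by move=> d; rewrite inX !inE => /or3P[]/eqP->; rewrite eqxx ?orbT.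
  - move=> u; rewrite inX !inE !xpair_eqE /= => /or3P[]/andP[/eqP-> e] //.
      by move: nyz; rewrite eq_sym e.
    by move: nzx; rewrite e.
have cp := ch_closed ch.
have [d0 d03] := inner3_exists triT; have [d0D d0i _] := and3P d03.
have d0X : d0 \notin X by apply: contra d0i; apply: outX.
have notX a b : (a, b) \in X -> (b, a) \notin X.
  rewrite !inX !inE !xpair_eqE => /or3P[]/andP[/eqP-> /eqP->];
  by rewrite ?(eq_sym y x) ?(eq_sym z y) ?(eq_sym x z) ?(negbTE nxy) ?(negbTE nyz) ?(negbTE nzx) ?andbF.
have rxz : Defs.rot T x z = y := nxtE n3.
have xyX : (x, y) \in X by rewrite inX !inE eqxx.
have yzX : (y, z) \in X by rewrite inX !inE eqxx ?orbT.
have zxX : (z, x) \in X by rewrite inX !inE eqxx ?orbT.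
have c1 : connect (free_step T X) (x, z) (z, y).
  have := @free_around_end n T X triT cp z y; rewrite (adjC plT) yz (nxtE n2) => -> //.
  - by move=> w; rewrite inX !inE !xpair_eqE => /or3P[]/andP[/eqP-> /eqP e] //; [move: nyz; rewrite e eqxx | move: nzx; rewrite e eqxx].
  - exact: notX.
have c2 : connect (free_step T X) (y, x) (x, z).
  have := @free_around_end n T X triT cp x z; rewrite (adjC plT) zx rxz => -> //.
  - by move=> w; rewrite inX !inE !xpair_eqE => /or3P[]/andP[/eqP-> /eqP e] //; [move: nxy; rewrite e eqxx | move: nzx; rewrite e eqxx].
  - exact: notX.
(* The interior is connected in the dual: turning around [z] and [x], by [c1] and [c2], links the
   reverses of the outer darts. So [X] and the darts reachable from [(x, z)] form a set closed under
   [nxt] and reversal. *)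
have con : connect (free_step T X) d0 (x, z).
  rewrite (free_sym triT cp); pose Y := [set d in darts T | connect (free_step T X) (x, z) d].
  have xzD : (x, z) \in darts T by rewrite in_darts (adjC plT).
  have YE d : (d \in Y) = (d \in darts T) && connect (free_step T X) (x, z) d by rewrite in_set.
  have nf d : connect (free_step T X) (x, z) d -> d \notin X.
    case/connectP => p pp ->; have : (x, z) \notin X by apply: notX.
    by elim: p (x, z) pp => //= a p IH c /andP[/and4P[_ _ aX _] /IH H] _; apply: H.
  have : X :|: Y = darts T.
    apply: (@darts_closed_full _ _ plT _ (x, y)).
    - by apply/subsetP => d; rewrite in_setU YE => /orP[/XD//|/andP[]].
    - move=> d; rewrite !in_setU => /orP[dX|]; first by case: cp => _ -> //.
      rewrite !YE => /andP[dD cd]; rewrite nxt_darts //= orbC; apply/orP; left.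
      apply: (connect_trans cd (connect1 _)); rewrite /free_step dD (nf _ cd) /dual_step eqxx andbT /=.
      by rewrite (closed_part_sface triT cp dD (sface_nxt _ _)) (nf _ cd).
    - move=> d; rewrite !in_setU => /orP[dX|].
        apply/orP; right; rewrite YE rev_darts // XD //=.
        move: dX; rewrite inX !inE => /or3P[]/eqP->; rewrite /rev_dart /=.
        + by rewrite (free_sym triT cp).
        + exact: c1.
        + exact: connect0.
      rewrite !YE => /andP[dD cd]; case rX: (rev_dart d \in X) => //=; rewrite rev_darts // dD /=.
      apply: (connect_trans cd (connect1 _)).
      by rewrite /free_step dD (nf _ cd) rX /dual_step eqxx orbT.
    - by rewrite in_setU xyX.
  by move/setP/(_ d0); rewrite in_setU (negbTE d0X) d0D YE d0D.
have [k [U [kn f tU kp i3]]] := bring_connect triT cp d03 d0X con zxX.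
exists k, U, X, x, y, z, x; split=> //; exact: chain_keeps ch kp tU.
Qed.

(** * The canonical 4-PPT *)

(** K_{2,n-2} with parts [x], [y] and [l], plus the edge [xy]. Rotation, tags and outer face are
    read off from [l]; [x] sees [l] in the order opposite to [y], so [cn_rotx] goes backwards. *)
Record canonical n (T : emb n) (x y : 'I_n) (l : seq 'I_n) : Prop := Canonical {
  cn_tri : tri4PPT T;
  cn_uniq : uniq [:: x, y & l];
  cn_all : forall u, u \in [:: x, y & l];
  cn_adjx : forall u, adj T x u = (u \in y :: l);
  cn_adjy : forall u, adj T y u = (u \in x :: l);
  cn_adjl : forall v u, v \in l -> adj T v u = (u == x) || (u == y);
  cn_rotx : forall u, u \in y :: l -> Defs.rot T x (next (y :: l) u) = u;
  cn_roty : forall u, u \in x :: l -> Defs.rot T y u = next (x :: l) u;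
  cn_rotl : forall v, v \in l -> Defs.rot T v x = y /\ Defs.rot T v y = x;
  cn_reflx : forall u, adj T x u -> reflex T x u = (u == head x l);
  cn_refly : forall u, adj T y u -> reflex T y u = (u == x);
  cn_refll : forall v u, v \in l -> adj T v u -> reflex T v u = (u == y);
  cn_outer : odart T = (x, y) }.

(** The links join up to closed cycles of the rotations at [x] and [y], which by transitivity
    exhaust their neighbours. *)
Lemma terminal_canonical n (T : emb n) X x y v1 s :
  terminal T X x y v1 s -> canonical T x y (v1 :: s).
Proof.
case=> ch; set v := last v1 s => m1 m2 m3; have triT := ch_tri ch; have plT := tri_plane triT.
have [Xd Xn _] := ch_closed ch.
have U := ch_uniq ch; have side a := @ch_side _ _ _ _ _ _ _ ch a.
have [xl yl] : x \notin v1 :: s /\ y \notin v1 :: s.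
  by move: U => /= /and3P[]; rewrite !in_cons !negb_or => /andP[_ /andP[-> ->]] /andP[-> ->].
have [v1y v1n v1r] := side v1 (mem_head _ _).
have xy : adj T x y := ch_xyD ch; have nxy := ch_xy ch.
have yx : adj T y x by rewrite (adjC plT).
have cyy : fcycle (Defs.rot T y) (x :: v1 :: s).
  rewrite /= rcons_path (nxtE (ch_first ch)) eqxx /= (nxtE m2) eqxx andbT.
  by apply: sub_path (ch_path ch) => a b /and4P[_ _ /eqP/nxtE e _] /=; rewrite e.
have cyx : path.cycle (fun a b : 'I_n => Defs.rot T x b == a) (y :: v1 :: s).
  rewrite /= rcons_path (nxtE (ch_last ch)) eqxx /= (nxtE m3) eqxx andbT.
  by apply: sub_path (ch_path ch) => a b /and4P[_ _ _ /eqP/nxtE e] /=; rewrite e.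
have ayl a : a \in v1 :: s -> adj T a y.
  by case/side => /Xd; rewrite in_darts (adjC plT).
have axl a : a \in v1 :: s -> adj T a x.
  by case/side => aX e _; rewrite -in_darts -e; apply/Xd/Xn.
have rotl a : a \in v1 :: s -> Defs.rot T a x = y /\ Defs.rot T a y = x.
  move=> al; have [_ /nxtE -> _] := side a al; split=> //.
  move: al; rewrite lastI mem_rcons in_cons -/v => /orP[/eqP->|]; first exact: nxtE m1.
  elim: (s) (v1) (ch_path ch) => //= b q IH c /andP[/and4P[_ /eqP e _ _] pq].
  rewrite in_cons => /orP[/eqP->|]; [exact: nxtE e | exact: IH pq].
have adjl a u : a \in v1 :: s -> adj T a u = (u == x) || (u == y).
  move=> al; have [r1 r2] := rotl a al; apply/idP/orP => [|[]/eqP->]; last 2 first.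
  - exact: axl.
  - exact: ayl.
  move: u; apply: (rot_ind triT (axl a al)); first by rewrite eqxx; left.
  by move=> u _ [/eqP->|/eqP->]; [right; rewrite r1 | left; rewrite r2].
have adjy u : adj T y u = (u \in x :: v1 :: s).
  rewrite in_cons; apply/idP/orP => [yu|[/eqP->//|/ayl]]; last by rewrite (adjC plT).
  have := rot_trans plT yx yu; rewrite (fconnect_cycle cyy (mem_head _ _)) in_cons.
  by case/orP; [left | right].
have adjx u : adj T x u = (u \in y :: v1 :: s).
  rewrite in_cons; apply/idP/orP => [xu|[/eqP->//|/axl]]; last by rewrite (adjC plT).
  have cyx' : fcycle (Defs.rot T x) (rev (y :: v1 :: s)) by rewrite rev_cycle.
  have := rot_trans plT xy xu; rewrite (fconnect_cycle cyx' _) ?mem_rev ?mem_head // in_cons.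
  by case/orP; [left | right].
(* Listed vertices have only listed neighbours, and the graph is connected. *)
have all u : u \in [:: x, y, v1 & s].
  have step a b : a \in [:: x, y, v1 & s] -> adj T a b -> b \in [:: x, y, v1 & s].
    rewrite in_cons => /orP[/eqP->|]; first by rewrite adjx [in X in _ -> X]in_cons orbC => ->.
    rewrite in_cons => /orP[/eqP->|/adjl ->].
      by rewrite adjy !in_cons => /orP[->|->]; rewrite ?orbT.
    by rewrite !in_cons => /orP[->|->]; rewrite ?orbT.
  have /connectP[p pp ->] := adj_connect plT x u.
  have : x \in [:: x, y, v1 & s] by rewrite mem_head.
  elim: p {1 2 4}x pp => //= w p IH a /andP[aw pp] /step/(_ aw); exact: IH.
have ox : sface T (odart T) (x, y) by rewrite (ch_outer ch) sface_refl.
have ov : sface T (odart T) (v1, x).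
  by apply: sface_trans ox _; apply: sface_trans (sface_nxt _ _) _; rewrite (ch_first ch) -v1n sface_nxt.
have reflE a b c : adj T a b -> reflex T a b -> adj T a c -> reflex T a c = (c == b).
  move=> ab rb ac; apply/idP/eqP => [rc|->//]; exact: (reflex_uniq triT ac rc ab rb).
split=> //.
- by move=> u ul; apply/eqP; apply: (next_cycle cyx).
- by move=> u ul; apply/eqP; apply: (next_cycle cyy).
- move=> u xu; apply: reflE => //; last exact: (outer_reflex triT ov).
  by rewrite (adjC plT) axl ?mem_head.
- by move=> u yu; apply: reflE => //; apply: (outer_reflex triT ox).
- move=> a u al au; have [_ _ r] := side a al; apply: reflE => //; exact: ayl.
- exact: ch_outer ch.
Qed.

Lemma iso_refl n (T : emb n) : iso T T.
Proof.
exists 1%g; split=> *; rewrite ?perm1 //.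
by rewrite -surjective_pairing sface_refl.
Qed.

Lemma iso_trans n (A B C : emb n) : is_plane B -> iso A B -> iso B C -> iso A C.
Proof.
move=> plB [f [fa fr fx fo]] [g [ga gr gx go]]; exists (f * g)%g; split.
- by move=> u v; rewrite !permM ga fa.
- by move=> v u vu; rewrite !permM gr ?fa // fr.
- by move=> v u vu; rewrite !permM gx ?fa // fx.
rewrite !permM; apply: sface_trans go _.
have gn d k : d \in darts B ->
    iter k (nxt C) (g d.1, g d.2) = (g (iter k (nxt B) d).1, g (iter k (nxt B) d).2) /\ iter k (nxt B) d \in darts B.
  move=> dD; elim: k => //= k [-> kD]; split; last exact: nxt_darts.
  by rewrite /nxt /= gr // (adjC plB) -in_darts -surjective_pairing.
have oD := odartP plB; rewrite /sface in fo *; rewrite -[f _]/((f (odart A).1, f (odart A).2).1).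
rewrite -[f (odart A).2]/((f (odart A).1, f (odart A).2).2) -(iter_findex fo).
by have [<- _] := gn _ (findex (nxt B) (odart B) (f (odart A).1, f (odart A).2)) oD; apply: fconnect_iter.
Qed.

(** Vertices correspond by their positions in the two lists. *)
Lemma canonical_iso n (T U : emb n) x y l x' y' l' :
  canonical T x y l -> canonical U x' y' l' -> iso T U.
Proof.
move=> cT cU; set V := [:: x, y & l]; set V' := [:: x', y' & l'].
have uV : uniq V := cn_uniq cT. have uV' : uniq V' := cn_uniq cU.
have sV (W : seq 'I_n) : uniq W -> (forall u, u \in W) -> size W = n.
  by move=> /card_uniqP <- aW; rewrite -[RHS]card_ord; apply: eq_card => u; rewrite aW.
have szV : size V = n := sV V uV (cn_all cT).
have szV' : size V' = n := sV V' uV' (cn_all cU).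
pose g u := nth x' V' (index u V).
have idx u : index u V < size V' by rewrite -(etrans szV (esym szV')) index_mem (cn_all cT).
have g_inj : injective g.
  move=> u w /eqP; rewrite nth_uniq // => /eqP e.
  by rewrite -(nth_index x (cn_all cT u)) e nth_index // (cn_all cT).
pose f := perm g_inj; have fE u : f u = g u by rewrite permE.
have fV : map f V = V'.
  apply: (@eq_from_nth _ x'); rewrite size_map szV ?szV' // => i iV.
  by rewrite (nth_map x) ?szV // fE /g index_uniq ?szV.
have [fx [fy fl]] : f x = x' /\ f y = y' /\ map f l = l' by case: fV.
have f_inj : injective f := @perm_inj _ f.
have memf (W : seq 'I_n) u : (f u \in map f W) = (u \in W) by rewrite (mem_map f_inj).
have eqf u w : (f u == f w) = (u == w) by rewrite (inj_eq f_inj).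
have Vcase u : [\/ u = x, u = y | u \in l].
  by have := cn_all cT u; rewrite !in_cons => /or3P[/eqP|/eqP|]; [constructor 1|constructor 2|constructor 3].
have lU u : u \in l -> f u \in l' by rewrite -fl memf.
have adjf u v : adj U (f u) (f v) = adj T u v.
  case: (Vcase u) => [->|->|ul].
  - by rewrite fx (cn_adjx cU) (cn_adjx cT) -fy -fl -map_cons memf.
  - by rewrite fy (cn_adjy cU) (cn_adjy cT) -fx -fl -map_cons memf.
  - by rewrite (cn_adjl cU _ (lU u ul)) (cn_adjl cT _ ul) -fx -fy !eqf.
have plT := tri_plane (cn_tri cT); have plU := tri_plane (cn_tri cU).
have uyl : uniq (y :: l) by move: uV => /andP[].
have uxl : uniq (x :: l) by move: uV => /= /and3P[]; rewrite in_cons negb_or => /andP[_ ->].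
exists f; split=> //.
- move=> v u; case: (Vcase v) => [->|->|vl] vu; rewrite ?fx ?fy.
  + rewrite (cn_adjx cT) in vu.
    have wl : Defs.rot T x u \in y :: l by rewrite -(cn_adjx cT) adj_rot // (cn_adjx cT).
    have -> : u = next (y :: l) (Defs.rot T x u).
      apply: (adj_rot_inj plT (v := x)); rewrite ?(cn_adjx cT) ?mem_next //.
      by rewrite (cn_rotx cT).
    rewrite -(next_map f_inj uyl) map_cons fy fl (cn_rotx cU).
      by rewrite (cn_rotx cT).
    by rewrite -fy -fl -map_cons memf.
  + rewrite (cn_adjy cT) in vu; rewrite (cn_roty cT) // -(next_map f_inj uxl) map_cons fx fl.
    by rewrite (cn_roty cU) // -fx -fl -map_cons memf.
  + have [r1 r2] := cn_rotl cT vl; have [r1' r2'] := cn_rotl cU (lU v vl).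
    move: vu; rewrite (cn_adjl cT) // => /orP[]/eqP->; rewrite ?fx ?fy.
      by rewrite r1' r1 fy.
    by rewrite r2' r2 fx.
- move=> v u vu; have vu' : adj U (f v) (f u) by rewrite adjf.
  case: (Vcase v) => [e|e|vl].
  + rewrite e fx in vu vu' *; rewrite (cn_reflx cU) // (cn_reflx cT) // -fx -fl.
    by rewrite (_ : head _ _ = f (head x l)) ?eqf //; case: (l).
  + by rewrite e fy in vu vu' *; rewrite (cn_refly cU) // (cn_refly cT) // -fx eqf.
  + by rewrite (cn_refll cU) ?lU // (cn_refll cT) // -fy eqf.
- by rewrite (cn_outer cU) (cn_outer cT) /= fx fy sface_refl.
Qed.

Lemma flip_fstep n (T U : emb n) : tri4PPT T -> tri4PPT U -> flip T U \/ flip U T -> fstep T U.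
Proof. by move=> tT tU f; exists T, U; split=> //; apply: iso_refl. Qed.

Lemma freach_flips n i k (A T U : emb n) : freach i A T -> flips k T U -> freach (i + k) A U.
Proof.
move=> r f; elim: f i r => [T'|{}k T' W U' tT tW f _ IH] i r; first by rewrite addn0.
rewrite -addSnnS; apply: IH; exists T'; split=> //.
by apply: flip_fstep => //; left.
Qed.

(** [fstep] admits a flip in either direction, so a sequence can be read backwards. *)
Lemma freach_flips_back n i k (A T U : emb n) : freach i A U -> flips k T U -> freach (i + k) A T.
Proof.
move=> r f; elim: f i r => [T'|{}k T' W U' tT tW f _ IH] i r; first by rewrite addn0.
rewrite addnS; exists W; split; first exact: IH.
by apply: flip_fstep => //; right.
Qed.

Lemma freach_iso n k (A B C : emb n) : is_plane B -> freach k A B -> iso B C -> iso C B -> freach k A C.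
Proof.
move=> plB; case: k => [|k] /=; first by move=> h bc _; apply: iso_trans h bc.
case=> W [aw [T1 [U1 [i1 i2 t1 u1 f]]]] bc cb; exists W; split=> //.
by exists T1, U1; split=> //; apply: iso_trans cb i2.
Qed.

(** The number of flips is at most 4n + n (6n + 2), well within the bound. *)
Lemma reach_canonical n (T : emb n) : 3 <= n -> tri4PPT T ->
  exists k U x y l, [/\ k <= 20 * n ^ 2, flips k T U & canonical U x y l].
Proof.
move=> n3 triT; have [k1 [U1 [X [x [y [z [u [k1n f1 ch i3]]]]]]]] := initial triT.
have [|k2 [U2 [X2 [s [k2n f2 tm]]]]] := @reach_terminal n n U1 X x y z [::] u ch i3.
  by rewrite leq_addl.
exists (k1 + k2), U2, x, y, (z :: s); split.
- by rewrite -mulnn; move: k1n k2n; nia.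
- exact: flips_cat f1 f2.
- exact: terminal_canonical tm.
Qed.

Theorem theorem2 :
  exists C : nat, forall (n : nat), 3 <= n ->
    forall T U : emb n, tri4PPT T -> tri4PPT U ->
      exists k, k <= C * n ^ 2 /\ freach k T U.
Proof.
exists 40 => n n3 T U triT triU.
have [k1 [T' [x [y [l [k1n f1 cT]]]]]] := reach_canonical n3 triT.
have [k2 [U' [x' [y' [l' [k2n f2 cU]]]]]] := reach_canonical n3 triU.
exists (k1 + k2); split; first by rewrite (_ : 40 = 20 + 20) // mulnDl leq_add.
apply: (freach_flips_back _ f2).
apply: (freach_iso (tri_plane (cn_tri cT)) _ (canonical_iso cT cU) (canonical_iso cU cT)).
exact: (freach_flips (iso_refl T : freach 0 T T) f1).
Qed.
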